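(* Let $x$ be a literal (e.g. $x=x_1$), viewed as the literal function $(x_1,\dots,x_n)\mapsto x$. Then, as $n\to\infty$, \[\mathbb{P}_n(x)\sim\mu_n(\mathcal{X}),\] where $\mathcal{X}$ is the family of simple $x$ trees on $n$ variables.
   Context: Fix $n\ge1$. An associative tree is a rooted plane tree in which every internal node has at least two children, internal nodes are labelled by $\land$ or $\lor$ with no internal node having the same label as its parent, and leaves are labelled by literals from $\{x_1,\bar x_1,\dots,x_n,\bar x_n\}$; it computes a Boolean function of $x_1,\dots,x_n$. The size of a tree is its number of nodes; $A_{m,n}$ is the number of associative trees of size $m$. $\mathbb{P}_{m,n}(f)$ is the proportion of trees of size $m$ computing $f$ and $\mathbb{P}_n(f)=\lim_{m\to\infty}\mathbb{P}_{m,n}(f)$. For a family $\mathcal{T}$ of associative trees with $T_m$ members of size $m$, its limiting ratio is $\mu_n(\mathcal{T})=\lim_{m\to\infty}T_m/A_{m,n}$. A simple $x$ tree is an associative tree whose root has exactly two children, one being a single leaf labelled $x$ and the other a non-leaf subtree, where either the root is labelled $\lor$ and the non-leaf subtree computes the constant $\mathtt{True}$, or the root is labelled $\land$ and the non-leaf subtree computes the constant $\mathtt{False}$.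
   Formalization: In the definition of simple x tree the constants True and False are exchanged: root ∨ with a subtree computing False, or root ∧ with a subtree computing True. As worded, such trees compute a constant, not x, and the asymptotic equivalence fails. *)

(* Defs.v *)
From HB Require Import structures.
From mathcomp Require Import all_boot all_order all_algebra.
From mathcomp Require Import finmap.
From mathcomp Require Import all_classical all_reals all_analysis.

Set Implicit Arguments.
Unset Strict Implicit.
Unset Printing Implicit Defensive.

Import Order.TTheory GRing.Theory Num.Theory.
Import numFieldNormedType.Exports.

Local Open Scope classical_set_scope.
Local Open Scope ring_scope.

Variant connective := Conj | Disj.

Definition connective_to_bool (c : connective) : bool :=
  if c is Conj then true else false.
Definition bool_to_connective (b : bool) : connective :=
  if b then Conj else Disj.
Lemma connective_to_boolK : cancel connective_to_bool bool_to_connective.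
Proof. by case. Qed.
HB.instance Definition _ :=
  Countable.copy connective (can_type connective_to_boolK).

(* [(i, true)] is the variable x_i, [(i, false)] its negation; the variables
   are numbered from 0. *)
Definition literal (n : nat) : Type := 'I_n * bool.

HB.instance Definition _ n := Finite.on (literal n).

(* Raw labelled plane trees; the constraints on arities and labels are the
   predicate [associative] below. *)
Inductive tree (n : nat) : Type :=
| Leaf of literal n
| Node of connective & seq (tree n).

HB.instance Definition _ n := gen_eqMixin (tree n).
HB.instance Definition _ n := gen_choiceMixin (tree n).

Definition is_leaf n (t : tree n) : bool := if t is Leaf _ then true else false.

Definition root_label n (t : tree n) : option connective :=
  if t is Node c _ then Some c else None.

Fixpoint associative n (t : tree n) : bool :=
  match t with
  | Leaf _ => true
  | Node c ts =>
      [&& (1 < seq.size ts)%N,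
          all (fun s => root_label s != Some c) ts
        & all (@associative n) ts]
  end.

Fixpoint nodes n (t : tree n) : nat :=
  match t with
  | Leaf _ => 1
  | Node _ ts => (sumn (map (@nodes n) ts)).+1
  end.

Definition assignment (n : nat) : Type := {ffun 'I_n -> bool}.

HB.instance Definition _ n := Finite.on (assignment n).

Definition boolfun (n : nat) : Type := {ffun assignment n -> bool}.

HB.instance Definition _ n := Finite.on (boolfun n).

Definition eval_literal n (l : literal n) (v : assignment n) : bool :=
  if l.2 then v l.1 else ~~ v l.1.

Fixpoint eval n (v : assignment n) (t : tree n) : bool :=
  match t with
  | Leaf l => eval_literal l v
  | Node Conj ts => all (eval v) ts
  | Node Disj ts => has (eval v) ts
  end.

Definition fun_of_tree n (t : tree n) : boolfun n :=
  [ffun v : assignment n => eval v t].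
Definition literal_fun n (l : literal n) : boolfun n :=
  [ffun v : assignment n => eval_literal l v].
Definition const_fun n (b : bool) : boolfun n :=
  [ffun _ : assignment n => b].

(* [fset_set] is the empty set on infinite sets; [finite_sized] below shows
   that this never happens here. *)
Definition sized n (F : set (tree n)) (m : nat) : set (tree n) :=
  [set t | [/\ associative t, F t & nodes t = m]].
Definition count_sized n (F : set (tree n)) (m : nat) : nat :=
  #|` fset_set (sized F m)|.

Definition tree_ratio n (R : realType) (F : set (tree n)) (m : nat) : R :=
  (count_sized F m)%:R / (count_sized [set: tree n] m)%:R.

Definition limiting_ratio n (R : realType) (F : set (tree n)) : R :=
  limn (tree_ratio R F).

Definition computing n (f : boolfun n) : set (tree n) :=
  [set t | fun_of_tree t = f].

Definition proportion n (R : realType) (f : boolfun n) (m : nat) : R :=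
  tree_ratio R (computing f) m.

Definition limiting_probability n (R : realType) (f : boolfun n) : R :=
  limn (proportion R f).

Definition neutral (c : connective) : bool :=
  if c is Conj then true else false.

(* The non-leaf child computes the constant that is neutral for the label of
   the root, so that the tree computes [x] (see [simple_tree_computes]). With
   the other constant, the tree would compute that constant instead. *)
Definition simple_tree n (x : literal n) : set (tree n) :=
  [set t | associative t /\
     exists (c : connective) (s : tree n),
       [/\ ~~ is_leaf s,
           fun_of_tree s = const_fun n (neutral c)
         & t = Node c [:: Leaf x; s] \/ t = Node c [:: s; Leaf x]]].

Lemma simple_tree_computes n (x : literal n) (t : tree n) :
  simple_tree x t -> fun_of_tree t = literal_fun x.
Proof.
move=> [_ [c [s [_ /ffunP sc tE]]]]; apply/ffunP => v.
have := sc v; rewrite !ffunE => {}sc.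
by case: tE => ->; case: c sc => /= ->; rewrite ?andbT ?orbF.
Qed.

Lemma finite_sized n (F : set (tree n)) (m : nat) : finite_set (sized F m).
Proof.
have nodes_gt0 (t : tree n) : (0 < nodes t)%N by case: t.
suff H k : finite_set [set t : tree n | (nodes t <= k)%N].
  by apply: sub_finite_set (H m) => t [_ _ <-] /=.
elim: k => [|k IHk].
  by apply: sub_finite_set (finite_set0 _) => t /=; rewrite leqn0 gtn_eqF.
have forests j :
    finite_set [set ts : seq (tree n) |
      all (fun t => nodes t <= k)%N ts /\ (seq.size ts <= j)%N].
  elim: j => [|j IHj].
    apply: sub_finite_set (finite_set1 [::]) => ts /= [_].
    by rewrite leqn0 => /nilP.
  pose cns := [set t :: ts | t in [set t : tree n | (nodes t <= k)%N] &
     ts in [set ts : seq (tree n) |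
        all (fun t => nodes t <= k)%N ts /\ (seq.size ts <= j)%N]].
  have fc : finite_set ([set [::]] `|` cns).
    by rewrite finite_setU; split; [exact: finite_set1|exact: finite_image2].
  apply: sub_finite_set fc => -[|t ts] /= [+ +]; first by left.
  by move=> /andP[tk tsk] tsj; right; exists t => //; exists ts.
pose lfs := [set Leaf l | l in [set: literal n]].
pose nds := [set Node c ts | c in [set: connective] & ts in
  [set ts : seq (tree n) |
     all (fun t => nodes t <= k)%N ts /\ (seq.size ts <= k)%N]].
have fl : finite_set (lfs `|` nds).
  rewrite finite_setU; split; first exact/finite_image/finite_finset.
  apply: finite_image2; last exact: forests.
  have : finite_set [set` [:: Conj; Disj]] by exact: finite_seq.
  by apply: sub_finite_set => -[] _ /=; rewrite !inE eqxx ?orbT.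
apply: sub_finite_set fl => -[l|c ts] /=; first by left; exists l.
rewrite ltnS => h; right; exists c => //; exists ts => //; split.
  elim: ts h => //= t ts IH h; rewrite IH ?andbT.
    exact: leq_trans (leq_addr _ _) h.
  exact: leq_trans (leq_addl _ _) h.
apply: leq_trans h; elim: ts => //= t ts IH.
by rewrite -add1n leq_add.
Qed.

(* Main.v *)
Require Import Defs.
From mathcomp Require Import all_boot all_order all_algebra.
From mathcomp Require Import finmap.
From mathcomp Require Import all_classical all_reals all_analysis.
From mathcomp Require Import ring lra zify.

(* Let N = 2n be the number of literals and s = sqrt N. The forests of children
   of a node have the generating function V with
   V = 1 + z + (N - 2) z V + z V^2, whose radius of convergence is
   rho = 1 / (s (s + 2)), and V(rho) = 1 + s. The square root of its discriminant
   satisfies a first order differential equation, which yields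
   V_(m+1) / V_m -> 1 / rho; with the equation itself this gives
   (V * V)_m / V_m -> 2 V(rho), so that in a large product only one factor is
   large.

   Convergence of proportions: refine the numbers of children and of forests by
   the Boolean function computed, and consider the l^1 oscillation, over these
   functions, of the frequencies at pairs of large sizes. As one child is large,
   passing from children to forests and from forests to the next level of
   children multiplies the oscillation by at most rho (V(rho)^2 - 1) = 1, and by
   strictly less because a small child computing an absorbing constant erases
   the value of the large one. Hence the oscillation vanishes.

   Asymptotics: a tree computing the literal x has root children that all imply
   x up to duality. Giving each node below the root the representative literal
   consisting of itself or of its first leaf, one sees that an inner child that
   implies x and is not constant contains a child without leaves, one
   represented by x, or two with opposite representatives, not both leaves. Up
   to a common factor, this bounds the limiting ratio of the trees that compute x
   but are not simple by O(rho s^(-5)), whereas that of the simple ones is at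
   least of order rho^3: among the leaf children of a large
   node there are two opposite literals with probability bounded below. *)

Set Implicit Arguments.
Unset Strict Implicit.
Unset Printing Implicit Defensive.

Import Order.TTheory GRing.Theory Num.Theory.
Import numFieldNormedType.Exports.
Local Open Scope classical_set_scope.
Local Open Scope ring_scope.

(** * Formal power series *)

Section Convolution.
Variable R : realType.
Implicit Types (f g h : nat -> R) (m : nat).

(** The two limits make different demands. For fixed [n] only the existence of limits in the size is
    needed, without any rate, so the contraction factor of the oscillation argument need not be
    uniform in [n]. As [n] grows all bounds must be uniform, hence explicit powers of [q = 1 / s]:
    up to constants, an inner child weighs [q], a prescribed leaf [q ^+ 2], an arbitrary forest
    [q^-1]. Simple trees have order at least [rho ^+ 3], that is [q ^+ 6], the others at most
    [q ^+ 7]; the relative error is [O(1 / s)], and only one power of [q] is to spare when the trees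
    computing [x] are decomposed. Forests rather than trees are the basic objects because
    concatenation multiplies generating functions: with [a] the series of children, [V = 1 + a V]
    and [(1 + z) a = (N - 1) z + z V]. All counts are compared with [V m] through ratios, so that
    subexponentiality plays the part of a square root singularity. *)

Definition cauchy_prod f g m : R := \sum_(i < m.+1) f i * g (m - i)%N.
Definition delta0 m : R := (m == 0%N)%:R.
(* Multiplication by the formal variable. *)
Definition sh f m : R := if m is k.+1 then f k else 0.

Lemma cauchyC f g m : cauchy_prod f g m = cauchy_prod g f m.
Proof.
rewrite /cauchy_prod (reindex_inj rev_ord_inj) /=; apply: eq_bigr => i _.
have im : (i <= m)%N by rewrite -ltnS.
by rewrite subSS subKn// mulrC.
Qed.

Lemma eq_cauchy f f' g g' m : (forall i, (i <= m)%N -> f i = f' i) ->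
  (forall i, (i <= m)%N -> g i = g' i) -> cauchy_prod f g m = cauchy_prod f' g' m.
Proof.
move=> ff gg; apply: eq_bigr => i _.
by rewrite ff ?gg ?leq_subr// -ltnS.
Qed.

Lemma cauchyDr f g h m : cauchy_prod f (fun k => g k + h k) m = cauchy_prod f g m + cauchy_prod f h m.
Proof. by rewrite /cauchy_prod -big_split; apply: eq_bigr => i _; rewrite mulrDr. Qed.

Lemma cauchyZr f (c : R) g m : cauchy_prod f (fun k => c * g k) m = c * cauchy_prod f g m.
Proof. by rewrite /cauchy_prod mulr_sumr; apply: eq_bigr => i _; rewrite mulrCA. Qed.

Lemma cauchy1r f m : cauchy_prod f delta0 m = f m.
Proof.
rewrite /cauchy_prod big_ord_recr /= subnn /delta0 eqxx mulr1 big1 ?add0r// => i _.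
by rewrite subn_eq0 leqNgt ltn_ord mulr0.
Qed.

Lemma cauchy_shr f g m : cauchy_prod f (sh g) m = sh (cauchy_prod f g) m.
Proof.
case: m => [|m]; first by rewrite /cauchy_prod big_ord1 /= mulr0.
rewrite /cauchy_prod big_ord_recr /= subnn mulr0 addr0; apply: eq_bigr => i _.
by rewrite subSn// -ltnS.
Qed.

Lemma cauchy_ge0 f g : (forall i, 0 <= f i) -> (forall i, 0 <= g i) ->
  forall m, 0 <= cauchy_prod f g m.
Proof. by move=> f0 g0 m; apply: sumr_ge0 => i _; rewrite mulr_ge0. Qed.

Lemma cauchy_mono f f' g g' m :
  (forall i, 0 <= f i <= f' i) -> (forall i, 0 <= g i <= g' i) ->
  cauchy_prod f g m <= cauchy_prod f' g' m.
Proof.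
move=> ff gg; apply: ler_sum => i _.
have /andP[f0 ff'] := ff i; have /andP[g0 gg'] := gg (m - i)%N.
exact: ler_pM.
Qed.

(** [k%:R * f k] is the coefficient of [z f'], so this is [2 f (z f') = z (f ^ 2)']; it comes from
    pairing the weights [i] and [m - i]. *)
Lemma cauchy_euler f m : cauchy_prod f (fun k => k%:R * f k) m *+ 2 = m%:R * cauchy_prod f f m.
Proof.
rewrite mulr2n {1}cauchyC /cauchy_prod -big_split mulr_sumr; apply: eq_bigr => i _ /=.
have im : (i <= m)%N by rewrite -ltnS.
by rewrite natrB//; ring.
Qed.

(** Lets a factor with constant term 1 be cancelled; in [defect_eq0] that factor is [sigma]. *)
Lemma cauchy_eq0 f g : f 0%N = 1 -> (forall m, cauchy_prod f g m = 0) ->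
  forall m, g m = 0.
Proof.
move=> f0 fg m; elim/ltn_ind: m => m IH.
have := fg m; rewrite cauchyC /cauchy_prod big_ord_recr /= subnn f0 mulr1 big1 ?add0r//.
by move=> i _; rewrite IH ?mul0r.
Qed.

End Convolution.

Lemma perturbed_contraction_cvg0 (R : realType) (th : R) (e d : nat -> R) :
  0 <= th < 1 -> (forall m, 0 <= e m) -> d @ \oo --> 0 ->
  (\forall m \near \oo, e m.+1 <= th * e m + d m) -> e @ \oo --> 0.
Proof.
move=> /andP[th0 th1] e0 /cvgrPdist_le dc hyp.
apply/cvgrPdist_le => eps eps0.
have th'0 : 0 < 1 - th by rewrite subr_gt0.
(* With this bound on the perturbation, [eps / 2] is the fixed point of the perturbed recursion, so
   the excess over it decays like [th ^+ k]. *)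
have del0 : 0 < eps / 2 * (1 - th) by rewrite mulr_gt0// divr_gt0.
have [M _ HM] : \forall m \near \oo,
    e m.+1 <= th * e m + eps / 2 * (1 - th).
  near=> m; apply: (@le_trans _ _ (th * e m + d m)); first by near: m.
  rewrite lerD2l (le_trans (ler_norm _))//.
  have : `|0 - d m| <= eps / 2 * (1 - th) by near: m; exact: dc.
  by rewrite sub0r normrN.
have bnd k : e (M + k)%N <= th ^+ k * e M + eps / 2.
  elim: k => [|k IH]; first by rewrite addn0 expr0 mul1r lerDl ltW// divr_gt0.
  rewrite addnS; apply: le_trans (HM _ _) _; first exact: leq_addr.
  apply: (@le_trans _ _ (th * (th ^+ k * e M + eps / 2) + eps / 2 * (1 - th))).
    by rewrite lerD2r ler_wpM2l.
  by rewrite exprS; lra.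
have geo : (fun k => th ^+ k * e M) @ \oo --> 0.
  rewrite -(mul0r (e M)); apply: cvgMl; apply: cvg_expr.
  by rewrite ger0_norm.
move/cvgrPdist_le: geo => geo.
near=> m; rewrite sub0r normrN ger0_norm//.
have Mm : (M <= m)%N by near: m; exact: nbhs_infty_ge.
rewrite -(subnKC Mm); apply: le_trans (bnd _) _.
have : `|0 - th ^+ (m - M) * e M| <= eps / 2.
  near: m; have [|K _ HK] := geo (eps / 2); first by rewrite divr_gt0.
  exists (K + M)%N => // m /= Km; apply: HK => /=.
  by rewrite leq_subRL ?(leq_trans _ Km)// ?leq_addl// addnC.
rewrite sub0r normrN => /(le_trans (ler_norm _)) h.
by move: h; set A := _ * e M => h; lra.
Unshelve. all: by end_near.
Qed.

(** * Growth of the number of forests *)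

Section Growth.
Variables (R : realType) (N : R) (V : nat -> R).
Hypotheses (N2 : 2 <= N) (V0 : V 0%N = 1).
Hypothesis Vrec :
  forall m, V m.+1 = cauchy_prod V V m + (N - 2) * V m + delta0 R m.

(** The discriminant of [z V^2 - (1 - (N - 2) z) V + 1 + z = 0] is [D = 1 - 2 N z + kappa z^2]; with
    [s = sqrt N] it factors as [(1 - (N + 2 s) z) (1 - (N - 2 s) z)]. *)
Let kappa := N ^+ 2 - 4 * N.

(* The square root of the discriminant of the quadratic equation of [V]. *)
Let sigma m : R := (delta0 R m + (2 - N) * sh (delta0 R) m) + (- 2) * sh V m.

Let sigma_sq m : cauchy_prod sigma sigma m =
  delta0 R m - 2 * N * sh (delta0 R) m + kappa * sh (sh (delta0 R)) m.
Proof.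
have VsE k : cauchy_prod V sigma k =
    - V k + (N - 2) * sh V k + 2 * delta0 R k + 2 * sh (delta0 R) k.
  rewrite 2!cauchyDr !cauchyZr cauchy1r !cauchy_shr.
  case: k => [|k] /=; first by rewrite /delta0 /= V0; ring.
  by rewrite Vrec cauchy1r; rewrite /delta0/=; ring.
rewrite 2!cauchyDr !cauchyZr cauchy1r !cauchy_shr /kappa.
case: m => [|m] /=; first by rewrite /sigma /= /delta0; ring.
rewrite cauchy1r cauchyC VsE /sigma /=.
case: m => [|m] /=; first by rewrite V0 /delta0/=; ring.
by rewrite /delta0 /=; ring.
Qed.

(** Coefficients of [D sigma' - (D' / 2) sigma], where [D = sigma ^ 2] is the discriminant. *)
Let defect m : R := ((m.+1%:R * sigma m.+1 + (- (2 * N)) * (m%:R * sigma m)) +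
  N * sigma m) + (kappa * sh (fun k => k%:R * sigma k) m + (- kappa) * sh sigma m).

(** Multiplied by [sigma] it becomes [D D' / 2 - D' D / 2]; the constant term of [sigma] is 1, so
    the factor cancels. *)
Let defect_eq0 m : defect m = 0.
Proof.
apply: (cauchy_eq0 (f := sigma)) => {m} [|m]; first by rewrite /sigma /delta0/=; ring.
have eulerE k : cauchy_prod sigma (fun k => k%:R * sigma k) k =
    k%:R * cauchy_prod sigma sigma k / 2.
  by have := cauchy_euler sigma k; lra.
have derE k : cauchy_prod sigma (fun k => k.+1%:R * sigma k.+1) k =
    k.+1%:R * cauchy_prod sigma sigma k.+1 / 2.
  rewrite -eulerE.
  rewrite -[LHS]/(sh (cauchy_prod sigma (fun k => k.+1%:R * sigma k.+1)) k.+1).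
  rewrite -cauchy_shr; apply: eq_cauchy => // -[|i] _ //=.
  by rewrite mul0r.
rewrite 4!cauchyDr !cauchyZr derE eulerE !cauchy_shr.
case: m => [|m] /=; rewrite ?eulerE !sigma_sq /kappa /=.
  by rewrite /delta0 /=; field.
by case: m => [|[|[|m]]] /=; rewrite /delta0 /=; field.
Qed.

(** In degree at least 2, [sigma] is [-2 z V], and the differential equation becomes a recurrence
    for [V] that is linear, unlike [Vrec]; this gives access to the ratios of consecutive terms. *)
Lemma growth_recurrence k : (1 <= k)%N ->
  k.+2%:R * V k.+1 =
  N * (2 * k%:R + 1) * V k - (N ^+ 2 - 4 * N) * (k%:R - 1) * V k.-1.
Proof.
case: k => [//|k] _; have := defect_eq0 k.+2.
rewrite /defect /sigma /= /delta0 /=.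
case: k => [|k] /=; rewrite /kappa.
  by rewrite V0; lra.
rewrite -!natr1; lra.
Qed.

Lemma growth_ge0 m : 0 <= V m.
Proof.
elim/ltn_ind: m => -[|m] IH; first by rewrite V0.
rewrite Vrec !addr_ge0// ?ler0n//; last first.
  by rewrite mulr_ge0 ?subr_ge0// IH.
by apply: sumr_ge0 => i _; rewrite mulr_ge0// IH// ltnS leq_subr.
Qed.

Lemma growth_leS m : V m * N <= V m.+1.
Proof.
elim: m => [|m IH].
  by rewrite Vrec V0 /cauchy_prod big_ord1 V0 /delta0/=; lra.
have := growth_recurrence (ltn0Sn m) => /=.
rewrite -!natr1 => rec.
have m0 : 0 <= m%:R :> R by [].
have V1 := growth_ge0 m; have V2 := growth_ge0 m.+1.
have m3 : 0 < m%:R + 3 :> R by rewrite ltr_wpDl.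
rewrite -(ler_pM2l m3).
have -> : (m%:R + 3) * V m.+2 = (m%:R + 1 + 1 + 1) * V m.+2 by ring.
rewrite rec.
have [N4|N4] := lerP 4 N.
  have := ler_wpM2l (mulr_ge0 m0 (eqbRL (subr_ge0 _ _) N4)) IH.
  by have := mulr_ge0 m0 V2; lra.
have N0 : 0 <= N by apply: le_trans N2.
have N4' : 0 <= 4 - N by rewrite subr_ge0 ltW.
have := mulr_ge0 (mulr_ge0 (mulr_ge0 N0 N4') m0) V1.
have := mulr_ge0 (mulr_ge0 N0 m0) V2.
lra.
Qed.

Lemma growth_gt0 m : 0 < V m.
Proof.
elim: m => [|m IH]; first by rewrite V0.
by apply: lt_le_trans (growth_leS m); rewrite mulr_gt0// (lt_le_trans _ N2).
Qed.

End Growth.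

(** * Values of power series at a point, as limits of partial sums *)

Section PartialSums.
Variable R : realType.
Implicit Types (f g : nat -> R) (rho : R).

Definition psum f M : R := \sum_(i < M) f i.

Definition wsum rho f (w : R) := psum (fun i => f i * rho ^+ i) @ \oo --> w.

Lemma psumS f M : psum f M.+1 = psum f M + f M.
Proof. by rewrite /psum big_ord_recr. Qed.

Lemma psum_nd f : (forall i, 0 <= f i) -> nondecreasing_seq (psum f).
Proof. by move=> f0; apply/nondecreasing_seqP => M; rewrite psumS lerDl. Qed.

Lemma psum_cauchy f g M : psum (cauchy_prod f g) M = \sum_(i < M) f i * psum g (M - i)%N.
Proof.
elim: M => [|M IH]; first by rewrite /psum !big_ord0.
rewrite psumS IH /cauchy_prod [in RHS]big_ord_recr /= subSnn [in LHS]big_ord_recr /=.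
rewrite subnn {3}/psum big_ord1 addrA; congr (_ + _).
rewrite -big_split; apply: eq_bigr => i _ /=.
by rewrite subSn ?psumS ?mulrDr// ltnW.
Qed.

Lemma psum_cauchy_le f g M : (forall i, 0 <= f i) -> (forall i, 0 <= g i) ->
  psum (cauchy_prod f g) M <= psum f M * psum g M.
Proof.
move=> f0 g0; rewrite psum_cauchy mulr_suml; apply: ler_sum => i _.
by rewrite ler_wpM2l// psum_nd// leq_subr.
Qed.

(** The triangle [i + j < M] contains the square of side [M./2] and lies in the square of side [M];
    the terms being nonnegative, this squeezes the partial sums of a product. *)
Lemma psum_cauchy_ge f g M : (forall i, 0 <= f i) -> (forall i, 0 <= g i) ->
  psum f M./2 * psum g M./2 <= psum (cauchy_prod f g) M.
Proof.
move=> f0 g0; rewrite psum_cauchy.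
have -> : M = (M./2 + (M - M./2))%N by lia.
set A := M./2; set B := (M - A)%N.
have AB : (A <= B)%N by rewrite /B /A; lia.
have -> : (A + B)./2 = A by rewrite /B /A; lia.
rewrite big_split_ord /= -[leLHS]addr0; apply: lerD.
  rewrite mulr_suml; apply: ler_sum => i _.
  by rewrite ler_wpM2l// psum_nd//; have := ltn_ord i; lia.
by apply: sumr_ge0 => i _; rewrite mulr_ge0// /psum sumr_ge0.
Qed.

Lemma cauchy_weight rho f g m : cauchy_prod f g m * rho ^+ m =
  cauchy_prod (fun i => f i * rho ^+ i) (fun i => g i * rho ^+ i) m.
Proof.
rewrite /cauchy_prod mulr_suml; apply: eq_bigr => i _.
have im : (i <= m)%N by rewrite -ltnS.
have -> : rho ^+ m = rho ^+ i * rho ^+ (m - i) by rewrite -exprD subnKC.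
ring.
Qed.

Lemma cvg_half : (half : nat -> nat) @ \oo --> \oo.
Proof.
move=> A [K _ KA]; exists K.*2 => // m /= Km; apply: KA => /=; lia.
Qed.

Lemma wsum_cauchy rho f g a b : 0 <= rho ->
  (forall i, 0 <= f i) -> (forall i, 0 <= g i) ->
  wsum rho f a -> wsum rho g b -> wsum rho (cauchy_prod f g) (a * b).
Proof.
move=> r0 f0 g0 fa gb.
have F0 i : 0 <= f i * rho ^+ i by rewrite mulr_ge0// exprn_ge0.
have G0 i : 0 <= g i * rho ^+ i by rewrite mulr_ge0// exprn_ge0.
rewrite /wsum (_ : (fun i => _) = cauchy_prod (fun i => f i * rho ^+ i)
   (fun i => g i * rho ^+ i)); last by apply/funext => m; exact: cauchy_weight.
apply: (squeeze_cvgr (f := fun M => psum (fun i => f i * rho ^+ i) M./2 *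
    psum (fun i => g i * rho ^+ i) M./2)
  (h := fun M => psum (fun i => f i * rho ^+ i) M *
    psum (fun i => g i * rho ^+ i) M)).
- by near=> M; rewrite psum_cauchy_ge// psum_cauchy_le.
- by apply: cvgM; apply: (cvg_comp _ _ cvg_half).
- exact: cvgM.
Unshelve. all: by end_near.
Qed.

Lemma wsumD rho f g a b : wsum rho f a -> wsum rho g b ->
  wsum rho (fun m => f m + g m) (a + b).
Proof.
move=> fa gb; rewrite /wsum (_ : psum _ = psum (fun i => f i * rho ^+ i) \+
  psum (fun i => g i * rho ^+ i)); first exact: cvgD.
apply/funext => M; rewrite /= /psum -big_split; apply: eq_bigr => i _.
by rewrite mulrDl.
Qed.

Lemma wsumZ rho (c : R) f a : wsum rho f a ->
  wsum rho (fun m => c * f m) (c * a).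
Proof.
move=> fa; rewrite /wsum (_ : psum _ = fun M => c * psum (fun i => f i * rho ^+ i) M).
  exact: cvgMr.
by apply/funext => M; rewrite /psum mulr_sumr; apply: eq_bigr => i _; rewrite mulrA.
Qed.

Lemma wsum_delta0 rho : wsum rho (delta0 R) 1.
Proof.
rewrite /wsum -(cvg_shiftS (psum _)) (_ : (fun _ => _) = fun=> 1); first exact: cvg_cst.
apply/funext => M; rewrite /psum big_ord_recl /= /delta0 eqxx mul1r expr0 big1 ?addr0// => i _.
by rewrite mul0r.
Qed.

Lemma wsum_sh rho f a : wsum rho f a -> wsum rho (sh f) (rho * a).
Proof.
move=> fa; rewrite /wsum -(cvg_shiftS (psum _)).
rewrite (_ : (fun _ => _) = fun M => rho * psum (fun i => f i * rho ^+ i) M).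
  exact: cvgMr.
apply/funext => M; rewrite /psum big_ord_recl /= mul0r add0r mulr_sumr.
by apply: eq_bigr => i _; rewrite /bump /= add1n exprS mulrCA.
Qed.

Lemma wsum_unique rho f a b : wsum rho f a -> wsum rho f b -> a = b.
Proof. by move=> /(cvg_lim (@Rhausdorff R)) <- /(cvg_lim (@Rhausdorff R)). Qed.

Lemma eq_wsum rho f g a : f =1 g -> wsum rho f a -> wsum rho g a.
Proof. by move=> /funext ->. Qed.

Lemma psum_le_wsum rho f a M : 0 <= rho -> (forall i, 0 <= f i) ->
  wsum rho f a -> psum (fun i => f i * rho ^+ i) M <= a.
Proof.
move=> r0 f0 fa; rewrite -(cvg_lim (@Rhausdorff R) fa).
apply: nondecreasing_cvgn_le; last by apply: cvgP fa.
by apply: psum_nd => i; rewrite mulr_ge0// exprn_ge0.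
Qed.

Lemma ex_wsum rho f a : 0 <= rho -> (forall i, 0 <= f i) ->
  (forall M, psum (fun i => f i * rho ^+ i) M <= a) ->
  exists2 w, wsum rho f w & w <= a.
Proof.
move=> r0 f0 fa.
have F0 i : 0 <= f i * rho ^+ i by rewrite mulr_ge0// exprn_ge0.
have c : cvgn (psum (fun i => f i * rho ^+ i)).
  apply: nondecreasing_is_cvgn; first exact: psum_nd.
  by exists a => _ [M _ <-].
exists (limn (psum (fun i => f i * rho ^+ i))); first exact: c.
by apply: limr_le => //; near=> M.
Unshelve. all: by end_near.
Qed.

Lemma ex_wsum_le rho f g a : 0 <= rho -> (forall i, 0 <= f i <= g i) ->
  wsum rho g a -> exists2 w, wsum rho f w & w <= a.
Proof.
move=> r0 fg ga; apply: ex_wsum => // [i|M]; first by have /andP[] := fg i.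
have g0 i : 0 <= g i by have /andP[/le_trans h /h] := fg i.
apply: le_trans (psum_le_wsum M r0 g0 ga); apply: ler_sum => i _.
by rewrite ler_wpM2r ?exprn_ge0//; have /andP[] := fg i.
Qed.

End PartialSums.

Lemma cvg_finite_sum (R : realType) (I : finType) (P : pred I)
    (F : I -> nat -> R) (l : I -> R) :
  (forall i, P i -> F i @ \oo --> l i) ->
  (fun m => \sum_(i | P i) F i m) @ \oo --> \sum_(i | P i) l i.
Proof.
by move=> Fl; apply: cvg_big => //; exact: add_continuous.
Qed.

Lemma cauchy_split (R : realType) (f g : nat -> R) K m : (K.*2 <= m)%N ->
  cauchy_prod f g m = \sum_(i < K) f i * g (m - i)%N + \sum_(i < K) g i * f (m - i)%N
    + \sum_(K <= i < m.+1 - K) f i * g (m - i)%N.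
Proof.
move=> Km; rewrite /cauchy_prod -(big_mkord xpredT (fun i => f i * g (m - i)%N)).
rewrite (big_cat_nat (n := K)) //=; last by lia.
rewrite (big_cat_nat (m := K) (n := (m.+1 - K)%N)) //=; [|lia|lia].
rewrite big_mkord -addrA; congr (_ + _); rewrite addrC; congr (_ + _).
rewrite -{1}[(m.+1 - K)%N]add0n big_addn.
rewrite (_ : (m.+1 - _)%N = K); last by lia.
rewrite big_nat_rev big_mkord; apply: eq_bigr => i _ /=.
have iK := ltn_ord i; rewrite mulrC; congr (g _ * f _); lia.
Qed.

(** * Ratio asymptotics and subexponentiality of the forest numbers *)

Section Subexponential.
Variables (R : realType) (N : R) (V : nat -> R).
Hypotheses (N2 : 2 <= N) (V0 : V 0%N = 1).
Hypothesis Vrec :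
  forall m, V m.+1 = cauchy_prod V V m + (N - 2) * V m + delta0 R m.

Let s := Num.sqrt N.
Definition radius : R := (N + 2 * Num.sqrt N)^-1.
Let rho := radius.
Let v := 1 + s.

Let V_ge0 := growth_ge0 N2 V0 Vrec.
Let V_gt0 := growth_gt0 N2 V0 Vrec.
Let V_neq0 m : V m != 0. Proof. by rewrite gt_eqF. Qed.

Let N_gt0 : 0 < N. Proof. exact: lt_le_trans N2. Qed.
Let s_gt0 : 0 < s. Proof. by rewrite sqrtr_gt0. Qed.
Let s_sq : s ^+ 2 = N. Proof. by rewrite sqr_sqrtr// ltW. Qed.
Let L_gt0 : 0 < N + 2 * s. Proof. by rewrite addr_gt0// mulr_gt0. Qed.

Lemma radius_gt0 : 0 < radius.
Proof. by rewrite invr_gt0. Qed.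
Let rho_gt0 : 0 < rho := radius_gt0.
Let rho_ge0 : 0 <= rho := ltW rho_gt0.

Let harmonic_shift_cvg0 (c : R) : (fun k => c / (k%:R + 3)) @ \oo --> 0.
Proof.
rewrite -(mulr0 c); apply: cvgMr.
rewrite (_ : (fun _ => _) = (fun k => @harmonic R (k + 2)%N)).
  by rewrite (cvg_shiftn 2 (@harmonic R)); exact: cvg_harmonic.
by apply/funext => k; rewrite /= -addnS natrD.
Qed.

(** The recurrence says that the ratios follow [r |-> 2 N - (N ^+ 2 - 4 * N) / r] up to [O(1 / k)].
    The fixed points of this map are [N + 2 s] and [N - 2 s]; since [N <= r] by [growth_leS], the
    distance to [L = N + 2 s] is multiplied by at most [|N - 4| / L < 1]. *)
Lemma growth_ratio_cvg : (fun k => V k.+1 / V k) @ \oo --> rho^-1.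
Proof.
rewrite /rho /radius invrK -/s; set L := N + 2 * s.
pose th := `|N - 4| / L.
pose c := `|- 3 * N + 3 * (N ^+ 2 - 4 * N) / L|.
suff : (fun k => `|V k.+1 / V k - L|) @ \oo --> 0.
  by move/norm_cvg0P => h; apply/subr_cvg0.
apply: (@perturbed_contraction_cvg0 _ th _ (fun k => c / (k%:R + 3))) => //.
- rewrite divr_ge0 ?normr_ge0 ?ltW//= ltr_pdivrMr// mul1r ltr_norml /L.
  by have := N2; have := s_gt0; move=> ? ?; apply/andP; split; lra.
near=> k.
have k1 : (1 <= k)%N by near: k; exact: nbhs_infty_ge.
have rec : (k%:R + 3) * V k.+2 = N * (2 * (k%:R + 1) + 1) * V k.+1 -
     (N ^+ 2 - 4 * N) * (k%:R + 1 - 1) * V k.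
  have := growth_recurrence V0 Vrec (ltn0Sn k) => /=.
  by rewrite -!natr1; lra.
have kk0 : 0 <= k%:R :> R by [].
have k3 : 0 < k%:R + 3 :> R by rewrite ltr_wpDl.
set r := V k.+1 / V k.
have rN : N <= r by rewrite ler_pdivlMr// mulrC; exact: growth_leS.
have r0 : 0 < r by apply: lt_le_trans rN.
have r'E : V k.+2 / V k.+1 - L = (- 3 * N + 3 * (N ^+ 2 - 4 * N) / L) / (k%:R + 3)
   + (N ^+ 2 - 4 * N) * (r - L) / (L * r) * (k%:R / (k%:R + 3)).
  have -> : V k.+2 = (N * (2 * (k%:R + 1) + 1) * V k.+1 -
     (N ^+ 2 - 4 * N) * (k%:R + 1 - 1) * V k) / (k%:R + 3).
    by rewrite -rec; field; rewrite gt_eqF.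
  have -> : V k = V k.+1 / r by rewrite /r; field; rewrite !V_neq0.
  have LE : N ^+ 2 - 4 * N = L * (2 * N - L) by rewrite /L -s_sq; ring.
  by rewrite LE; field; rewrite !gt_eqF.
have k_le1 : `|k%:R / (k%:R + 3)| <= 1 :> R.
  by rewrite ger0_norm ?(divr_ge0 kk0 (ltW k3))// ler_pdivrMr// mul1r lerDl.
move: (k%:R / (k%:R + 3)) r'E k_le1 => t r'E k_le1.
have Lr_gt0 : 0 < L * r := mulr_gt0 L_gt0 r0.
rewrite r'E (le_trans (ler_normD _ _))// addrC lerD//; last first.
  by rewrite normrM normfV (gtr0_norm k3).
rewrite !normrM normfV (gtr0_norm Lr_gt0).
apply: (@le_trans _ _ (`|N ^+ 2 - 4 * N| * `|r - L| / (L * r))).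
  have Lr0 : 0 <= (L * r)^-1 by rewrite invr_ge0 ltW.
  by rewrite ler_piMr// !mulr_ge0.
have -> : N ^+ 2 - 4 * N = N * (N - 4) by ring.
rewrite normrM (gtr0_norm N_gt0) /th ler_pdivrMr//.
have -> : `|N - 4| / L * `|r - L| * (L * r) = r * (`|N - 4| * `|r - L|).
  by field; rewrite gt_eqF.
by rewrite -mulrA ler_wpM2r// mulr_ge0.
Unshelve. all: by end_near.
Qed.

Lemma growth_shift_cvg i : (fun m => V (m - i)%N / V m) @ \oo --> rho ^+ i.
Proof.
elim: i => [|i IH].
  rewrite expr0 (_ : (fun _ => _) = fun=> 1); first exact: cvg_cst.
  by apply/funext => m; rewrite subn0 divff.
rewrite -(cvg_shiftS (fun m => V (m - i.+1)%N / V m)) exprSr.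
rewrite (_ : (fun _ => _) = fun m => (V (m - i)%N / V m) * (V m.+1 / V m)^-1).
  apply: cvgM => //; rewrite -[X in _ --> X]invrK; apply: cvgV.
    by rewrite invr_neq0 ?gt_eqF.
  exact: growth_ratio_cvg.
by apply/funext => m /=; rewrite subSS; field; rewrite !V_neq0.
Qed.

(** By induction the partial sums stay below [v], a solution of the quadratic equation at [rho].
    Their limit solves the same equation, of which [v] is the only root. *)
Lemma wsum_growth : wsum rho V v.
Proof.
have rhoE : rho * (s * (s + 2)) = 1.
  rewrite /rho /radius -/s -s_sq.
  have -> : s * (s + 2) = s ^+ 2 + 2 * s by ring.
  by rewrite mulVf// s_sq gt_eqF.
have v0 : 0 <= v by rewrite addr_ge0// ltW.
have vE : 1 + rho * (v * v + (N - 2) * v + 1) = v.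
  apply/eqP; rewrite -subr_eq0 -s_sq /v; apply/eqP.
  have -> : 1 + rho * ((1 + s) * (1 + s) + (s ^+ 2 - 2) * (1 + s) + 1) - (1 + s) =
     s * (rho * (s * (s + 2)) - 1) by ring.
  by rewrite rhoE subrr mulr0.
have step : (fun m => V m) =1 (fun m => delta0 R m + sh (fun k =>
    (cauchy_prod V V k + (N - 2) * V k) + delta0 R k) m).
  by case=> [|m] /=; rewrite /delta0/= ?V0 ?addr0// add0r Vrec.
have bnd M : psum (fun i => V i * rho ^+ i) M <= v.
  elim: M => [|M IH]; first by rewrite /psum big_ord0.
  rewrite /psum big_ord_recl /= V0 mul1r expr0 -[leRHS]vE lerD2l.
  rewrite (_ : \sum_(i < M) _ = rho * (psum (cauchy_prod (fun i => V i * rho ^+ i)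
     (fun i => V i * rho ^+ i)) M + (N - 2) * psum (fun i => V i * rho ^+ i) M
     + psum (fun i => delta0 R i * rho ^+ i) M)); last first.
    rewrite /psum !mulr_sumr -!big_split mulr_sumr; apply: eq_bigr => i _ /=.
    by rewrite /bump /= add1n Vrec -cauchy_weight exprS; ring.
  rewrite ler_wpM2l//; apply: lerD; last first.
    by apply: psum_le_wsum (wsum_delta0 _) => // i; rewrite ler0n.
  apply: lerD; last by rewrite ler_wpM2l// subr_ge0.
  apply: le_trans (psum_cauchy_le _ _ _) _.
  - by move=> i; rewrite mulr_ge0// exprn_ge0.
  - by move=> i; rewrite mulr_ge0// exprn_ge0.
  have p0 : 0 <= psum (fun i => V i * rho ^+ i) M.
    by apply: sumr_ge0 => i _; rewrite mulr_ge0// exprn_ge0.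
  exact: ler_pM.
have [w Vw wv] := ex_wsum rho_ge0 V_ge0 bnd.
suff <- : w = v by [].
have := wsumD (wsum_delta0 rho) (wsum_sh (wsumD (wsumD
  (wsum_cauchy rho_ge0 V_ge0 V_ge0 Vw Vw) (@wsumZ _ _ (N - 2) _ _ Vw)) (wsum_delta0 rho))).
move=> /(eq_wsum (fsym step)) /(wsum_unique Vw) wE.
(* [rho] is a double root of the discriminant. *)
have : rho * (w - v) ^+ 2 = 0.
  have -> : rho * (w - v) ^+ 2 = (1 + rho * (w * w + (N - 2) * w + 1) - w)
     - (1 + rho * (v * v + (N - 2) * v + 1) - v)
     + (w - v) * (1 - rho * (N - 2 + 2 * v)) by ring.
  rewrite -wE vE !subrr add0r.
  have -> : N - 2 + 2 * v = s * (s + 2) by rewrite /v -s_sq; ring.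
  by rewrite rhoE subrr mulr0.
move/eqP; rewrite mulf_eq0 gt_eqF//= sqrf_eq0 subr_eq0 => /eqP //.
Qed.

Definition ratio (f : nat -> R) m : R := f m / V m.

Definition dominated (C : R) (f : nat -> R) := forall m, 0 <= f m <= C * V m.

Lemma ratio_bound C f : dominated C f -> forall m, 0 <= ratio f m <= C.
Proof.
move=> fC m; have /andP[f0 fm] := fC m.
by rewrite /ratio divr_ge0//= ler_pdivrMr.
Qed.

Lemma dominated_cst C f : dominated C f -> 0 <= C.
Proof. by move=> /(_ 0%N); rewrite V0 mulr1 => /andP[/le_trans]; apply. Qed.

Lemma ratio_sh f m : ratio (sh f) m.+1 = ratio f m * (V m / V m.+1).
Proof. by rewrite /ratio /=; field; rewrite !V_neq0. Qed.

Lemma growth_inv_ratio_cvg : (fun m => V m / V m.+1) @ \oo --> rho.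
Proof.
rewrite -[X in _ --> X]invrK (_ : (fun _ => _) = fun m => (V m.+1 / V m)^-1).
  by apply: cvgV growth_ratio_cvg; rewrite invr_neq0 ?gt_eqF.
by apply/funext => m; rewrite invf_div.
Qed.

Lemma ratio_delta0_cvg : ratio (delta0 R) @ \oo --> 0.
Proof.
rewrite -(cvg_shiftS (ratio (delta0 R))) (_ : (fun _ => _) = fun=> 0).
  exact: cvg_cst.
by apply/funext => m; rewrite /ratio /delta0 mul0r.
Qed.

Let square_ratio_cvg : ratio (cauchy_prod V V) @ \oo --> 2 * v.
Proof.
rewrite (_ : ratio _ = fun m => (V m.+1 / V m - (N - 2)) - ratio (delta0 R) m).
  rewrite (_ : 2 * v = (rho^-1 - (N - 2)) - 0).
    by apply: cvgB; [apply: cvgB; [exact: growth_ratio_cvg|exact: cvg_cst]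
      |exact: ratio_delta0_cvg].
  by rewrite /v /rho /radius invrK -/s; ring.
by apply/funext => m; rewrite /ratio Vrec; field; rewrite V_neq0.
Qed.

(** The full convolution has a ratio tending to [2 * v], and each of its two ends contributes [p], a
    partial sum of the series with sum [v]; what remains for the middle is [2 * (v - p)]. *)
Let middle_negligible (eps : R) : 0 < eps ->
  exists K0, forall K, (K0 <= K)%N -> \forall m \near \oo,
    \sum_(K <= i < m.+1 - K) V i * V (m - i)%N <= eps * V m.
Proof.
move=> eps0; have /cvgrPdist_lt/(_ (eps / 2))[|K0 _ HK0] := wsum_growth.
  by rewrite divr_gt0.
exists K0 => K KK0; have := HK0 K KK0 => /=; set p := psum _ K => pK.
have cv : (fun m => ratio (cauchy_prod V V) m
    - 2 * \sum_(i < K) V i * (V (m - i)%N / V m)) @ \oo --> 2 * v - 2 * p.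
  apply: cvgB; first exact: square_ratio_cvg.
  apply: cvgMr; rewrite /p /psum; apply: cvg_finite_sum => i _.
  by apply: cvgMr; exact: growth_shift_cvg.
near=> m.
have Km : (K.*2 <= m)%N by near: m; exact: nbhs_infty_ge.
rewrite -ler_pdivrMr//.
have -> : (\sum_(K <= i < m.+1 - K) V i * V (m - i)%N) / V m =
    ratio (cauchy_prod V V) m - 2 * \sum_(i < K) V i * (V (m - i)%N / V m).
  have -> : \sum_(i < K) V i * (V (m - i)%N / V m) =
      (\sum_(i < K) V i * V (m - i)%N) / V m.
    by rewrite mulr_suml; apply: eq_bigr => i _; rewrite mulrA.
  by rewrite /ratio (cauchy_split V V Km); field; rewrite V_neq0.
apply: ltW; near: m; apply: (cvgr_lt _ cv).
by move: pK; rewrite ltr_norml => /andP[_]; lra.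
Unshelve. all: by end_near.
Qed.

Lemma bounded_mul_cvg0 (C : R) (b a : nat -> R) :
  (forall m, `|b m| <= C) -> a @ \oo --> 0 -> (fun m => b m * a m) @ \oo --> 0.
Proof.
move=> bC a0; apply/norm_cvg0P.
have a0' : (fun m => C * `|a m|) @ \oo --> 0.
  by rewrite -(mulr0 C); apply: cvgMr; exact/norm_cvg0P.
apply: (squeeze_cvgr _ (cvg_cst 0) a0').
by near=> m; rewrite normrM mulr_ge0//= ler_wpM2r.
Unshelve. all: by end_near.
Qed.

(* Subexponentiality: in a product of total size [m], one of the two factors
   has bounded size. *)
Lemma ratio_cauchy_approx C f g (eps : R) : dominated C f -> dominated C g ->
  0 < eps -> exists K0, forall K, (K0 <= K)%N -> \forall m \near \oo,
  `|ratio (cauchy_prod f g) m - (\sum_(i < K) (f i * rho ^+ i) * ratio g (m - i)%N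
     + \sum_(i < K) (g i * rho ^+ i) * ratio f (m - i)%N)| <= eps.
Proof.
move=> fC gC eps0; have C0 := dominated_cst fC.
(* The middle part is bounded by [C ^+ 2] times that of the square of [V]; adding 1 keeps the
   divisor positive. *)
have e0 : 0 < eps / 2 / (C ^+ 2 + 1).
  by rewrite !divr_gt0// ltr_wpDl// exprn_ge0.
have [K0 HK0] := middle_negligible e0; exists K0 => K KK0.
(* No convergence of [ratio k] is assumed, only boundedness; the sole limit taken is that of
   [V (m - i) / V m]. The approximation thus applies to frequencies that might oscillate. *)
have head h k : dominated C h -> dominated C k -> (fun m => \sum_(i < K) h i *
    (ratio k (m - i)%N * (V (m - i)%N / V m - rho ^+ i))) @ \oo --> 0.
  move=> hC kC; have z : 0 = \sum_(i < K) (0 : R) by rewrite big1.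
  rewrite [X in _ --> X]z.
  apply: cvg_finite_sum => i _; rewrite -(mulr0 (h i)); apply: cvgMr.
  apply: (@bounded_mul_cvg0 C) => [m|].
    by have /andP[k0 ?] := ratio_bound kC (m - i); rewrite ger0_norm.
  by apply/subr_cvg0; exact: growth_shift_cvg.
have := cvgD (head f g fC gC) (head g f gC fC).
rewrite addr0 => /(_ eventually_filter) /cvgrPdist_le /(_ (eps / 2) (divr_gt0 eps0 (ltr0n _ 2))) heads.
near=> m.
have Km : (K.*2 <= m)%N by near: m; exact: nbhs_infty_ge.
have mid : \sum_(K <= i < m.+1 - K) V i * V (m - i)%N <=
    eps / 2 / (C ^+ 2 + 1) * V m by near: m; exact: HK0.
have : `|0 - (\sum_(i < K) f i *
    (ratio g (m - i)%N * (V (m - i)%N / V m - rho ^+ i)) +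
    \sum_(i < K) g i *
    (ratio f (m - i)%N * (V (m - i)%N / V m - rho ^+ i)))| <= eps / 2.
  by near: m; exact: heads.
rewrite sub0r normrN.
have hE h k : \sum_(i < K) h i * (ratio k (m - i)%N * (V (m - i)%N / V m - rho ^+ i))
   = (\sum_(i < K) h i * k (m - i)%N) / V m
     - \sum_(i < K) (h i * rho ^+ i) * ratio k (m - i)%N.
  rewrite mulr_suml -sumrB; apply: eq_bigr => i _.
  by rewrite /ratio; field; rewrite !V_neq0.
rewrite !hE [ratio (cauchy_prod f g) m]/ratio (cauchy_split f g Km).
set A := \sum_(i < K) f i * g _; set B := \sum_(i < K) g i * f _.
set A' := \sum_(i < K) _ * _; set B' := \sum_(i < K) _ * _.
set M := \sum_(_ <= i < _) _ => h.
have -> : (A + B + M) / V m - (A' + B') = (A / V m - A' + (B / V m - B')) + M / V m.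
  by rewrite !mulrDl; ring.
apply: le_trans (ler_normD _ _) _; rewrite [leRHS]splitr; apply: lerD => //.
have M0 : 0 <= M.
  apply: sumr_ge0 => i _; rewrite mulr_ge0//.
  - by have /andP[] := fC i.
  - by have /andP[] := gC (m - i)%N.
rewrite ger0_norm ?divr_ge0// ler_pdivrMr//.
have MC : M <= C ^+ 2 * (eps / 2 / (C ^+ 2 + 1) * V m).
  apply: le_trans (ler_wpM2l (exprn_ge0 2 C0) mid).
  rewrite /M mulr_sumr; apply: ler_sum => i _.
  have /andP[f0 fi] := fC i; have /andP[g0 gi] := gC (m - i)%N.
  by rewrite expr2 mulrACA; exact: ler_pM.
have e2 : 0 <= eps / 2 by rewrite divr_ge0// ltW.
have C1 : 0 < C ^+ 2 + 1 by rewrite ltr_wpDl// exprn_ge0.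
apply: le_trans MC _; rewrite mulrA ler_wpM2r// mulrA ler_pdivrMr//.
by rewrite mulrC ler_wpM2l// lerDl.
Unshelve. all: by end_near.
Qed.

End Subexponential.

(** * Oscillation of a vector of frequencies *)

Section Oscillation.
Variables (R : realType) (G : finType).

(** An upper bound [d] on the limsup of the l^1 distances when two sizes go to infinity
    independently; the slack [eps] makes the predicate closed under decreasing limits of [d]. *)
Definition osc_le (X : G -> nat -> R) (d : R) := forall eps, 0 < eps ->
  exists M, forall m m', (M <= m)%N -> (M <= m')%N ->
    \sum_g `|X g m - X g m'| <= d + eps.

Lemma osc_le_mono X d d' : d <= d' -> osc_le X d -> osc_le X d'.
Proof.
move=> dd Xd eps eps0; have [M HM] := Xd _ eps0; exists M => m m' Mm Mm'.
by apply: le_trans (HM _ _ Mm Mm') _; rewrite lerD2r.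
Qed.

Lemma osc_le_lim X d : (forall eps, 0 < eps -> osc_le X (d + eps)) -> osc_le X d.
Proof.
move=> Xd eps eps0; have e2 : 0 < eps / 2 by rewrite divr_gt0.
have [M HM] := Xd _ e2 _ e2; exists M => m m' Mm Mm'.
by apply: le_trans (HM _ _ Mm Mm') _; rewrite -addrA -splitr.
Qed.

Lemma osc_le0_cvg X g : osc_le X 0 -> cvgn (X g).
Proof.
move=> X0; apply/cauchy_cvgP/cauchy_exP => eps eps0.
have [M HM] := X0 _ (divr_gt0 eps0 (ltr0n _ 2)).
exists (X g M), M => // m /= Mm; rewrite /ball /=.
have := HM M m (leqnn _) Mm; rewrite (bigD1 g)//= add0r => h.
apply: (@le_lt_trans _ _ (eps / 2)); last by rewrite ltr_pdivrMr// ltr_pMr// ltr1n.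
by apply: le_trans h; rewrite lerDl sumr_ge0.
Qed.

Lemma eq_osc_le X Y d : (forall g, \forall m \near \oo, X g m = Y g m) ->
  osc_le X d -> osc_le Y d.
Proof.
move=> XY Xd eps eps0; have [M HM] := Xd _ eps0.
have [M' _ HM'] := filter_forall eventually_filter XY.
exists (M + M')%N => m m' Mm Mm'.
rewrite (eq_bigr (fun g => `|X g m - X g m'|)); first by apply: HM; lia.
by move=> g _; rewrite !HM' //=; lia.
Qed.

Lemma osc_le_init (X : G -> nat -> R) : (forall g m, 0 <= X g m) ->
  (forall m, \sum_g X g m <= 1) -> osc_le X 2.
Proof.
move=> X0 X1 eps eps0; exists 0%N => m m' _ _.
apply: (@le_trans _ _ (\sum_g (X g m + X g m'))).
  apply: ler_sum => g _; rewrite (le_trans (ler_normB _ _))//.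
  by rewrite !ger0_norm.
by rewrite big_split /=; have := X1 m; have := X1 m'; lra.
Qed.

(** Solves an inequality [d <= k d + b] between best bounds that are known only through the
    predicate [P]: iterating from some initial bound [d0] gives [k ^+ j * d0 + b / (1 - k)], and [P]
    passes to the limit. *)
Lemma contraction_fixpoint (P : R -> Prop) (k b d0 : R) :
  (forall d d', d <= d' -> P d -> P d') ->
  (forall d, (forall eps, 0 < eps -> P (d + eps)) -> P d) ->
  0 <= k < 1 -> 0 <= b -> 0 <= d0 -> P d0 ->
  (forall d, 0 <= d -> P d -> P (k * d + b)) -> P (b / (1 - k)).
Proof.
move=> Pmono Plim /andP[k0 k1] b0 d00 Pd0 Pstep.
have k1' : 0 < 1 - k by rewrite subr_gt0.
have B0 : 0 <= b / (1 - k) by rewrite divr_ge0// ltW.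
have Pj j : P (k ^+ j * d0 + b / (1 - k)).
  elim: j => [|j IH]; first by apply: Pmono Pd0; rewrite expr0 mul1r lerDl.
  have h0 : 0 <= k ^+ j * d0 + b / (1 - k) by rewrite addr_ge0// mulr_ge0// exprn_ge0.
  have := Pstep _ h0 IH; apply: Pmono; rewrite le_eqVlt; apply/orP; left; apply/eqP.
  by rewrite exprS; field; rewrite gt_eqF.
apply: Plim => eps eps0.
have : (fun j => k ^+ j * d0) @ \oo --> 0.
  by rewrite -(mul0r d0); apply: cvgMl; apply: cvg_expr; rewrite ger0_norm.
move/cvgrPdist_le => /(_ _ eps0)[j _ /(_ j (leqnn j))].
rewrite sub0r normrN => /(le_trans (ler_norm _)) h.
by apply: Pmono (Pj j); rewrite addrC lerD2l.
Qed.

End Oscillation.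

Section Product.
Variables (R : realType) (N : R) (V : nat -> R).
Hypotheses (N2 : 2 <= N) (V0 : V 0%N = 1).
Hypothesis Vrec :
  forall m, V m.+1 = cauchy_prod V V m + (N - 2) * V m + delta0 R m.
Variable G : finType.

Let rho := radius N.
Let rho_gt0 : 0 < rho := radius_gt0 N2.

Variables (op : G -> G -> G) (z : G).
Hypothesis op_z : forall b, op z b = z.

Let fiber_sum (H : G -> G -> R) :
  \sum_g \sum_a \sum_(b | op a b == g) H a b = \sum_a \sum_b H a b.
Proof.
rewrite exchange_big; apply: eq_bigr => a _ /=.
rewrite (exchange_big_dep xpredT)//=; apply: eq_bigr => b _.
by rewrite (big_pred1 (op a b)).
Qed.

Let fiber_norm (H : G -> G -> R) :
  \sum_g `|\sum_a \sum_(b | op a b == g) H a b| <=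
  \sum_(a | a != z) \sum_b `|H a b| + `|\sum_b H z b|.
Proof.
pose H' a b : R := if a == z then 0 else `|H a b|.
have -> : \sum_(a | a != z) \sum_b `|H a b| = \sum_a \sum_b H' a b.
  rewrite [RHS](bigD1 z)//= [X in _ = X + _]big1 ?add0r; last first.
    by move=> b _; rewrite /H' eqxx.
  by apply: eq_bigr => a /negbTE az; apply: eq_bigr => b _; rewrite /H' az.
have -> : `|\sum_b H z b| = \sum_g (if g == z then `|\sum_b H z b| else 0).
  by rewrite -big_mkcond /= big_pred1_eq.
rewrite -(fiber_sum H') -big_split; apply: ler_sum => g _ /=.
rewrite (bigD1 z)//= (le_trans (ler_normD _ _))// [leLHS]addrC lerD//.
  rewrite [leRHS](bigD1 z)//= [X in _ <= X + _]big1 ?add0r; last first.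
    by move=> b _; rewrite /H' eqxx.
  apply: le_trans (ler_norm_sum _ _ _) _; apply: ler_sum => a /negbTE az.
  apply: le_trans (ler_norm_sum _ _ _) _; apply: ler_sum => b _.
  by rewrite /H' az.
case: eqVneq => [->|gz].
  by rewrite (eq_bigl xpredT)// => b; rewrite op_z eqxx.
rewrite big_pred0 ?normr0// => b.
by rewrite op_z eq_sym (negbTE gz).
Qed.

(* The absorbing value [z] of the first factor erases the second one; without
   this gain the bound would not contract. *)
Lemma osc_le_cauchy (f g h : G -> nat -> R) (wf wg : G -> R) (C d e : R) :
  (forall a, dominated V C (f a)) -> (forall a, dominated V C (g a)) ->
  (forall c m, h c m = \sum_a \sum_(b | op a b == c) cauchy_prod (f a) (g b) m) ->
  (forall a, wsum rho (f a) (wf a)) -> (forall a, wsum rho (g a) (wg a)) ->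
  (\forall m \near \oo, \sum_b ratio V (g b) m = 1) ->
  osc_le (fun a => ratio V (f a)) d -> osc_le (fun a => ratio V (g a)) e ->
  osc_le (fun a => ratio V (h a))
    ((\sum_(a | a != z) wf a) * e + (\sum_b wg b) * d).
Proof.
move=> fC gC hE fw gw [M1 _ g1] fd ge eps eps0.
have rho0 : 0 <= rho := ltW rho_gt0.
have f0 a m : 0 <= f a m by have /andP[] := fC a m.
have g0 a m : 0 <= g a m by have /andP[] := gC a m.
have wf0 a : 0 <= wf a by have := psum_le_wsum 0 rho0 (f0 a) (fw a); rewrite /psum big_ord0.
have wg0 a : 0 <= wg a by have := psum_le_wsum 0 rho0 (g0 a) (gw a); rewrite /psum big_ord0.
set A := \sum_(a | _) wf a; set B := \sum_b wg b.
have A0 : 0 <= A by apply: sumr_ge0.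
have B0 : 0 <= B by apply: sumr_ge0.
(* Error budget: [e'] at each of the two sizes for every pair of values, and [e'] in each of the two
   oscillations, weighted by [A] and [B]. *)
pose D := (#|G| * #|G|)%:R * 2 + A + B + 1 : R.
have D0 : 0 < D by rewrite /D ltr_wpDl// !addr_ge0// mulr_ge0.
have e'0 : 0 < eps / D by rewrite divr_gt0.
set e' := eps / D in e'0.
have /choice[K0 HK0] : forall p : G * G, exists K0, forall K, (K0 <= K)%N ->
    \forall m \near \oo, `|ratio V (cauchy_prod (f p.1) (g p.2)) m -
     (\sum_(i < K) (f p.1 i * rho ^+ i) * ratio V (g p.2) (m - i)%N
     + \sum_(i < K) (g p.2 i * rho ^+ i) * ratio V (f p.1) (m - i)%N)| <= e'.
  by move=> [a b]; exact: (ratio_cauchy_approx N2 V0 Vrec (fC a) (gC b) e'0).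
pose K := (\max_p K0 p)%N.
have [M2 _ HM2] := filter_forall eventually_filter (fun p => HK0 p K (leq_bigmax p)).
have [M3 HM3] := fd _ e'0; have [M4 HM4] := ge _ e'0.
exists (M1 + M2 + M3 + M4 + K)%N => m m' Mm Mm'.
have big k i : (M1 + M2 + M3 + M4 + K <= k)%N -> (i < K)%N ->
    [/\ (M1 <= k - i)%N, (M3 <= k - i)%N & (M4 <= k - i)%N].
  by clear; move=> ? ?; split; lia.
pose Y a b k := \sum_(i < K) (f a i * rho ^+ i) * ratio V (g b) (k - i)%N
     + \sum_(i < K) (g b i * rho ^+ i) * ratio V (f a) (k - i)%N.
pose H1 a b := \sum_(i < K) (f a i * rho ^+ i) *
  (ratio V (g b) (m - i)%N - ratio V (g b) (m' - i)%N).
pose H2 a b := \sum_(i < K) (g b i * rho ^+ i) *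
  (ratio V (f a) (m - i)%N - ratio V (f a) (m' - i)%N).
have YH a b : Y a b m - Y a b m' = H1 a b + H2 a b.
  rewrite /Y opprD addrACA -!sumrB; congr (_ + _); apply: eq_bigr => i _;
  by rewrite mulrBr.
have Yk a b k : (M1 + M2 + M3 + M4 + K <= k)%N ->
    `|ratio V (cauchy_prod (f a) (g b)) k - Y a b k| <= e'.
  move=> Mk; have M2k : (M2 <= k)%N by clear -Mk; lia.
  exact: (HM2 k M2k (a, b)).
have rhE c k : ratio V (h c) k =
    \sum_a \sum_(b | op a b == c) ratio V (cauchy_prod (f a) (g b)) k.
  rewrite /ratio hE mulr_suml; apply: eq_bigr => a _.
  by rewrite mulr_suml.
pose Z a b := (ratio V (cauchy_prod (f a) (g b)) m - Y a b m)
  - (ratio V (cauchy_prod (f a) (g b)) m' - Y a b m').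
have dE c : ratio V (h c) m - ratio V (h c) m' =
    \sum_a \sum_(b | op a b == c) Z a b +
    (\sum_a \sum_(b | op a b == c) H1 a b + \sum_a \sum_(b | op a b == c) H2 a b).
  rewrite !rhE -sumrB -!big_split; apply: eq_bigr => a _ /=.
  rewrite -sumrB -!big_split; apply: eq_bigr => b _ /=.
  by rewrite -YH /Z; ring.
have triv (H : G -> G -> R) : \sum_c `|\sum_a \sum_(b | op a b == c) H a b| <=
    \sum_a \sum_b `|H a b|.
  rewrite -fiber_sum; apply: ler_sum => c _.
  apply: le_trans (ler_norm_sum _ _ _) _; apply: ler_sum => a _.
  exact: ler_norm_sum.
apply: (@le_trans _ _ ((#|G| * #|G|)%:R * 2 * e' + (A * (e + e') + B * (d + e')))).
  rewrite (eq_bigr _ (fun c _ => congr1 Num.norm (dE c))).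
  apply: le_trans (ler_sum _ (fun c _ => ler_normD _ _)) _.
  rewrite big_split /=; apply: lerD.
    apply: le_trans (triv _) _.
    apply: (@le_trans _ _ (\sum_(a : G) \sum_(b : G) 2 * e')).
      apply: ler_sum => a _; apply: ler_sum => b _.
      rewrite /Z (le_trans (ler_normB _ _))// mulr_natl mulr2n.
      by apply: lerD; apply: Yk.
    by rewrite !sumr_const -mulrnA -[leLHS]mulr_natl mulrA.
  apply: le_trans (ler_sum _ (fun c _ => ler_normD _ _)) _.
  rewrite big_split /=; apply: lerD; last first.
    apply: le_trans (triv _) _; rewrite exchange_big /= mulr_suml.
    apply: ler_sum => b _.
    apply: (@le_trans _ _ (\sum_(i < K) (g b i * rho ^+ i) * (d + e'))).
      apply: le_trans (ler_sum _ (fun a _ => ler_norm_sum _ _ _)) _.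
      rewrite exchange_big; apply: ler_sum => i _ /=.
      have gi0 : 0 <= g b i * rho ^+ i by rewrite mulr_ge0// exprn_ge0.
      rewrite (eq_bigr _ (fun a _ => normrM _ _)) -mulr_sumr (ger0_norm gi0).
      have [_ ? ?] := big _ i Mm (ltn_ord i); have [_ ? ?] := big _ i Mm' (ltn_ord i).
      by rewrite ler_wpM2l//; exact: HM3.
    rewrite -mulr_suml ler_wpM2r//; last exact: psum_le_wsum.
    have := HM3 M3 M3 (leqnn _) (leqnn _).
    by apply: le_trans; exact: sumr_ge0.
  apply: le_trans (fiber_norm _) _.
  rewrite [X in _ + X](_ : _ = 0) ?addr0.
    rewrite mulr_suml; apply: ler_sum => a _.
    apply: (@le_trans _ _ (\sum_(i < K) (f a i * rho ^+ i) * (e + e'))).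
      apply: le_trans (ler_sum _ (fun b _ => ler_norm_sum _ _ _)) _.
      rewrite exchange_big; apply: ler_sum => i _ /=.
      have fi0 : 0 <= f a i * rho ^+ i by rewrite mulr_ge0// exprn_ge0.
      rewrite (eq_bigr _ (fun a _ => normrM _ _)) -mulr_sumr (ger0_norm fi0).
      have [_ ? ?] := big _ i Mm (ltn_ord i); have [_ ? ?] := big _ i Mm' (ltn_ord i).
      by rewrite ler_wpM2l//; exact: HM4.
    rewrite -mulr_suml ler_wpM2r//; last exact: psum_le_wsum.
    have := HM4 M4 M4 (leqnn _) (leqnn _).
    by apply: le_trans; exact: sumr_ge0.
  rewrite /H1 exchange_big big1 ?normr0// => i _.
  have [? _ _] := big _ i Mm (ltn_ord i); have [? _ _] := big _ i Mm' (ltn_ord i).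
  by rewrite -mulr_sumr sumrB !g1 ?subrr ?mulr0.
have eD : eps = D * e' by rewrite /e' mulrC divfK// gt_eqF.
rewrite [leRHS](_ : _ = (A * e + B * d) + D * e'); last by rewrite -eD.
rewrite /D; have := ltW e'0; lra.
Qed.

End Product.

(** * Limits of generating functions at the singularity *)

Section Calculus.
Variables (R : realType) (N : R) (V : nat -> R).
Hypotheses (N2 : 2 <= N) (V0 : V 0%N = 1).
Hypothesis Vrec :
  forall m, V m.+1 = cauchy_prod V V m + (N - 2) * V m + delta0 R m.

Let rho := radius N.
Let s := Num.sqrt N.
Let v := 1 + s.
Let rho_gt0 : 0 < rho := radius_gt0 N2.
Let rho_ge0 : 0 <= rho := ltW rho_gt0.
Let V_gt0 := growth_gt0 N2 V0 Vrec.
Let V_ge0 := growth_ge0 N2 V0 Vrec.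
Let V_neq0 m : V m != 0. Proof. by rewrite gt_eqF. Qed.
Let N_gt0 : 0 < N. Proof. exact: lt_le_trans N2. Qed.
Let s_gt0 : 0 < s. Proof. by rewrite sqrtr_gt0. Qed.
Let s_sq : s ^+ 2 = N. Proof. by rewrite sqr_sqrtr// ltW. Qed.

Lemma radiusE : radius N = (s * (s + 2))^-1.
Proof. by rewrite /radius -/s -s_sq; congr (_^-1); ring. Qed.

(* [good f w mu] reads: the value of [f] at the formal number [rho + eps],
   with [eps ^ 2 = 0], is [w + mu eps], the unit being chosen such that
   [V (rho + eps) = v + eps]. *)
Definition good (f : nat -> R) (w mu : R) :=
  [/\ forall m, 0 <= f m, wsum rho f w & ratio V f @ \oo --> mu].

Lemma good_dominated f w mu : good f w mu -> exists C, dominated V C f.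
Proof.
case=> f0 _ /cvgrPdist_lt/(_ 1 ltr01)[M _ HM].
have r0 m : 0 <= ratio V f m by rewrite /ratio divr_ge0.
exists (mu + 1 + \sum_(i < M) ratio V f i) => m.
rewrite f0 /= -ler_pdivrMr// -/(ratio V f m).
have S0 : 0 <= \sum_(i < M) ratio V f i by exact: sumr_ge0.
have [Mm|mM] := leqP M m.
  have /= := HM m Mm; rewrite distrC ltr_norml => /andP[_ h].
  by rewrite (le_trans (y := mu + 1)) ?lerDl//; lra.
have mu0 : 0 <= mu + 1.
  have /= := HM M (leqnn M); rewrite ltr_norml => /andP[h _].
  by have := r0 M; lra.
rewrite (bigD1 (Ordinal mM))//= addrCA lerDl addr_ge0//.
by apply: sumr_ge0.
Qed.

Lemma cvg_subn_infty i : (fun m => (m - i)%N) @ \oo --> \oo.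
Proof. by move=> A [K _ KA]; exists (K + i)%N => // m /= Km; apply: KA => /=; lia. Qed.

Lemma goodD f g wf wg mf mg : good f wf mf -> good g wg mg ->
  good (fun m => f m + g m) (wf + wg) (mf + mg).
Proof.
move=> [f0 fw fm] [g0 gw gm]; split; first by move=> m; rewrite addr_ge0.
  exact: wsumD.
rewrite (_ : ratio V _ = ratio V f \+ ratio V g); first exact: cvgD.
by apply/funext => m; rewrite /ratio /= mulrDl.
Qed.

Lemma goodZ (c : R) f w mu : 0 <= c -> good f w mu ->
  good (fun m => c * f m) (c * w) (c * mu).
Proof.
move=> c0 [f0 fw fm]; split; first by move=> m; rewrite mulr_ge0.
  exact: wsumZ.
rewrite (_ : ratio V _ = (fun m => c * ratio V f m)); first exact: cvgMr.
by apply/funext => m; rewrite /ratio mulrA.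
Qed.

Lemma good_delta0 : good (delta0 R) 1 0.
Proof.
split; first by move=> m; rewrite ler0n.
  exact: wsum_delta0.
exact: ratio_delta0_cvg.
Qed.

Lemma good_sh f w mu : good f w mu -> good (sh f) (rho * w) (rho * mu).
Proof.
move=> [f0 fw fm]; split; first by case=> [|m] /=.
  exact: wsum_sh.
rewrite -(cvg_shiftS (ratio V (sh f))).
rewrite (_ : (fun _ => _) = fun m => ratio V f m * (V m / V m.+1)).
  by rewrite mulrC; apply: cvgM => //; exact: growth_inv_ratio_cvg.
by apply/funext => m; rewrite (ratio_sh N2 V0 Vrec).
Qed.

Lemma good_growth : good V v 1.
Proof.
split => //; first exact: wsum_growth.
rewrite (_ : ratio V V = fun=> 1); first exact: cvg_cst.
by apply/funext => m; rewrite /ratio divff.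
Qed.

Lemma good_cauchy f g wf wg mf mg : good f wf mf -> good g wg mg ->
  good (cauchy_prod f g) (wf * wg) (wf * mg + wg * mf).
Proof.
move=> gf gg; have [Cf fC] := good_dominated gf; have [Cg gC] := good_dominated gg.
have {}fC : dominated V (Num.max Cf Cg) f.
  move=> m; have /andP[-> /= h] := fC m.
  by rewrite (le_trans h)// ler_wpM2r// le_max lexx.
have {}gC : dominated V (Num.max Cf Cg) g.
  move=> m; have /andP[-> /= h] := gC m.
  by rewrite (le_trans h)// ler_wpM2r// le_max lexx orbT.
case: gf gg => [f0 fw fm] [g0 gw gm].
split; [exact: cauchy_ge0|exact: wsum_cauchy|].
apply/cvgrPdist_le => eps eps0; have e3 : 0 < eps / 3 by rewrite divr_gt0.
have [K0 HK0] := ratio_cauchy_approx N2 V0 Vrec fC gC e3.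
pose p f K := psum (fun i => f i * rho ^+ i) K.
have pc : (fun K => p f K * mg + p g K * mf) @ \oo --> wf * mg + wg * mf.
  by apply: cvgD; apply: cvgMl.
move/cvgrPdist_le : pc => /(_ _ e3)[K1 _ HK1].
pose K := (K0 + K1)%N.
have /= hK := HK1 K (leq_addl _ _).
have sc (h k : nat -> R) (mk : R) : ratio V k @ \oo --> mk ->
    (fun m => \sum_(i < K) (h i * rho ^+ i) * ratio V k (m - i)%N) @ \oo --> p h K * mk.
  move=> km; rewrite /p /psum mulr_suml; apply: cvg_finite_sum => i _.
  by apply: cvgMr; apply: cvg_comp km; exact: cvg_subn_infty.
have tc : (fun m => \sum_(i < K) (f i * rho ^+ i) * ratio V g (m - i)%N +
    \sum_(i < K) (g i * rho ^+ i) * ratio V f (m - i)%N) @ \oo -->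
    p f K * mg + p g K * mf.
  by apply: cvgD; exact: sc.
move/cvgrPdist_le : tc => /(_ _ e3) tc.
near=> m.
have h1 : `|p f K * mg + p g K * mf -
   (\sum_(i < K) (f i * rho ^+ i) * ratio V g (m - i)%N +
    \sum_(i < K) (g i * rho ^+ i) * ratio V f (m - i)%N)| <= eps / 3.
  by near: m.
have h2 : `|ratio V (cauchy_prod f g) m -
   (\sum_(i < K) (f i * rho ^+ i) * ratio V g (m - i)%N +
    \sum_(i < K) (g i * rho ^+ i) * ratio V f (m - i)%N)| <= eps / 3.
  by near: m; apply: HK0; exact: leq_addr.
move: hK h1 h2; set T := _ + \sum_(i < K) _; set P := p f K * mg + _.
rewrite -/P; move: (ratio V _ m) => r.
by rewrite !ler_norml; move=> /andP[? ?] /andP[? ?] /andP[? ?]; apply/andP; split; lra.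
Unshelve. all: by end_near.
Qed.

Lemma good_sub f g h wf wg mf mg : good f wf mf -> good g wg mg ->
  (forall m, 0 <= h m) -> (forall m, h m + g m = f m) ->
  good h (wf - wg) (mf - mg).
Proof.
move=> [f0 fw fm] [g0 gw gm] h0 hgf.
have hE m : f m + (- 1) * g m = h m by rewrite -hgf; ring.
split=> //.
  by rewrite -mulN1r; apply: eq_wsum hE _; apply: wsumD => //; exact: wsumZ.
rewrite (_ : ratio V h = fun m => ratio V f m - ratio V g m); first exact: cvgB.
by apply/funext => m; rewrite /ratio -hgf mulrDl addrK.
Qed.

(** Division by [1 + rho] gives both values, with [rho / (1 + rho) = v ^- 2]. Convergence of the
    ratios of [a] is not a formal consequence of that of [a + z a]: it comes from the recursion
    [y' = t (1 - y)] with [t = V m / V m.+1 <= 1 / 2], which contracts. *)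
Lemma good_children a : (forall m, 0 <= a m) ->
  (forall m, a m + sh a m = (N - 1) * sh (delta0 R) m + sh V m) ->
  good a (s / (1 + s)) (v ^- 2).
Proof.
move=> a0 aE; have sa0 m : 0 <= sh a m by case: m => /=.
have gR : good (fun m => (N - 1) * sh (delta0 R) m + sh V m)
   ((N - 1) * (rho * 1) + rho * v) ((N - 1) * (rho * 0) + rho * 1).
  apply: goodD (good_sh good_growth); apply: goodZ (good_sh good_delta0).
  by rewrite subr_ge0 (le_trans _ N2)// ler1n.
have v_gt0 : 0 < v by rewrite addr_gt0.
have r1 : 0 < 1 + rho by rewrite addr_gt0.
have rE : rho = (s * (s + 2))^-1 := radiusE.
have s2 : s + 2 != 0 by rewrite gt_eqF// addr_gt0.
have s1 : 1 + s != 0 by rewrite gt_eqF.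
case: gR => _ Rw Rm; split => //.
  have ale i : 0 <= a i <= (N - 1) * sh (delta0 R) i + sh V i.
    by rewrite a0 -aE lerDl sa0.
  have [w aw _] := ex_wsum_le rho_ge0 ale Rw.
  have := wsumD aw (wsum_sh aw).
  move=> /(eq_wsum aE)/wsum_unique/(_ Rw) wE.
  suff <- : w = s / (1 + s) by [].
  have -> : w = ((N - 1) * (rho * 1) + rho * v) / (1 + rho).
    by rewrite -wE; field; rewrite gt_eqF.
  rewrite rE /v -s_sq; field; rewrite s1 s2 (gt_eqF s_gt0)/= gt_eqF//.
  by rewrite addr_gt0// mulr_gt0// addr_gt0.
set y0 := v ^- 2; have y0E : y0 = rho - y0 * rho.
  by rewrite /y0 rE /v; field; rewrite s1 s2 gt_eqF.
suff : (fun m => `|ratio V a m - y0|) @ \oo --> 0.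
  by move/norm_cvg0P => h; apply/subr_cvg0.
apply: (@perturbed_contraction_cvg0 _ 2^-1 _
    (fun m => `|(1 - y0) * (V m / V m.+1 - rho)|)) => //.
- by rewrite invr_ge0 ler0n invf_lt1 ?ltr1n.
- apply/norm_cvg0P; rewrite -(mulr0 (1 - y0)); apply: cvgMr.
  by apply/subr_cvg0; exact: growth_inv_ratio_cvg.
near=> m.
have m1 : (1 <= m)%N by near: m; exact: nbhs_infty_ge.
set t := V m / V m.+1.
have -> : ratio V a m.+1 - y0 = - (t * (ratio V a m - y0)) + (1 - y0) * (t - rho).
  have -> : ratio V a m.+1 = t - ratio V a m * t.
    have := aE m.+1 => /=; rewrite {1}/delta0 (gtn_eqF m1) mulr0 add0r.
    move=> /(canRL (addrK _)) aS; rewrite /ratio aS /t; field.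
    by rewrite !V_neq0.
  by rewrite {1}y0E; ring.
apply: le_trans (ler_normD _ _) _; rewrite normrN lerD2r normrM ler_wpM2r//.
have t0 : 0 <= t by rewrite /t divr_ge0.
rewrite (ger0_norm t0) /t ler_pdivrMr// ler_pdivlMl//.
apply: le_trans (growth_leS N2 V0 Vrec m); rewrite mulrC.
by rewrite ler_wpM2l.
Unshelve. all: by end_near.
Qed.

(** The families to be bounded have no known limiting ratio; a majorant that has one is enough for
    upper bounds, and such majorants are stable under sums and products. *)
Definition ub (f : nat -> R) (w mu : R) := exists g w' mu',
  [/\ good g w' mu', forall m, 0 <= f m <= g m, w' <= w & mu' <= mu].

Lemma good_ub f w mu : good f w mu -> ub f w mu.
Proof. by move=> gf; exists f, w, mu; split => // m; case: gf => -> _ _ /=. Qed.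

Lemma ub_le f g w mu w' mu' : ub g w mu -> (forall m, 0 <= f m <= g m) ->
  w <= w' -> mu <= mu' -> ub f w' mu'.
Proof.
move=> [h [a [b [gh hg aw bm]]]] fg ww mm; exists h, a, b; split => //.
- move=> m; have /andP[-> /= /le_trans] := fg m; apply.
  by have /andP[] := hg m.
- exact: le_trans ww.
- exact: le_trans mm.
Qed.

Lemma ubW f w mu w' mu' : ub f w mu -> w <= w' -> mu <= mu' -> ub f w' mu'.
Proof.
move=> h ww mm; apply: ub_le (h) _ ww mm => m.
by case: h => g [a [b [_ /(_ m)/andP[-> _] _ _]]] /=.
Qed.

Lemma good_ge0 f w mu : good f w mu -> 0 <= w /\ 0 <= mu.
Proof.
case=> f0 fw fm; split.
  by have := psum_le_wsum 0 rho_ge0 f0 fw; rewrite /psum big_ord0.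
rewrite -(cvg_lim (@Rhausdorff R) fm); apply: limr_ge; first by apply: cvgP fm.
by near=> m; rewrite /ratio divr_ge0.
Unshelve. all: by end_near.
Qed.

Lemma ub_ge0 f w mu : ub f w mu -> 0 <= w /\ 0 <= mu.
Proof.
by move=> [h [a [b [/good_ge0[a0 b0] _ aw bm]]]]; rewrite (le_trans a0) ?(le_trans b0).
Qed.

Lemma ubD f g wf wg mf mg : ub f wf mf -> ub g wg mg ->
  ub (fun m => f m + g m) (wf + wg) (mf + mg).
Proof.
move=> [h [a [b [gh hf aw bm]]]] [k [c [d [gk kg cw dm]]]].
exists (fun m => h m + k m), (a + c), (b + d); split.
- exact: goodD.
- move=> m; have /andP[f0 fh] := hf m; have /andP[g0 gk'] := kg m.
  by rewrite addr_ge0//= lerD.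
- exact: lerD.
- exact: lerD.
Qed.

Lemma ub_sum (I : Type) (r : seq I) (f : I -> nat -> R) w mu :
  (forall i, ub (f i) w mu) ->
  ub (fun m => \sum_(i <- r) f i m) ((size r)%:R * w) ((size r)%:R * mu).
Proof.
move=> fu; elim: r => [|i r IH].
  exists (fun m => 0 * delta0 R m), (0 * 1), (0 * 0); rewrite !mul0r; split => //.
    by have := goodZ (lexx 0) good_delta0; rewrite !mul0r.
  by move=> m; rewrite big_nil mul0r lexx.
rewrite /= -natr1 !mulrDl !mul1r ![_ * _ + _]addrC.
rewrite (_ : (fun m => _) = fun m => f i m + \sum_(j <- r) f j m); first exact: ubD.
by apply/funext => m; rewrite big_cons.
Qed.

Lemma ub_sh f w mu : ub f w mu -> ub (sh f) (rho * w) (rho * mu).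
Proof.
move=> [h [a [b [gh hf aw bm]]]]; exists (sh h), (rho * a), (rho * b); split.
- exact: good_sh.
- by case=> [|m] /=; rewrite ?lexx.
- by rewrite ler_wpM2l.
- by rewrite ler_wpM2l.
Qed.

Lemma ub_cauchy f g wf wg mf mg : ub f wf mf -> ub g wg mg ->
  ub (cauchy_prod f g) (wf * wg) (wf * mg + wg * mf).
Proof.
move=> [h [a [b [gh hf aw bm]]]] [k [c [d [gk kg cw dm]]]].
have [a0 b0] := good_ge0 gh; have [c0 d0] := good_ge0 gk.
exists (cauchy_prod h k), (a * c), (a * d + c * b); split.
- exact: good_cauchy.
- move=> m; apply/andP; split; last exact: cauchy_mono.
  by apply: cauchy_ge0 => i; [have /andP[] := hf i|have /andP[] := kg i].
- exact: ler_pM.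
- by apply: lerD; exact: ler_pM.
Qed.

Lemma ub_lim f w mu l : ub f w mu -> ratio V f @ \oo --> l -> l <= mu.
Proof.
move=> [h [a [b [[_ _ hb] hf _ bm]]]] fl; apply: le_trans bm.
rewrite -(cvg_lim (@Rhausdorff R) fl) -(cvg_lim (@Rhausdorff R) hb).
apply: ler_lim; [by apply: cvgP fl|by apply: cvgP hb|].
by near=> m; rewrite /ratio ler_pM2r ?invr_gt0//; have /andP[] := hf m.
Unshelve. all: by end_near.
Qed.

End Calculus.

(** * Counting forests *)

Section Counting.
Variable n : nat.
Implicit Types (ts us : seq (tree n)) (A B C : set (seq (tree n))).

Definition fsize ts : nat := sumn (map (@nodes n) ts).

Lemma fsize_cat ts us : fsize (ts ++ us) = (fsize ts + fsize us)%N.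
Proof. by rewrite /fsize map_cat sumn_cat. Qed.

Lemma finite_forests m : finite_set [set ts | fsize ts = m].
Proof.
suff H k : finite_set [set ts | (fsize ts <= k)%N].
  by apply: sub_finite_set (H m) => ts /= ->.
have nodes_gt0 (t : tree n) : (0 < nodes t)%N by case: t.
elim: k => [|k IHk].
  apply: sub_finite_set (finite_set1 [::]) => -[|t ts] //= h.
  by have := nodes_gt0 t; move: h; rewrite /fsize /=; lia.
pose trees := [set Leaf l | l in [set: literal n]] `|`
  [set Node c ts | c in [set: connective] & ts in [set ts | (fsize ts <= k)%N]].
have ftrees : finite_set trees.
  rewrite finite_setU; split; first exact/finite_image/finite_finset.
  apply: finite_image2 IHk; have : finite_set [set` [:: Conj; Disj]] by exact: finite_seq.
  by apply: sub_finite_set => -[] _ /=; rewrite !inE eqxx ?orbT.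
have fc : finite_set ([set [::]] `|` [set t :: ts | t in trees &
    ts in [set ts | (fsize ts <= k)%N]]).
  by rewrite finite_setU; split; [exact: finite_set1|exact: finite_image2].
apply: sub_finite_set fc => -[|t ts] /=; first by left.
rewrite /fsize /= => h; right; exists t; last first.
  by exists ts => //; move: h; have := nodes_gt0 t; rewrite /fsize; lia.
case: t h => [l|c us] /= h; first by left; exists l.
have {}h : ((fsize us).+1 + fsize ts <= k.+1)%N := h.
by right; exists c => //; exists us => //=; lia.
Qed.

Definition forests m : seq (seq (tree n)) := fset_set [set ts | fsize ts = m].

Lemma mem_forests ts m : (ts \in forests m) = (fsize ts == m).
Proof.
rewrite /forests; have fm := finite_forests m; apply/idP/eqP.
  by rewrite in_fset_set// inE.
by move=> h; rewrite in_fset_set// inE.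
Qed.

Lemma forests_uniq m : uniq (forests m).
Proof. exact: fset_uniq. Qed.

Definition level A m := [seq ts <- forests m | `[< A ts >]].

Lemma mem_level A m ts : (ts \in level A m) = `[< A ts >] && (fsize ts == m).
Proof. by rewrite mem_filter mem_forests. Qed.

Lemma level_uniq A m : uniq (level A m).
Proof. by rewrite filter_uniq// forests_uniq. Qed.

Definition catset A B : set (seq (tree n)) :=
  [set ts | exists a b, [/\ A a, B b & ts = a ++ b]].

Definition single (T : set (tree n)) : set (seq (tree n)) :=
  [set ts | exists2 t, T t & ts = [:: t]].

Definition nodeset c A : set (tree n) := [set t | exists2 ts, A ts & t = Node c ts].

Let cats A B m : seq (seq (tree n)) :=
  [seq p | i <- iota 0 m.+1, p <- [seq a ++ b | a <- level A i, b <- level B (m - i)]].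

Let size_cats A B m : seq.size (cats A B m) =
  (\sum_(i < m.+1) seq.size (level A i) * seq.size (level B (m - i)))%N.
Proof.
rewrite /cats size_allpairs_dep sumnE big_map.
rewrite -[iota _ _]/(index_iota 0 m.+1) big_mkord.
by apply: eq_bigr => i _; rewrite size_allpairs.
Qed.

Lemma size_level_cat_le A B C m : C `<=` catset A B ->
  (seq.size (level C m) <=
   \sum_(i < m.+1) seq.size (level A i) * seq.size (level B (m - i)))%N.
Proof.
move=> CAB; rewrite -size_cats; apply: uniq_leq_size (level_uniq _ _) _ => ts.
rewrite mem_level => /andP[/asboolP/CAB[a [b [Aa Bb ->]]]].
rewrite fsize_cat => /eqP abm; apply/allpairsPdep.
exists (fsize a), (a ++ b); split => //; first by rewrite mem_iota; lia.
apply/allpairsPdep; exists a, b; split => //; rewrite mem_level.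
  by apply/andP; split; [exact/asboolP|].
by apply/andP; split; [exact/asboolP|apply/eqP; lia].
Qed.

(** The second hypothesis says that the cut between the factors can be recovered from the
    concatenation; otherwise one forest could be counted for several cuts. *)
Lemma size_level_cat_ge A B C m : catset A B `<=` C ->
  (forall a a' b b', A a -> A a' -> B b -> B b' -> a ++ b = a' ++ b' -> a = a') ->
  (\sum_(i < m.+1) seq.size (level A i) * seq.size (level B (m - i))
   <= seq.size (level C m))%N.
Proof.
move=> ABC inj; rewrite -size_cats; apply: uniq_leq_size; last first.
  move=> ts /allpairsPdep[i [p [+ /allpairsPdep[a [b [+ + ->]]] ->]]].
  rewrite mem_iota !mem_level => im /andP[/asboolP Aa /eqP ai] /andP[/asboolP Bb /eqP bi].
  apply/andP; split; first by apply/asboolP/ABC; exists a, b.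
  by rewrite fsize_cat ai bi; apply/eqP; lia.
apply: allpairs_uniq_dep; first exact: iota_uniq.
  move=> i _; apply: allpairs_uniq_dep => [|? _|]; try exact: level_uniq.
  move=> _ _ /allpairsPdep[a [b [+ + ->]]] /allpairsPdep[a' [b' [+ + ->]]] /=.
  rewrite !mem_level => /andP[/asboolP Aa _] /andP[/asboolP Bb _].
  move=> /andP[/asboolP Aa' _] /andP[/asboolP Bb' _] e.
  have aa := inj _ _ _ _ Aa Aa' Bb Bb' e; rewrite aa in e *.
  by move/eqP: e; rewrite eqseq_cat// eqxx /= => /eqP ->.
move=> _ _ /allpairsPdep[i [p [_ + ->]]] /allpairsPdep[i' [p' [_ + ->]]] /=.
move=> /allpairsPdep[a [b [+ + pE]]] /allpairsPdep[a' [b' [+ + p'E]]].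
rewrite !mem_level => /andP[/asboolP Aa /eqP ai] /andP[/asboolP Bb _].
move=> /andP[/asboolP Aa' /eqP ai'] /andP[/asboolP Bb' _] e.
have aa : a = a' by apply: inj Bb Bb' _; rewrite // -pE -p'E.
have ii : i = i' by rewrite -ai -ai' aa.
by rewrite -ii e.
Qed.

Variable R : realType.

Definition cnt A m : R := (seq.size (level A m))%:R.

Lemma cnt_ge0 A m : 0 <= cnt A m.
Proof. exact: ler0n. Qed.

Lemma cntE A m : cnt A m = \sum_(ts <- forests m | `[< A ts >]) 1.
Proof. by rewrite /cnt size_filter -sum1_count natr_sum. Qed.

Lemma cnt_sub_at A B m : (forall ts, fsize ts = m -> A ts -> B ts) ->
  cnt A m <= cnt B m.
Proof.
move=> AB; rewrite ler_nat; apply: uniq_leq_size (level_uniq _ _) _ => ts.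
rewrite !mem_level => /andP[/asboolP Ats tm]; rewrite tm andbT.
by apply/asboolP/AB => //; exact/eqP.
Qed.

Lemma cnt_sub A B m : A `<=` B -> cnt A m <= cnt B m.
Proof. by move=> AB; apply: cnt_sub_at => ts _ /AB. Qed.

Lemma eq_cnt_at A B m : (forall ts, fsize ts = m -> (A ts <-> B ts)) ->
  cnt A m = cnt B m.
Proof. by move=> AB; apply/eqP; rewrite eq_le !cnt_sub_at// => ts /AB[]. Qed.

Lemma eq_cnt A B m : (forall ts, A ts <-> B ts) -> cnt A m = cnt B m.
Proof. by move=> AB; apply/eqP; rewrite eq_le !cnt_sub// => ts /AB. Qed.

Lemma cnt_subU A B C m : A `<=` B `|` C -> cnt A m <= cnt B m + cnt C m.
Proof.
move=> ABC; apply: le_trans (cnt_sub m ABC) _.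
rewrite /cnt -natrD -size_cat ler_nat; apply: uniq_leq_size (level_uniq _ _) _ => ts.
rewrite mem_cat !mem_level -andb_orl => /andP[/asboolP h ->]; rewrite andbT.
by case: h => h; apply/orP; [left|right]; exact/asboolP.
Qed.

Lemma cnt_class (I : finType) (k : seq (tree n) -> I) A m :
  cnt A m = \sum_i cnt (A `&` [set ts | k ts = i]) m.
Proof.
rewrite cntE (partition_big k xpredT)//=; apply: eq_bigr => i _.
rewrite cntE; apply: eq_bigl => ts; rewrite /setI asbool_and.
by congr (_ && _); apply/eqP/asboolP.
Qed.

Lemma cnt_split (p : pred (seq (tree n))) A m : cnt A m =
  cnt (A `&` [set ts | p ts]) m + cnt (A `&` [set ts | ~~ p ts]) m.
Proof.
rewrite (cnt_class p) big_bool /=; congr (_ + _); apply: eq_cnt => ts /=.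
by split=> -[Ats] => [/negbT|/negbTE].
Qed.

Lemma cnt_set0 m : cnt set0 m = 0.
Proof.
rewrite /cnt /level (eq_filter (a2 := pred0)) ?filter_pred0// => ts.
by apply/asboolP.
Qed.

Lemma cnt_cat_le A B C m : C `<=` catset A B -> cnt C m <= cauchy_prod (cnt A) (cnt B) m.
Proof.
move=> /(size_level_cat_le m) h; apply: (@le_trans _ _ (_%:R)).
  by rewrite ler_nat; exact: h.
by rewrite natr_sum; apply: ler_sum => i _; rewrite natrM.
Qed.

Lemma cnt_cat_ge A B C m : catset A B `<=` C ->
  (forall a a' b b', A a -> A a' -> B b -> B b' -> a ++ b = a' ++ b' -> a = a') ->
  cauchy_prod (cnt A) (cnt B) m <= cnt C m.
Proof.
move=> ABC /(size_level_cat_ge m ABC) h.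
apply: (@le_trans _ _ (\sum_(i < m.+1) seq.size (level A i) *
    seq.size (level B (m - i)))%N%:R); last by rewrite ler_nat; exact: h.
by rewrite natr_sum; apply: ler_sum => i _; rewrite natrM.
Qed.

Lemma cnt_single_cat T B C m :
  (forall ts, C ts <-> catset (single T) B ts) ->
  cnt C m = cauchy_prod (cnt (single T)) (cnt B) m.
Proof.
move=> CE; apply/eqP; rewrite eq_le cnt_cat_le ?cnt_cat_ge//.
- by move=> ts /CE.
- by move=> _ _ b b' [t _ ->] [t' _ ->] _ _ [->].
- by move=> ts /CE.
Qed.

Lemma cnt_nodeset c A m : cnt (single (nodeset c A)) m = sh (cnt A) m.
Proof.
case: m => [|m] /=.
  rewrite /cnt (_ : level _ _ = [::])//; apply/eqP; rewrite -[_ == _]negbK -has_filter.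
  by apply/hasPn => ts; rewrite mem_forests => /eqP h; apply/asboolP => -[t [us _ ->] tsE];
    move: h; rewrite tsE.
rewrite /cnt -(size_map (fun ts => [:: Node c ts]) (level A m)); congr (_%:R).
apply/perm_size/uniq_perm; first exact: level_uniq.
  by rewrite map_inj_uniq ?level_uniq// => a b [].
move=> ts; rewrite mem_level; apply/andP/mapP => [[/asboolP[t [us Aus ->] ->]]|].
  rewrite /fsize /= addn0 eqSS => h; exists us => //.
  by rewrite mem_level h andbT; exact/asboolP.
move=> [us]; rewrite mem_level => /andP[/asboolP Aus h] ->; split.
  by apply/asboolP; exists (Node c us) => //; exists us.
by rewrite /fsize /= addn0 eqSS.
Qed.

Lemma cnt_nil m : cnt [set [::]] m = delta0 R m.
Proof.
rewrite /delta0 /cnt; congr (_%:R); case: eqP => [->|m0].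
  rewrite -[RHS]/(seq.size [:: ([::] : seq (tree n))]).
  apply/perm_size/uniq_perm => //; first exact: level_uniq.
  move=> ts; rewrite mem_level inE; apply/andP/eqP => [[/asboolP]//|->].
  by split=> //; apply/asboolP.
apply/eqP; rewrite size_eq0 -[_ == _]negbK -has_filter; apply/hasPn => ts.
by rewrite mem_forests => /eqP h; apply/asboolP => tsE; apply: m0; rewrite -h tsE.
Qed.

Lemma cnt_leaf (P : pred (literal n)) m :
  cnt (single [set t | exists2 l, P l & t = Leaf l]) m = #|P|%:R * sh (delta0 R) m.
Proof.
have [->|m1] := eqVneq m 1%N.
  rewrite /= /delta0 /= mulr1 /cnt cardE -(size_map (fun l => [:: Leaf l]) (enum P)).
  congr (_%:R); apply/perm_size/uniq_perm; first exact: level_uniq.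
    by rewrite map_inj_uniq ?enum_uniq// => a b [].
  move=> ts; rewrite mem_level; apply/andP/mapP => [[/asboolP[t [l Pl ->] ->] _]|].
    by exists l; rewrite ?mem_enum.
  move=> [l]; rewrite mem_enum => Pl ->; split => //.
  by apply/asboolP; exists (Leaf l) => //; exists l.
rewrite (_ : sh _ m = 0) ?mulr0; last first.
  by case: m m1 => [|[|m]] //=; rewrite /delta0.
apply/eqP; rewrite /cnt pnatr_eq0 size_eq0 -[_ == _]negbK -has_filter; apply/hasPn => ts.
rewrite mem_forests => /eqP h; apply/asboolP => -[t [l _ ->] tsE].
by move: m1; rewrite -h tsE /fsize.
Qed.

Lemma count_sizedE (F : set (tree n)) m :
  (count_sized F m)%:R = cnt (single [set t | Defs.associative t /\ F t]) m.
Proof.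
rewrite /cnt /count_sized; congr (_%:R).
rewrite -(size_map (fun t : tree n => [:: t])).
apply/perm_size/uniq_perm; last 1 first.
- move=> ts; rewrite mem_level; apply/idP/idP.
    move=> /mapP[t]; rewrite in_fset_set ?inE//=; last exact: finite_sized.
    move=> -[at_ Ft tm] ->; rewrite /fsize /= addn0 tm eqxx andbT.
    by apply/asboolP; exists t.
  move=> /andP[/asboolP[t [at_ Ft] ->]]; rewrite /fsize /= addn0 => /eqP tm.
  apply/mapP; exists t => //; rewrite in_fset_set ?inE//; exact: finite_sized.
- by rewrite map_inj_uniq ?fset_uniq// => a b [].
- exact: level_uniq.
Qed.

End Counting.

(** * Decomposition of associative trees, refined by a value in a finite set *)

Definition dual_connective (c : connective) := if c is Conj then Disj else Conj.

Lemma dual_connectiveK : involutive dual_connective.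
Proof. by case. Qed.

Section Structure.
Variable n : nat.
Implicit Types (d : connective) (t : tree n) (ts us : seq (tree n)).

Definition child d t := Defs.associative t && (root_label t != Some d).
Definition forest d ts := all (child d) ts.

Lemma associative_node d ts :
  Defs.associative (Node d ts) = (1 < seq.size ts)%N && forest d ts.
Proof.
rewrite /=; congr (_ && _); rewrite andbC -all_predI; exact: eq_all.
Qed.

Lemma childP d t : child d t <-> (exists l, t = Leaf l) \/
  (exists ts, [/\ t = Node (dual_connective d) ts, (1 < seq.size ts)%N &
    forest (dual_connective d) ts]).
Proof.
split=> [|[[l ->]|[ts [-> s2 fts]]]].
- case: t => [l _|c ts]; first by left; exists l.
  rewrite /child associative_node /= => /andP[/andP[s2 fts] cd]; right; exists ts.
  by case: c d fts cd => -[].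
- by [].
- by rewrite /child associative_node s2 fts /=; case: d {fts}.
Qed.

Lemma forest_cat d ts us : forest d (ts ++ us) = forest d ts && forest d us.
Proof. exact: all_cat. Qed.

End Structure.

Section Census.
Variables (R : realType) (n : nat) (G : finType).
Variables (op : connective -> G -> G -> G) (phi : tree n -> G).
Variable psi : connective -> seq (tree n) -> G.
Hypothesis psi_cons : forall d t ts, psi d (t :: ts) = op d (phi t) (psi d ts).
Hypothesis psi_one : forall d t, psi d [:: t] = phi t.
Hypothesis phi_node : forall d ts, phi (Node d ts) = psi d ts.

(** The value [phi] is left abstract: in [unit] the recursions below give the total numbers, in the
    Boolean functions they give the numbers refined by the function computed. *)
Definition children_with d g : set (seq (tree n)) :=
  single [set t | child d t /\ phi t = g].

Definition forests_with d k g : set (seq (tree n)) :=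
  [set ts | [/\ forest d ts, (k <= seq.size ts)%N & psi d ts = g]].

Lemma cnt_forestsS d k g m : cnt R (forests_with d k.+1 g) m =
  \sum_a \sum_(b | op d a b == g)
    cauchy_prod (cnt R (children_with d a)) (cnt R (forests_with d k b)) m.
Proof.
(* A nonempty forest is classified by the values of its first child and of the remaining forest; the
   key of [[::]] is a dummy, as the forests counted have at least one child. *)
pose key ts : G * G :=
  if ts is t :: us then (phi t, psi d us) else (psi d [::], psi d [::]).
rewrite (cnt_class _ key) pair_big_dep /=.
rewrite (bigID (fun p => op d p.1 p.2 == g)) /= addrC big1 ?add0r; last first.
  move=> p pg; rewrite -[RHS](@cnt_set0 n R m); apply: eq_cnt => -[|t us]; split=> //=.
    by case; case.
  by move=> [[_ _]]; rewrite psi_cons => tg pE; move: pg; rewrite -pE /= tg eqxx.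
apply: eq_bigr => -[a b] /= /eqP abg; apply: cnt_single_cat => ts; split.
  case: ts => [[[]]//|t us] /= [[/andP[ct fus] kus _] [ta ub]].
  by exists [:: t], us; split => //; exists t.
move=> [_ [us [[t [ct ta] ->] [fus kus ub] ->]]] /=; rewrite ta ub; split=> //.
by split=> //; rewrite ?psi_cons ?ta ?ub//= /forest /= ct.
Qed.

Lemma cnt_forests0 d g m : cnt R (forests_with d 0 g) m =
  (psi d [::] == g)%:R * delta0 R m + cnt R (forests_with d 1 g) m.
Proof.
rewrite (cnt_split _ (fun ts => nilp ts)); congr (_ + _); last first.
  by apply: eq_cnt => -[|t ts] /=; split=> [[[? ? ?] ?]|[? ? ?]].
case: eqVneq => [pg|pg].
  rewrite mul1r -(@cnt_nil n); by apply: eq_cnt => -[|t ts] /=; split=> [[[? ? ?] ?]|?] //; do !split.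
rewrite mul0r -[RHS](@cnt_set0 n R m); apply: eq_cnt => -[|t ts] /=; split=> [[[_ _ /eqP pg'] ?]|?] //.
by rewrite pg' in pg.
Qed.

Lemma cnt_forests1 d g m : cnt R (forests_with d 1 g) m =
  cnt R (children_with d g) m + cnt R (forests_with d 2 g) m.
Proof.
rewrite (cnt_split _ (fun ts => seq.size ts == 1%N)); congr (_ + _); last first.
  by apply: eq_cnt => -[|t [|t' ts]] /=; split=> [[[? ? ?] ?]|[? ? ?]].
apply: eq_cnt => ts /=; split.
  case: ts => [|t [|t' ts]] /= [[fts _ tg]] // _.
  have /andP[ct _] := fts; by exists t => //; split=> //; rewrite -(psi_one d).
move=> [t [ct tg] ->]; split=> //; split=> //=; first by rewrite ct.
by rewrite psi_one.
Qed.

Lemma cnt_children d g m : cnt R (children_with (dual_connective d) g) m =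
  #|[pred l | phi (Leaf l) == g]|%:R * sh (delta0 R) m +
  sh (cnt R (forests_with d 2 g)) m.
Proof.
rewrite (cnt_split _ (fun ts => if ts is t :: _ then is_leaf t else false)).
congr (_ + _).
  rewrite -cnt_leaf; apply: eq_cnt => ts /=; split.
    move=> [[t [ct tg] ->]]; case: t ct tg => //= l _ lg _.
    by exists (Leaf l) => //; exists l => //; apply/eqP.
  by move=> [t [l /eqP]] /= lg -> ->; split=> //; exists (Leaf l).
rewrite -(@cnt_nodeset n R d); apply: eq_cnt => ts /=; split.
  move=> [[t [/childP[[l ->]|[us [-> s2 fus]]] tg ->]]]//= _.
  rewrite dual_connectiveK in fus *; exists (Node d us) => //; exists us => //.
  by split=> //; rewrite -phi_node -[in LHS](dual_connectiveK d).
move=> [t [us [fus s2 ug] ->] ->]; split=> //; exists (Node d us) => //; split.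
  apply/childP; right; exists us; rewrite dual_connectiveK; split=> //.
by rewrite phi_node.
Qed.

End Census.

(** * The quadratic equation for the number of forests *)

Section Totals.
Variables (R : realType) (n : nat).

Let N : R := (2 * n)%:R.

Let tot_forests d m : R := cnt R [set ts : seq (tree n) | forest d ts] m.
Let tot_children d m : R := cnt R (single [set t : tree n | child d t]) m.

Let op_unit (d : connective) (a b : unit) := tt.
Let phi_unit (t : tree n) := tt.
Let psi_unit (d : connective) (ts : seq (tree n)) := tt.
Let fw d k m := cnt R (forests_with psi_unit d k tt) m.

Let fw0 d m : fw d 0%N m = tot_forests d m.
Proof. by apply: eq_cnt => ts; split=> [[]|]. Qed.

Let cwE d m : cnt R (children_with phi_unit d tt) m = tot_children d m.
Proof.
by apply: eq_cnt => ts; split=> [[t [ct _] ->]|[t ct ->]]; exists t.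
Qed.

Let fwE d m : tot_forests d m = delta0 R m + fw d 1%N m.
Proof. by rewrite -fw0 /fw (cnt_forests0 R psi_unit) eqxx mul1r. Qed.

Let fw1E d m : fw d 1%N m = tot_children d m + fw d 2 m.
Proof. by rewrite /fw (@cnt_forests1 R _ _ phi_unit psi_unit) ?cwE. Qed.

Let fw1_cauchy d m : fw d 1%N m = cauchy_prod (tot_children d) (tot_forests d) m.
Proof.
rewrite /fw (@cnt_forestsS R _ _ op_unit phi_unit psi_unit)//.
rewrite (big_pred1 tt) => [|[]]//; rewrite (big_pred1 tt) => [|[]]//.
by apply: eq_cauchy => i _; rewrite ?cwE// -fw0.
Qed.

Let tot_children_dual d m : tot_children (dual_connective d) m =
  N * sh (delta0 R) m + sh (fw d 2) m.
Proof.
rewrite -cwE (@cnt_children R _ _ phi_unit psi_unit)//; congr (_%:R * _ + _).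
rewrite (eq_card (B := xpredT)) => [|l]; last by rewrite inE eqxx.
by rewrite card_prod card_ord card_bool mulnC.
Qed.

(** Simultaneous induction on the size: children of size [m] depend on forests of size [m - 1] over
    the dual label and, since no child has size 0, forests of size [m] depend on children of size at
    most [m] and on smaller forests. *)
Let tot_dual d m : tot_children d m = tot_children (dual_connective d) m /\
  tot_forests d m = tot_forests (dual_connective d) m.
Proof.
elim/ltn_ind: m d => m IH d.
have ac k : (k <= m)%N -> tot_children d k = tot_children (dual_connective d) k.
  move=> km; rewrite tot_children_dual -{1}[d]dual_connectiveK tot_children_dual.
  case: k km => [|k] km //=; congr (_ + _).
  have [a1 f1] := IH k km d.
  have := fwE d k; have := fwE (dual_connective d) k; rewrite !fw1E -a1 -f1.
  by move=> -> /addrI/addrI.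
split; first exact: ac.
rewrite !fwE !fw1_cauchy /cauchy_prod !big_ord_recl; congr (_ + (_ + _)).
  by rewrite tot_children_dual -{1}[d]dual_connectiveK tot_children_dual /= !mulr0
    !addr0 !mul0r.
apply: eq_bigr => i _; have im := ltn_ord i.
rewrite ac /= /bump /=; last by lia.
by have [|_ ->//] := IH (m - (1 + i))%N _ d; lia.
Qed.

Definition forest_count m : R := tot_forests Conj m.
Definition child_count m : R := tot_children Conj m.

Lemma cnt_all_forests d m : cnt R [set ts : seq (tree n) | forest d ts] m = forest_count m.
Proof. by case: d => //; exact: esym (proj2 (tot_dual Conj m)). Qed.

Lemma cnt_all_children d m :
  cnt R (single [set t : tree n | child d t]) m = child_count m.
Proof. by case: d => //; exact: esym (proj1 (tot_dual Conj m)). Qed.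

Lemma forest_countE m : forest_count m = delta0 R m + cauchy_prod child_count forest_count m.
Proof. by rewrite /forest_count fwE fw1_cauchy. Qed.

(** A child is a leaf or a node over a forest that is neither empty nor a single child, so
    [a = N z + z (V - 1 - a)]; the relation closes up on one pair of sequences because both labels
    have the same counts. *)
Lemma child_countE m : child_count m + sh child_count m =
  (N - 1) * sh (delta0 R) m + sh forest_count m.
Proof.
rewrite [child_count m](proj1 (tot_dual Conj m)) tot_children_dual.
case: m => [|m] /=; first by rewrite !mulr0 !addr0.
by rewrite /forest_count fwE fw1E -/(tot_children Conj m); ring.
Qed.

Lemma child_count_ge0 m : 0 <= child_count m.
Proof. exact: cnt_ge0. Qed.

Lemma child_count_le m : child_count m <= forest_count m.
Proof.
apply: cnt_sub => ts [t ct ->]; by rewrite /= /forest/= ct.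
Qed.

Lemma forest_count0 : forest_count 0%N = 1.
Proof.
rewrite forest_countE /cauchy_prod big_ord1.
have := child_countE 0; rewrite /= mulr0 !addr0 => ->.
by rewrite mul0r addr0.
Qed.

(** Multiply [child_countE] by [V] and replace [a V] by [V - 1]. *)
Lemma forest_count_rec m : forest_count m.+1 =
  cauchy_prod forest_count forest_count m + (N - 2) * forest_count m + delta0 R m.
Proof.
have : cauchy_prod forest_count (fun k => child_count k + sh child_count k) m.+1 =
    (N - 1) * forest_count m + cauchy_prod forest_count forest_count m.
  rewrite (eq_cauchy (f' := forest_count) (g' := fun k =>
    (N - 1) * sh (delta0 R) k + sh forest_count k)) => // [|i _]; last exact: child_countE.
  by rewrite cauchyDr cauchyZr !cauchy_shr /= cauchy1r.
rewrite cauchyDr cauchy_shr /= [cauchy_prod forest_count child_count _]cauchyC.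
rewrite [cauchy_prod forest_count child_count m]cauchyC.
have := forest_countE m; have := forest_countE m.+1.
by rewrite {1}/delta0 /= add0r => <- ->; lra.
Qed.

End Totals.

Section OscillationShift.
Variables (R : realType) (N : R) (V : nat -> R).
Hypotheses (N2 : 2 <= N) (V0 : V 0%N = 1).
Hypothesis Vrec :
  forall m, V m.+1 = cauchy_prod V V m + (N - 2) * V m + delta0 R m.
Variable G : finType.

(** The factor [V m / V m.+1] differs at the two sizes; as it tends to [rho] and the frequencies are
    bounded, the difference only enters the slack. *)
Lemma osc_le_sh (f : G -> nat -> R) C d : 0 <= d ->
  (forall a, dominated V C (f a)) -> osc_le (fun a => ratio V (f a)) d ->
  osc_le (fun a => ratio V (sh (f a))) (radius N * d).
Proof.
move=> d0 fC fd eps eps0; set rho := radius N.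
have rho0 : 0 < rho := radius_gt0 N2.
have V_gt0 := growth_gt0 N2 V0 Vrec.
have C0 m : 0 <= \sum_a ratio V (f a) m <= #|G|%:R * C.
  rewrite sumr_ge0 => [|a _]; last by have /andP[] := ratio_bound N2 V0 Vrec (fC a) m.
  rewrite mulr_natl -sumr_const ler_sum// => a _.
  by have /andP[] := ratio_bound N2 V0 Vrec (fC a) m.
set B := #|G|%:R * C in C0.
have B0 : 0 <= B by have /andP[/le_trans] := C0 0%N; apply.
(* A bound on the coefficient of [e] in the final error [(d + e) * (rho + e) + 2 * B * e], where
   [e <= 1] takes care of the square. *)
pose D := rho + d + 1 + 2 * B.
have D0 : 0 < D by rewrite /D; move: rho0 d0 B0; rewrite -/rho; lra.
pose e := Num.min 1 (eps / D).
have e0 : 0 < e by rewrite lt_min ltr01 divr_gt0.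
have e1 : e <= 1 by rewrite ge_min lexx.
have eD : e * D <= eps by rewrite -ler_pdivlMr// ge_min lexx orbT.
have [M HM] := fd _ e0.
have /cvgrPdist_le/(_ _ e0)[M' _ HM'] := growth_inv_ratio_cvg N2 V0 Vrec.
exists (M + M').+1 => -[//|m] [//|m']; rewrite !ltnS => Mm Mm'.
have [t [t0 tr tE]] : exists t : nat -> R, [/\ forall k, 0 <= t k,
    forall k, (M + M' <= k)%N -> `|t k - rho| <= e &
    forall a k, ratio V (sh (f a)) k.+1 = ratio V (f a) k * t k].
  exists (fun k => V k / V k.+1); split=> [k|k Mk|a k].
  - by rewrite divr_ge0 ?ltW.
  - by rewrite distrC; apply: HM'; rewrite /= (leq_trans (leq_addl _ _) Mk).
  - exact: ratio_sh N2 V0 Vrec _ _.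
have h1 : \sum_a `|ratio V (f a) m - ratio V (f a) m'| <= d + e.
  by apply: HM; [exact: leq_trans (leq_addr _ _) Mm|exact: leq_trans (leq_addr _ _) Mm'].
apply: (@le_trans _ _ ((d + e) * t m + B * (e + e))).
  apply: (@le_trans _ _ (\sum_a (`|ratio V (f a) m - ratio V (f a) m'| * t m
      + ratio V (f a) m' * `|t m - t m'|))).
    apply: ler_sum => a _; rewrite !tE.
    rewrite (_ : _ * t m - _ = (ratio V (f a) m - ratio V (f a) m') * t m +
      ratio V (f a) m' * (t m - t m')); last by ring.
    apply: le_trans (ler_normD _ _) _; apply: lerD; rewrite normrM.
      by rewrite (ger0_norm (t0 m)).
    have /andP[r0 _] := ratio_bound N2 V0 Vrec (fC a) m'.
    by rewrite (ger0_norm r0).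
  have /andP[S0 SB] := C0 m'; rewrite big_split /=; apply: lerD.
    by rewrite -mulr_suml ler_wpM2r.
  have tt : `|t m - t m'| <= e + e.
    rewrite (_ : t m - t m' = (t m - rho) - (t m' - rho)); last by ring.
    by apply: le_trans (ler_normB _ _) _; apply: lerD; apply: tr.
  apply: le_trans (ler_pM S0 (normr_ge0 _) SB tt).
  by rewrite le_eqVlt mulr_suml eqxx.
have tm : t m <= rho + e.
  by have := tr m Mm; rewrite ler_norml => /andP[_]; lra.
have h2 : (d + e) * t m <= (d + e) * (rho + e) by rewrite ler_wpM2l// addr_ge0// ltW.
apply: le_trans (lerD h2 (lexx _)) _; apply: le_trans (lerD (lexx _) eD).
have := ler_wpM2l (ltW e0) e1; rewrite /D; lra.
Qed.

End OscillationShift.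

(** * Convergence of the proportions *)

Section Convergence.
Variables (R : realType) (n : nat) (G : finType).
Hypothesis n0 : (0 < n)%N.
Variables (op : connective -> G -> G -> G) (phi : tree n -> G).
Variable psi : connective -> seq (tree n) -> G.
Hypothesis psi_cons : forall d t ts, psi d (t :: ts) = op d (phi t) (psi d ts).
Hypothesis psi_one : forall d t, psi d [:: t] = phi t.
Hypothesis phi_node : forall d ts, phi (Node d ts) = psi d ts.
Variable z : connective -> G.
Hypothesis op_z : forall d b, op d (z d) b = z d.
Hypothesis z_child : forall d, exists2 t, child d t & phi t = z d.

Let N : R := (2 * n)%:R.
Let V := forest_count R n.
Let rho := radius N.
Let s := Num.sqrt N.
Let v := 1 + s.

Lemma literals_ge2 : 2 <= (2 * n)%:R :> R.
Proof. by rewrite ler_nat; lia. Qed.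
Let N2 : 2 <= N := literals_ge2.
Let V0 : V 0%N = 1 := forest_count0 R n.
Let Vrec : forall m, V m.+1 = cauchy_prod V V m + (N - 2) * V m + delta0 R m :=
  forest_count_rec R n.
Let V_gt0 := growth_gt0 N2 V0 Vrec.
Let rho_gt0 : 0 < rho := radius_gt0 N2.
Let rho_ge0 : 0 <= rho := ltW rho_gt0.
Let s_gt0 : 0 < s. Proof. by rewrite sqrtr_gt0 (lt_le_trans _ N2). Qed.

Let f d a m : R := cnt R (children_with phi d a) m.
Let g k d a m : R := cnt R (forests_with psi d k a) m.

Let f_dom d a : dominated V 1 (f d a).
Proof.
move=> m; rewrite cnt_ge0 mul1r /V -(@cnt_all_forests R n d) cnt_sub// => ts.
by move=> [t [ct _] ->]; rewrite /= /forest /= ct.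
Qed.

Let g_dom k d a : dominated V 1 (g k d a).
Proof. by move=> m; rewrite cnt_ge0 mul1r /V -(@cnt_all_forests R n d) cnt_sub// => ts []. Qed.

Let sum_f d m : \sum_a f d a m = child_count R n m.
Proof.
rewrite -(@cnt_all_children R n d) (cnt_class R (psi d)); apply: eq_bigr => a _.
apply: eq_cnt => ts; split=> [[t [ct ta] ->]|[[t ct ->] ta]].
  by split; [exists t|rewrite /= psi_one].
by exists t => //; split=> //; rewrite -(psi_one d).
Qed.

Let sum_g0 d m : \sum_a g 0 d a m = V m.
Proof.
rewrite /V -(@cnt_all_forests R n d) (cnt_class R (psi d)); apply: eq_bigr => a _.
by apply: eq_cnt => ts; split=> [[]|[]].
Qed.

Let g01 d a m : g 0 d a m = (psi d [::] == a)%:R * delta0 R m + g 1 d a m.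
Proof. exact: cnt_forests0. Qed.

Let sum_g1 d m : \sum_a g 1 d a m + delta0 R m = V m.
Proof.
rewrite -(sum_g0 d) (eq_bigr _ (fun a _ => g01 d a m)) big_split /= addrC.
congr (_ + _); rewrite -mulr_suml (bigD1 (psi d [::]))//= eqxx big1 ?addr0 ?mul1r//.
by move=> a; rewrite eq_sym => /negbTE ->.
Qed.

Let ratio_sum (h : G -> nat -> R) m :
  \sum_a ratio V (h a) m = (\sum_a h a m) / V m.
Proof. by rewrite mulr_suml. Qed.

Let wsum_ex (h : connective -> G -> nat -> R) :
  (forall d a, dominated V 1 (h d a)) ->
  exists w, forall d a, wsum rho (h d a) (w d a).
Proof.
move=> hdom; have hw d a : exists w, wsum rho (h d a) w.
  have [w gw _] := ex_wsum_le rho_ge0 (hdom d a)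
    (@wsumZ _ _ 1 _ _ (wsum_growth N2 V0 Vrec)); by exists w.
have /choice[w Hw] : forall p : connective * G, exists w, wsum rho (h p.1 p.2) w.
  by move=> [d a]; exact: hw.
by exists (fun d a => w (d, a)) => d a; exact: Hw (d, a).
Qed.

Let wsum_sum (h : G -> nat -> R) (w : G -> R) :
  (forall a, wsum rho (h a) (w a)) ->
  wsum rho (fun m => \sum_a h a m) (\sum_a w a).
Proof.
move=> hw; rewrite /wsum (_ : psum _ = fun M => \sum_a psum (fun i => h a i * rho ^+ i) M).
  by apply: cvg_finite_sum => a _; exact: hw.
apply/funext => M; rewrite /psum exchange_big; apply: eq_bigr => i _.
by rewrite mulr_suml.
Qed.

Let good_child : good N V (child_count R n) (s / (1 + s)) (v ^- 2) :=
  good_children N2 V0 Vrec (@child_count_ge0 R n) (child_countE R n).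

(** Let the children oscillate by at most [del]. A forest is empty or a first child followed by a
    forest, so forests oscillate by at most [v * del / (1 - k)], where [k] is the weight of the
    children whose value is not absorbing, and forests with two children or more by [k] times this
    plus [(v - 1) * del]. One more factor [rho] gives [th]. If [k] were the full weight
    [s / (1 + s)] of the children, [th] would be exactly 1; [z_child] makes it smaller. *)
Lemma children_with_cvg d a : cvgn (ratio V (cnt R (children_with phi d a))).
Proof.
have [wf fw] := wsum_ex f_dom; have [wg gw] := wsum_ex (g_dom 0).
have [wg1 gw1] := wsum_ex (g_dom 1).
have wf_ge0 e b : 0 <= wf e b.
  have f0 i : 0 <= f e b i by exact: cnt_ge0.
  by have := psum_le_wsum 0 rho_ge0 f0 (fw e b); rewrite /psum big_ord0.
have sum_wf e : \sum_b wf e b = s / (1 + s).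
  case: good_child => _ cw _; apply: wsum_unique cw.
  by apply: eq_wsum (wsum_sum (fw e)) => m; exact: sum_f.
have sum_wg e : \sum_b wg e b = v.
  apply: wsum_unique (wsum_growth N2 V0 Vrec).
  by apply: eq_wsum (wsum_sum (gw e)) => m; exact: sum_g0.
have sum_wg1 e : \sum_b wg1 e b = v - 1.
  have := wsumD (wsum_sum (gw1 e)) (wsum_delta0 rho).
  move=> /(eq_wsum (sum_g1 e))/(wsum_unique (wsum_growth N2 V0 Vrec)).
  by rewrite -/s -/v => ->; rewrite addrK.
have wz_gt0 e : 0 < wf e (z e).
  have [t ct tz] := z_child e.
  have f0 i : 0 <= f e (z e) i by exact: cnt_ge0.
  have := psum_le_wsum (nodes t).+1 rho_ge0 f0 (fw e (z e)).
  apply: lt_le_trans; rewrite psumS ltr_wpDl//.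
    by apply: sumr_ge0 => i _; rewrite mulr_ge0// exprn_ge0.
  rewrite mulr_gt0 ?exprn_gt0// /f /cnt ltr0n lt0n size_eq0 -[_ == _]negbK -has_filter.
  rewrite negbK; apply/hasP; exists [:: t]; first by rewrite mem_forests /fsize /= addn0.
  by apply/asboolP; exists t.
pose k e := \sum_(b | b != z e) wf e b.
have k_ge0 e : 0 <= k e by exact: sumr_ge0.
have k_lt e : k e < s / (1 + s).
  by rewrite -(sum_wf e) (bigD1 (z e))//= ltrDr.
pose th e := rho * (k e * (v / (1 - k e)) + (v - 1)).
have v_gt0 : 0 < v by rewrite addr_gt0.
have v1 : 0 <= v - 1 by rewrite /v addrC addrA addNr add0r ltW.
have A1 : s / (1 + s) = 1 - v^-1 by rewrite /v; field; rewrite gt_eqF.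
have k_lt1 e : 0 < 1 - k e.
  by rewrite subr_gt0 (lt_le_trans (k_lt e))// A1 gerBl invr_ge0 ltW.
have th_ge0 e : 0 <= th e.
  by rewrite /th mulr_ge0// addr_ge0// mulr_ge0// divr_ge0// ltW.
(* [rho * (v ^+ 2 - 1) = 1] is the criticality of the branching structure. *)
have th_lt1 e : th e < 1.
  have vk : v / (1 - k e) <= v ^+ 2.
    rewrite ler_pdivrMr// expr2 -mulrA ler_pMr// mulrC -ler_pdivrMr// mul1r.
    by have := k_lt e; rewrite A1; lra.
  have h : k e * (v / (1 - k e)) < (1 - v^-1) * v ^+ 2.
    apply: le_lt_trans (ler_wpM2l (k_ge0 e) vk) _.
    by rewrite ltr_pM2r ?exprn_gt0// -A1.
  have vE : (1 - v^-1) * v ^+ 2 + (v - 1) = rho^-1.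
    by rewrite /rho radiusE// -/s invrK /v; field; rewrite gt_eqF.
  by rewrite /th -ltr_pdivlMl// mulr1 -vE ltrD2r.
have delta0_gt m : (0 < m)%N -> delta0 R m = 0 by case: m.
have V_neq0 m : V m != 0 by rewrite gt_eqF.
have r0 (h : connective -> G -> nat -> R) e b m : dominated V 1 (h e b) ->
    0 <= ratio V (h e b) m.
  by move=> h1; have /andP[] := ratio_bound N2 V0 Vrec h1 m.
have step e del : 0 <= del -> osc_le (fun b => ratio V (f e b)) del ->
    osc_le (fun b => ratio V (f (dual_connective e) b)) (th e * del).
  move=> del0 fdel.
  have g1 eta : osc_le (fun b => ratio V (g 0 e b)) eta ->
      osc_le (fun b => ratio V (g 1 e b)) (k e * eta + v * del).
    move=> geta; rewrite -(sum_wg e).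
    apply: (osc_le_cauchy N2 V0 Vrec (op_z e) (f_dom e) (g_dom 0 e) _ (fw e) (gw e)) => //.
      by move=> c m; exact: cnt_forestsS.
    by near=> m; rewrite ratio_sum sum_g0 divff.
  have g0 : osc_le (fun b => ratio V (g 0 e b)) (v * del / (1 - k e)).
    apply: (@contraction_fixpoint _ _ _ _ 2) => //.
    - by move=> x y; exact: osc_le_mono.
    - by move=> x; exact: osc_le_lim.
    - by apply/andP; split; [exact: k_ge0|rewrite -subr_gt0; exact: k_lt1].
    - exact: mulr_ge0 (ltW v_gt0) del0.
    - apply: osc_le_init => [b m|m]; first exact: r0.
      by rewrite ratio_sum sum_g0 divff.
    move=> eta _ /g1; apply: eq_osc_le => b; near=> m.
    rewrite /ratio g01 delta0_gt ?mulr0 ?add0r//.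
    by near: m; exact: nbhs_infty_gt.
  have g2 : osc_le (fun b => ratio V (g 2 e b))
      (k e * (v * del / (1 - k e)) + (v - 1) * del).
    rewrite -(sum_wg1 e).
    apply: (osc_le_cauchy N2 V0 Vrec (op_z e) (f_dom e) (g_dom 1 e) _ (fw e) (gw1 e)) => //.
    - by move=> c m; exact: cnt_forestsS.
    - near=> m; have m0 : (0 < m)%N by near: m; exact: nbhs_infty_gt.
      by have := sum_g1 e m; rewrite delta0_gt// addr0 ratio_sum => ->; rewrite divff.
    apply: eq_osc_le g0 => b; near=> m.
    rewrite /ratio g01 delta0_gt ?mulr0 ?add0r//.
    by near: m; exact: nbhs_infty_gt.
  have eta_ge0 : 0 <= k e * (v * del / (1 - k e)) + (v - 1) * del.
    have vd0 : 0 <= v * del := mulr_ge0 (ltW v_gt0) del0.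
    by apply: addr_ge0; apply: mulr_ge0 => //; apply: divr_ge0 => //; exact: ltW.
  have := osc_le_sh N2 V0 Vrec eta_ge0 (g_dom 2 e) g2.
  rewrite (_ : _ * _ = th e * del); last by rewrite /th -/rho; field; rewrite gt_eqF.
  apply: eq_osc_le => b; near=> m.
  have m1 : (1 < m)%N by near: m; exact: nbhs_infty_gt.
  rewrite /ratio /f (@cnt_children R _ _ phi psi)// (_ : sh (delta0 R) m = 0) ?mulr0 ?add0r//.
  by clear -m1; case: m m1 => [|[]].
(* A step leads from the children below one label to those below the dual one, hence a common factor
   for both labels. *)
pose T := Num.max (th Conj) (th Disj).
have thT e : th e <= T by rewrite le_max; case: e; rewrite lexx ?orbT.
have T0 : 0 <= T := le_trans (th_ge0 Conj) (thT Conj).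
have : forall e, osc_le (fun b => ratio V (f e b)) (0 / (1 - T)).
  apply: (@contraction_fixpoint _ (fun x => forall e, osc_le (fun b => ratio V (f e b)) x)
    T 0 2) => //.
  - by move=> x y xy h e; exact: osc_le_mono (h e).
  - by move=> x h e; apply: osc_le_lim => eps eps0; exact: h.
  - by rewrite T0 gt_max !th_lt1.
  - move=> e; apply: osc_le_init => [b m|m]; first exact: r0.
    rewrite ratio_sum sum_f ler_pdivrMr// mul1r; exact: child_count_le.
  move=> x x0 h e; rewrite addr0 -[e]dual_connectiveK.
  apply: osc_le_mono (step _ _ x0 (h (dual_connective e))).
  by rewrite ler_wpM2r.
by rewrite mul0r => /(_ d)/osc_le0_cvg; apply.
Unshelve. all: by end_near.
Qed.

End Convergence.

(** * Trees computing a literal *)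

Section Semantics.
Variable n : nat.
Implicit Types (d : connective) (t u : tree n) (ts us ws : seq (tree n)).
Implicit Types (v : assignment n) (x y l : literal n).

Definition op_fun d (f g : boolfun n) : boolfun n :=
  [ffun v => if d is Conj then f v && g v else f v || g v].

Definition node_fun d ts : boolfun n := fun_of_tree (Node d ts).

Lemma node_fun_cons d t ts :
  node_fun d (t :: ts) = op_fun d (fun_of_tree t) (node_fun d ts).
Proof. by apply/ffunP => v; rewrite !ffunE; case: d. Qed.

Lemma node_fun1 d t : node_fun d [:: t] = fun_of_tree t.
Proof. by apply/ffunP => v; rewrite !ffunE; case: d => /=; rewrite ?andbT ?orbF. Qed.

Lemma op_fun_absorbing d f : op_fun d (const_fun n (~~ neutral d)) f = const_fun n (~~ neutral d).
Proof. by apply/ffunP => v; rewrite !ffunE; case: d. Qed.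

(* A tree is active under [v] below a node labelled [d] when its value is the
   absorbing one for [d]; up to negating all values this treats both
   connectives as [Disj]. *)
Definition active d v t : bool := Defs.eval v t (+) neutral d.

Lemma active_node d v ts : active d v (Node d ts) = has (active d v) ts.
Proof.
rewrite /active; case: d => /=; last by rewrite addbF; apply: eq_has => t; rewrite addbF.
rewrite addbT -has_predC; apply: eq_has => t /=; by rewrite addbT.
Qed.

Lemma active_dual d v ts :
  active d v (Node (dual_connective d) ts) = all (active d v) ts.
Proof.
rewrite /active; case: d => /=; last by rewrite addbF; apply: eq_all => t; rewrite addbF.
rewrite addbT -all_predC; apply: eq_all => t /=; by rewrite addbT.
Qed.

Lemma active_leaf d v l : active d v (Leaf l) = eval_literal l v (+) neutral d.
Proof. by []. Qed.

Definition neg_lit l : literal n := (l.1, ~~ l.2).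

Lemma neg_litK : involutive neg_lit.
Proof. by case=> i b; rewrite /neg_lit /= negbK. Qed.

Lemma active_neg_lit d v l : active d v (Leaf (neg_lit l)) = ~~ active d v (Leaf l).
Proof.
by rewrite !active_leaf -addNb; congr (_ (+) _); case: l => i [] //=;
  rewrite /eval_literal /= negbK.
Qed.

(** Each variable follows [L], except that of [x], which is set to make [x] inactive; this respects
    [L], whose only literal in that variable can be the negation of [x]. The addition of [neutral d]
    accounts for duality. *)
Lemma separating_assignment d (L : seq (literal n)) x :
  (forall y, y \in L -> neg_lit y \notin L) -> x \notin L ->
  exists v, (forall y, y \in L -> active d v (Leaf y)) /\ ~~ active d v (Leaf x).
Proof.
move=> Lneg xL.
exists [ffun i => (if i == x.1 then ~~ x.2 else (i, true) \in L) (+) neutral d].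
have litE y v : eval_literal y v = (v y.1 == y.2).
  by rewrite /eval_literal; case: y.2; case: (v y.1).
split=> [[i b] yL|]; rewrite active_leaf litE ffunE /=.
  case: (i =P x.1) => [ix|_].
    have : b != x.2.
      apply: (contraNneq _ xL) => bx.
      by have -> : x = (i, b) by move: ix bx => /= -> ->; case: (x).
    by case: b {yL}; case: x.2; case: (neutral d).
  case: b yL => yL; first by rewrite yL; case: (neutral d).
  have /negbTE -> : (i, true) \notin L by have := Lneg _ yL.
  by case: (neutral d).
by rewrite eqxx; case: x.2; case: (neutral d).
Qed.

Lemma active_leaf_sub d l x :
  (forall v, active d v (Leaf l) -> active d v (Leaf x)) -> l = x.
Proof.
move=> lx; apply/eqP/negP => /negP lnx.
have [||v [vl /negP vx]] := @separating_assignment d [:: l] x.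
- move=> y; rewrite !inE => /eqP ->; case: (l) => i b; apply/negP => /eqP[].
  by case: b.
- by rewrite inE eq_sym.
- by apply: vx; apply: lx; apply: vl; rewrite inE.
Qed.

Lemma node_fun_active d ts x : node_fun d ts = literal_fun x <->
  (forall v, has (active d v) ts = active d v (Leaf x)).
Proof.
split=> [/ffunP h v|h].
  by have := h v; rewrite -active_node active_leaf /active !ffunE => ->.
apply/ffunP => v; rewrite !ffunE; have := h v.
by rewrite -active_node active_leaf => /addIb.
Qed.

Definition leaf_lit t : option (literal n) := if t is Leaf l then Some l else None.

Definition repr_lit t : option (literal n) :=
  match t with Leaf l => Some l | Node _ ts => ohead (pmap leaf_lit ts) end.

Lemma ohead_pmap_leaf ts y : ohead (pmap leaf_lit ts) = Some y ->
  exists us ws, [/\ ts = us ++ Leaf y :: ws & ~~ has (@is_leaf n) us].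
Proof.
elim: ts => //= -[l|c us] ts IH /=; first by move=> [->]; exists [::], ts.
move=> /IH[us' [ws [-> h]]]; exists (Node c us :: us'), ws; by split.
Qed.

(** When [t] is not a leaf it has the label [d], for which activity is a disjunction, so its
    representative leaf alone makes it active. *)
Lemma active_repr d v t y : child (dual_connective d) t ->
  repr_lit t = Some y -> active d v (Leaf y) -> active d v t.
Proof.
move=> /childP[[l ->] [->]//|[us [-> _ _]] /=].
rewrite dual_connectiveK => /ohead_pmap_leaf[as_ [bs [-> _]]] vy.
by rewrite active_node has_cat /= vy orbT.
Qed.

Definition partial d x : set (tree n) := [set t | [/\ child d t, ~~ is_leaf t,
  forall v, active d v t -> active d v (Leaf x) & exists v, active d v t]].

(** Otherwise the representatives of the children include neither [x] nor two opposite literals: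
    opposite leaves are excluded because some assignment makes all children active. An assignment
    then activates all representatives, hence [t], but not [x]. *)
Lemma partialP d x t : partial d x t -> exists us,
  [/\ t = Node (dual_connective d) us, forest (dual_connective d) us &
   [\/ exists2 u, u \in us & repr_lit u = None,
       exists2 u, u \in us & repr_lit u = Some x |
       exists y u u', [/\ u \in us, u' \in us, repr_lit u = Some y,
         repr_lit u' = Some (neg_lit y) & ~~ is_leaf u || ~~ is_leaf u']]].
Proof.
move=> [/childP[[l ->]//|[us [-> _ fus]]] _ tx [v0 v0t]].
exists us; split=> //; apply: contrapT => none.
have rep u : u \in us -> exists2 y, repr_lit u = Some y & y != x.
  move=> uus; case E : (repr_lit u) => [y|]; last first.
    by exfalso; apply: none; constructor 1; exists u.
  exists y => //; apply/eqP => yx; apply: none; constructor 2; exists u => //.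
  by rewrite E yx.
pose L := pmap repr_lit us.
have LP y : y \in L -> exists2 u, u \in us & repr_lit u = Some y.
  by rewrite mem_pmap => /mapP[u uus ->]; exists u.
have [||v [vL /negP vx]] := @separating_assignment d L x.
- move=> y /LP[u uus uy]; apply/negP => /LP[u' u'us u'y].
  have [/andP[lu lu']|] := boolP (is_leaf u && is_leaf u'); last first.
    rewrite negb_and => h; apply: none; constructor 3.
    by exists y, u, u'.
  move: v0t; rewrite active_dual => /allP v0us.
  have := v0us _ uus; have := v0us _ u'us.
  case: u lu uy {uus} => // l _ [->]; case: u' lu' u'y {u'us} => // l' _ [->].
  by rewrite active_neg_lit => /negbTE ->.
- by apply/negP => /LP[u uus ux]; have [y] := rep _ uus; rewrite ux => -[->]; rewrite eqxx.
apply: vx; apply: tx; rewrite active_dual; apply/allP => u uus.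
have [y uy _] := rep _ uus; apply: (active_repr _ uy).
  by move/allP : fus; apply.
by apply: vL; rewrite mem_pmap; apply/mapP; exists u => //; rewrite uy.
Qed.

Local Notation "A +++ B" := (catset A B) (at level 42, right associativity).

Lemma mem_split (T : eqType) (u : T) (s : seq T) :
  u \in s -> exists a b, s = a ++ u :: b.
Proof. by case/splitPr => a b; exists a, b. Qed.

Definition all_forests d : set (seq (tree n)) := [set ts | forest d ts].

Definition forests_over (T : set (tree n)) : set (seq (tree n)) :=
  [set ts : seq (tree n) | forall t, t \in ts -> T t].

Definition inner d : set (tree n) := [set t | child d t /\ ~~ is_leaf t].

Definition usable d x : set (tree n) :=
  [set t | child d t /\ (~~ is_leaf t \/ t = Leaf x)].

Definition leaf_set l : set (tree n) := [set t | t = Leaf l].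

Definition repr_none d : set (tree n) := [set t | child d t /\ repr_lit t = None].

Definition repr_some d y : set (tree n) := [set t | child d t /\ repr_lit t = Some y].

Definition inner_repr d y : set (tree n) :=
  [set t | [/\ child d t, ~~ is_leaf t & repr_lit t = Some y]].

Definition inner_computing d x : set (tree n) :=
  [set t | [/\ child d t, ~~ is_leaf t & fun_of_tree t = literal_fun x]].

Lemma forests_over_cat T ts us :
  forests_over T (ts ++ us) -> forests_over T ts /\ forests_over T us.
Proof. by move=> h; split=> t tts; apply: h; rewrite mem_cat tts ?orbT. Qed.

Lemma forests_over_cons T t ts : forests_over T (t :: ts) -> T t /\ forests_over T ts.
Proof.
move=> h; split=> [|u uts]; first by apply: h; rewrite mem_head.
by apply: h; rewrite inE uts orbT.
Qed.

Lemma forests_over_all d T ts : (forall t, T t -> child d t) ->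
  forests_over T ts -> forest d ts.
Proof. by move=> Td h; apply/allP => t /h/Td. Qed.

Lemma single_cons T A t ts : T t -> A ts -> (single T +++ A) (t :: ts).
Proof. by move=> Tt Ats; exists [:: t], ts; split=> //; exists t. Qed.

Lemma single_one T t : T t -> single T [:: t].
Proof. by exists t. Qed.

Lemma catset_cat A B ts us : A ts -> B us -> (A +++ B) (ts ++ us).
Proof. by move=> Ats Bus; exists ts, us. Qed.

Lemma forests_over_sub d T : (forall t, T t -> child d t) ->
  forests_over T `<=` [set [::]] `|` (single T +++ all_forests d).
Proof.
move=> Td [|t ts] h; [by left|right]; have [Tt Tts] := forests_over_cons h.
by apply: single_cons => //; exact: forests_over_all Tts.
Qed.

Lemma repr_none_sub d : repr_none (dual_connective d) `<=`
  nodeset d (single (inner d) +++ single (inner d) +++ all_forests d).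
Proof.
move=> t [/childP[[l ->]//|[us [-> s2 fus]]]] /=.
rewrite dual_connectiveK in fus *; move=> none.
have nl u : u \in us -> inner d u.
  move=> uus; split; first by move/allP : fus; apply.
  apply/negP => lu; have [a [b usE]] := mem_split uus.
  move: none; rewrite usE pmap_cat; case: u lu {uus usE} => //= l _.
  by case: (pmap _ a).
clear none; exists us => //; case: us s2 fus nl => [|t1 [|t2 us]] //= _ /and3P[_ _ fus] nl.
apply: single_cons; first by apply: nl; rewrite mem_head.
by apply: single_cons => //; apply: nl; rewrite !inE eqxx orbT.
Qed.

(** Since [y] is the first leaf, the prefix before it has inner children only and weighs [O(1)],
    against [O(q^-1)] for an arbitrary forest. This saved power of [q] is what makes [ubs_partial]
    better than [ubs_inner]. *)
Lemma inner_repr_sub d y : inner_repr (dual_connective d) y `<=`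
  nodeset d (forests_over (inner d) +++ single (leaf_set y) +++ all_forests d).
Proof.
move=> t [/childP[[l ->]//|[us [-> s2 fus]]]] _ /=.
rewrite dual_connectiveK in fus * => /ohead_pmap_leaf[a [b [usE na]]].
exists us => //; move: fus; rewrite usE forest_cat => /andP[fa].
rewrite -[forest _ _]/(child d (Leaf y) && forest d b) => /andP[_ fb].
apply: catset_cat; last exact: single_cons.
move=> u ua; split; first by move/allP : fa; apply.
by move/hasPn : na; apply.
Qed.

Lemma repr_some_sub d y : repr_some d y `<=` leaf_set y `|` inner_repr d y.
Proof.
by move=> [l|c us] [ct ty]; [left; case: ty => ->|right].
Qed.

Lemma computing_usable d ts x : forest d ts -> node_fun d ts = literal_fun x ->
  forests_over (usable d x) ts.
Proof.
move=> /allP fts /node_fun_active h t tts; split; first exact: fts.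
case: t tts => [l tts|]; [right; congr Leaf|by left].
by apply: (@active_leaf_sub d) => v vl; rewrite -h; apply/hasP; exists (Leaf l).
Qed.

Lemma inner_computing_sub d x : inner_computing d x `<=`
  nodeset (dual_connective d) (single (usable (dual_connective d) x) +++
    single (usable (dual_connective d) x) +++
    forests_over (usable (dual_connective d) x)).
Proof.
move=> t [/childP[[l ->]//|[us [-> s2 fus]]]] _ /= tx.
exists us => //; have := computing_usable fus tx.
case: us s2 {fus tx} => [|t1 [|t2 us]] //= _.
by move=> /forests_over_cons[? /forests_over_cons[? ?]]; do 2!apply: single_cons => //.
Qed.

Lemma partial_sub d x (e := dual_connective d) (A := all_forests e) : partial d x `<=`
  nodeset e ((A +++ single (repr_none e) +++ A) `|` (A +++ single (repr_some e x) +++ A) `|`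
    [set us | exists y,
      (A +++ single (inner_repr e y) +++ A +++ single (repr_some e (neg_lit y)) +++ A) us \/
      (A +++ single (repr_some e y) +++ A +++ single (inner_repr e (neg_lit y)) +++ A) us]).
Proof.
move=> t /partialP[us [-> fus h]]; exists us => //.
have splitf a u b : us = a ++ u :: b -> [/\ A a, child e u & A b].
  by move=> usE; move: fus; rewrite usE forest_cat => /andP[? ub]; have /andP[] := ub.
case: h => [[u uus ru]|[u uus ru]|[y [u [u' [uus u'us ru ru' nl]]]]].
- have [a [b usE]] := mem_split uus; have [Aa cu Ab] := splitf _ _ _ usE.
  by left; left; rewrite usE; apply: catset_cat => //; apply: single_cons.
- have [a [b usE]] := mem_split uus; have [Aa cu Ab] := splitf _ _ _ usE.
  by left; right; rewrite usE; apply: catset_cat => //; apply: single_cons.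
right; wlog [a [b [c usE]]] : y u u' uus u'us ru ru' nl /
    exists a b c, us = a ++ u :: b ++ u' :: c.
  move=> wl; have [a [b usE]] := mem_split uus.
  have := u'us; rewrite {1}usE mem_cat inE => /or3P[u'ab|/eqP u'u|u'ab].
  - have [a1 [a2 aE]] := mem_split u'ab.
    apply: (wl (neg_lit y) u' u); rewrite ?neg_litK 1?orbC//.
    by exists a1, a2, b; rewrite usE aE -catA.
  - by move: ru'; rewrite u'u ru => -[]; case: (y) => i [].
  - have [b1 [b2 bE]] := mem_split u'ab.
    by apply: (wl y u u') => //; exists a, b1, b2; rewrite usE bE.
have [Aa cu Ab'] := splitf _ _ _ usE.
move: (Ab'); rewrite /A /all_forests /= forest_cat => /andP[Ab u'c]; have /andP[cu' Ac] := u'c.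
exists y; rewrite usE; have [nu|lu] := boolP (is_leaf u); [right|left].
  rewrite nu /= in nl; apply: catset_cat => //; apply: single_cons => //.
  by apply: catset_cat => //; apply: single_cons.
apply: catset_cat => //; apply: single_cons => //.
by apply: catset_cat => //; apply: single_cons.
Qed.

Definition simple_pair d x ts := exists s, [/\ ~~ is_leaf s,
  fun_of_tree s = const_fun n (neutral d) & ts = [:: Leaf x; s] \/ ts = [:: s; Leaf x]].

Definition nonsimple d x : set (seq (tree n)) := [set ts | [/\ forest d ts,
  (1 < seq.size ts)%N, node_fun d ts = literal_fun x & ~ simple_pair d x ts]].

Lemma inactive_const d t : (forall v, ~~ active d v t) ->
  fun_of_tree t = const_fun n (neutral d).
Proof.
move=> h; apply/ffunP => v; rewrite !ffunE; have := h v.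
by rewrite /active; case: (Defs.eval v t); case: (neutral d).
Qed.

(** If [Leaf x] occurs, either it has two further children on one side or one on each side, or the
    forest is a pair, whose other member is [Leaf x] or partial since the pair is not simple. If it
    does not occur, some child is active for some assignment, hence partial; either a second one is,
    or this one alone carries the value and computes [x], next to at least one more child. *)
Lemma nonsimple_sub d x (U := single (usable d x)) (F := forests_over (usable d x))
    (L := single (leaf_set x)) (P := single (partial d x))
    (X := single (inner_computing d x)) : nonsimple d x `<=`
  (L +++ P) `|` (P +++ L) `|` (L +++ L) `|` (U +++ U +++ F +++ L +++ F) `|`
  (F +++ L +++ U +++ U +++ F) `|` (U +++ L +++ U) `|` (F +++ P +++ F +++ P +++ F) `|`
  (U +++ F +++ X +++ F) `|` (F +++ X +++ U +++ F).
Proof.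
move=> ts [fts s2 tsx nsimple]; have Fts := computing_usable fts tsx.
have act := (node_fun_active d ts x).1 tsx.
have part t : t \in ts -> ~~ is_leaf t -> (exists v, active d v t) -> partial d x t.
  move=> tts lt tv; split=> //; first by move/allP : fts; apply.
  by move=> v vt; rewrite -act; apply/hasP; exists t.
have constN t : t \in ts -> ~~ is_leaf t -> ~ partial d x t -> forall v, ~~ active d v t.
  by move=> tts lt np v; apply/negP => vt; apply: np; apply: part => //; exists v.
have [xts|xts] := boolP (Leaf x \in ts).
  have [l1 [l2 tsE]] := mem_split xts.
  have [F1 /forests_over_cons[Ux F2]] : F l1 /\ F (Leaf x :: l2).
    by apply: forests_over_cat; rewrite -tsE.
  have pair t : t \in ts -> usable d x t ->
      ts = [:: Leaf x; t] \/ ts = [:: t; Leaf x] -> t = Leaf x \/ partial d x t.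
    move=> tts [_ [nl|->]] tsE'; [right|by left].
    apply: contrapT => np; apply: nsimple; exists t; split=> //.
    exact/inactive_const/constN.
  have [s1|] := leqP 2 (seq.size l1).
    case: l1 s1 F1 tsE => [|t1 [|t2 l1]] // _.
    move=> /forests_over_cons[U1 /forests_over_cons[U2 F1]] ->.
    do 5!left; right; do 2!apply: single_cons => //.
    by apply: catset_cat => //; apply: single_cons.
  have [s1 _|] := leqP 2 (seq.size l2).
    case: l2 s1 F2 tsE => [|t1 [|t2 l2]] // _.
    move=> /forests_over_cons[U1 /forests_over_cons[U2 F2]] ->.
    do 4!left; right; apply: catset_cat => //.
    by do 3!apply: single_cons => //.
  case: l2 F2 tsE => [|t2 []] // F2; case: l1 F1 => [|t1 []] // F1 tsE _ _.
  - by rewrite tsE in s2.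
  - have [U1 _] := forests_over_cons F1.
    have [|||tx|P1] := pair t1; rewrite ?tsE ?mem_head//; first by right.
      by do 6!left; right; rewrite tx; apply: single_cons => //; exact: single_one.
    by do 7!left; right; apply: single_cons => //; exact: single_one.
  - have [U2 _] := forests_over_cons F2.
    have [|||tx|P2] := pair t2; rewrite ?tsE ?inE ?eqxx ?orbT//; first by left.
      by do 6!left; right; rewrite tx; apply: single_cons => //; exact: single_one.
    by do 8!left; apply: single_cons => //; exact: single_one.
  - have [U1 _] := forests_over_cons F1; have [U2 _] := forests_over_cons F2.
    by rewrite tsE; do 3!left; right; do 2!apply: single_cons => //; exact: single_one.
have inn t : t \in ts -> ~~ is_leaf t.
  move=> tts; have [_ [//|tx]] := Fts t tts.
  by move: xts; rewrite -tx tts.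
have [v0 v0x] : exists v, active d v (Leaf x).
  have [||v [vx _]] := @separating_assignment d [:: x] (neg_lit x).
  - by move=> y; rewrite !inE => /eqP ->; case: (x) => i []; apply/negP => /eqP[].
  - by rewrite inE; case: (x) => i []; apply/negP => /eqP[].
  - by exists v; apply: vx; rewrite inE.
have /hasP[t tts v0t] : has (active d v0) ts by rewrite act.
have Pt : partial d x t by apply: part => //; [exact: inn|exists v0].
have [a [b tsE]] := mem_split tts.
have [Fa /forests_over_cons[Ut Fb]] : F a /\ F (t :: b).
  by apply: forests_over_cat; rewrite -tsE.
have [[u [uab Pu]]|single_partial] :=
  pselect (exists u, u \in a ++ b /\ partial d x u).
  do 2!left; right; move: uab; rewrite mem_cat => /orP[] /mem_split[b1 [b2 bE]].
    have [F1 /forests_over_cons[_ F2]] : F b1 /\ F (u :: b2).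
      by apply: forests_over_cat; rewrite -bE.
    rewrite tsE bE -catA; apply: catset_cat => //; apply: single_cons => //.
    by apply: catset_cat => //; apply: single_cons.
  have [F1 /forests_over_cons[_ F2]] : F b1 /\ F (u :: b2).
    by apply: forests_over_cat; rewrite -bE.
  rewrite tsE bE; apply: catset_cat => //; apply: single_cons => //.
  by apply: catset_cat => //; apply: single_cons.
have Xt : inner_computing d x t.
  split; [by case: Pt|exact: inn|].
  rewrite -(node_fun1 d); apply/node_fun_active => v; rewrite /= orbF -act.
  apply/idP/hasP => [vt|[u uts vu]]; first by exists t.
  have [->//|ut] := eqVneq t u; exfalso.
  move: (uts); rewrite tsE mem_cat inE eq_sym (negbTE ut) /= -mem_cat => uab.
  by apply: single_partial; exists u; split=> //; apply: part => //; [exact: inn|exists v].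
case: a Fa tsE {single_partial} => [|a1 a] Fa tsE.
  case: b Fb tsE => [|b1 b] Fb tsE; first by rewrite tsE in s2.
  have [U1 F1] := forests_over_cons Fb; right; rewrite tsE.
  by apply: (@catset_cat _ _ [::]) => //; do 2!apply: single_cons => //.
have [U1 F1] := forests_over_cons Fa; left; right; rewrite tsE.
by apply: single_cons => //; apply: catset_cat => //; apply: single_cons.
Qed.

End Semantics.

(** * Asymptotic bounds *)

Section Bounds.
Variables (R : realType) (n : nat).
Hypothesis n0 : (0 < n)%N.

Let N : R := (2 * n)%:R.
Let V := forest_count R n.
Let rho := radius N.
Let s := Num.sqrt N.
Let v := 1 + s.
Let q := s^-1.

Let N2 : 2 <= N := literals_ge2 R n0.
Let V0 : V 0%N = 1 := forest_count0 R n.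
Let Vrec : forall m, V m.+1 = cauchy_prod V V m + (N - 2) * V m + delta0 R m :=
  forest_count_rec R n.
Let rho_gt0 : 0 < rho := radius_gt0 N2.
Let s_gt0 : 0 < s. Proof. by rewrite sqrtr_gt0 (lt_le_trans _ N2). Qed.
Let s_ge1 : 1 <= s.
Proof. by rewrite -sqrtr1 ler_wsqrtr// (le_trans _ N2)// ler1n. Qed.
Let s_sq : s ^+ 2 = N.
Proof. by rewrite sqr_sqrtr// (le_trans _ N2). Qed.
Let q_gt0 : 0 < q. Proof. by rewrite invr_gt0. Qed.
Let q_neq0 : q != 0. Proof. by rewrite gt_eqF. Qed.
Let q_le1 : q <= 1. Proof. by rewrite invf_le1. Qed.
Let qX_ge0 i : 0 <= q ^+ i. Proof. by rewrite exprn_ge0// ltW. Qed.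
Let qXS i : q ^+ i.+1 <= q ^+ i.
Proof. by rewrite exprS ler_piMl. Qed.
Let rho_le : rho <= q ^+ 2.
Proof.
rewrite /rho radiusE// -/s /q exprVn lef_pV2 ?posrE ?exprn_gt0 ?mulr_gt0 ?addr_gt0//.
by rewrite expr2 ler_wpM2l ?lerDl// ltW.
Qed.

Local Notation "A +++ B" := (catset A B) (at level 42, right associativity).

(* The bounds are multiples of powers of [q]; the constants are not optimised. *)
Definition ubs (A : set (seq (tree n))) (w mu : R) := ub N V (cnt R A) w mu.

Lemma ubs_le A w mu w' mu' : ubs A w mu -> w <= w' -> mu <= mu' -> ubs A w' mu'.
Proof. exact: ubW. Qed.

Lemma ubs_eq A w mu w' mu' : ubs A w mu -> w = w' -> mu = mu' -> ubs A w' mu'.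
Proof. by move=> h <- <-. Qed.

Lemma ubs_sub A B w mu : A `<=` B -> ubs B w mu -> ubs A w mu.
Proof.
by move=> AB h; apply: ub_le h _ _ _ => // m; rewrite cnt_ge0 cnt_sub.
Qed.

Lemma ubsU A B wA wB mA mB : ubs A wA mA -> ubs B wB mB ->
  ubs (A `|` B) (wA + wB) (mA + mB).
Proof.
move=> hA hB; apply: ub_le (ubD hA hB) _ _ _ => // m.
by rewrite cnt_ge0 cnt_subU.
Qed.

Lemma ubs_cat A B wA wB mA mB : ubs A wA mA -> ubs B wB mB ->
  ubs (catset A B) (wA * wB) (wA * mB + wB * mA).
Proof.
move=> hA hB; apply: ub_le (ub_cauchy N2 V0 Vrec hA hB) _ _ _ => // m.
by rewrite cnt_ge0 cnt_cat_le.
Qed.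

Lemma ubs_node c A w mu : ubs A w mu ->
  ubs (single (nodeset c A)) (q ^+ 2 * w) (q ^+ 2 * mu).
Proof.
move=> hA; have [w0 mu0] := ub_ge0 N2 V0 Vrec hA.
apply: ub_le (ub_sh N2 V0 Vrec hA) _ _ _; last 2 first.
- by rewrite ler_wpM2r.
- by rewrite ler_wpM2r.
by move=> m; rewrite cnt_ge0 cnt_nodeset lexx.
Qed.

Lemma ubs_exists (I : finType) (A : I -> set (seq (tree n))) w mu :
  (forall i, ubs (A i) w mu) ->
  ubs [set ts | exists i, A i ts] (#|I|%:R * w) (#|I|%:R * mu).
Proof.
move=> h; have := ub_sum (index_enum I) h.
rewrite -[index_enum I]enumT -cardT => hs.
apply: ub_le hs _ _ _ => // m; rewrite cnt_ge0 /= -natr_sum ler_nat.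
apply: (@leq_trans (seq.size (flatten [seq level (A i) m | i <- enum I]))); last first.
  by rewrite size_flatten sumnE /shape !big_map.
apply: uniq_leq_size (level_uniq _ _) _ => ts.
rewrite mem_level => /andP[/asboolP[i Ai] tm]; apply/flatten_mapP; exists i.
  by rewrite mem_enum.
by rewrite mem_level tm andbT; exact/asboolP.
Qed.

Lemma ubs_nil : ubs [set [::]] 1 0.
Proof.
apply: ub_le (good_ub (good_delta0 N V)) _ _ _ => // m.
by rewrite cnt_ge0 cnt_nil lexx.
Qed.

(** In the bounds that follow, the second component is of order [q] times the first, or smaller.
    Products and nodes preserve this relation, so the exponent of [q] in the first component tells
    the strength of a bound. *)
Lemma ubs_all d : ubs (all_forests d) (2 * q^-1) 1.
Proof.
apply: ub_le (good_ub (good_growth N2 V0 Vrec)) _ _ _ => //.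
  by move=> m; rewrite cnt_ge0 cnt_all_forests lexx.
by rewrite -/s /q invrK; have := s_ge1; lra.
Qed.

Lemma ubs_leaf l : ubs (single (leaf_set l)) (q ^+ 2) 0.
Proof.
have h : ubs (single (leaf_set l)) (rho * 1) (rho * 0).
  apply: ub_le (good_ub (good_sh N2 V0 Vrec (good_delta0 N V))) _ _ _ => // m.
  rewrite cnt_ge0 /= (@eq_cnt _ R _ (single [set t | exists2 k, pred1 l k & t = Leaf k])).
    by rewrite cnt_leaf card1 mul1r lexx.
  move=> ts; split=> [[t -> ->]|[t [k /= /eqP -> ->] ->]]; last by exists (Leaf l).
  by exists (Leaf l) => //; exists l => //=; rewrite eqxx.
by apply: ubs_le h _ _; rewrite ?mulr1 ?mulr0.
Qed.

Lemma cnt_inner d m : cnt R (single (@inner n d)) m + N * sh (delta0 R) m = child_count R n m.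
Proof.
rewrite -(@cnt_all_children R n d).
rewrite [RHS](cnt_split R (fun ts => if ts is t :: _ then ~~ is_leaf t else false)).
congr (_ + _).
  apply: eq_cnt => ts; split=> [[t [ct nl] ->]|[[t ct ->] /= nl]].
    by split=> //; exists t.
  by exists t.
have -> : N = #|[pred l : literal n | true]|%:R.
  by congr (_%:R); rewrite card_prod card_ord card_bool mulnC.
rewrite -cnt_leaf; apply: eq_cnt => ts; split.
  by move=> [t [l _ ->] ->]; split=> //; exists (Leaf l).
by move=> [[[l|c us] ct ->]] //= _; exists (Leaf l) => //; exists l.
Qed.

(** Almost all the weight of the children comes from the leaves: [s / (1 + s)] less
    [N * rho = s / (s + 2)] is only of order [q]. *)
Lemma ubs_inner d : ubs (single (@inner n d)) q (q ^+ 2).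
Proof.
have gN := goodZ (ltW (lt_le_trans (ltr0n R 2) N2)) (good_sh N2 V0 Vrec (good_delta0 N V)).
have gc := good_children N2 V0 Vrec (@child_count_ge0 R n) (child_countE R n).
have gi := good_sub gc gN (fun m => cnt_ge0 R (single (@inner n d)) m)
  (cnt_inner d).
apply: ubW (good_ub gi) _ _.
  rewrite mulr1 -/rho -/s -s_sq /rho radiusE// -/s /q.
  have -> : s / (1 + s) - s ^+ 2 * (s * (s + 2))^-1 = s / ((s + 1) * (s + 2)).
    by field; rewrite !gt_eqF// ?addr_gt0.
  rewrite ler_pdivrMr ?mulr_gt0 ?addr_gt0// ler_pdivlMl//.
  by have := s_ge1; nra.
rewrite !mulr0 subr0 -/s /q exprVn lef_pV2 ?posrE ?exprn_gt0 ?addr_gt0//.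
by rewrite lerXn2r ?nnegrE ?addr_ge0 ?(ltW s_gt0)// lerDr.
Qed.

Lemma ubs_usable d x : ubs (single (usable d x)) (2 * q) (q ^+ 2).
Proof.
apply: ubs_le (ubs_sub _ (ubsU (ubs_inner d) (ubs_leaf x))) _ _.
- by move=> ts [t [ct [nl|tx]] ->]; [left|right]; exists t.
- by have := qXS 1; rewrite expr1; lra.
- by rewrite addr0.
Qed.

(** Restricting the first child already brings the weight of forests from order [q^-1] down to a
    constant: 1 for the empty forest and [2 * q] times [2 * q^-1] for the others. *)
Lemma ubs_forests_over d T : (forall t, T t -> child d t) ->
  ubs (single T) (2 * q) (q ^+ 2) -> ubs (forests_over T) 5 (4 * q).
Proof.
move=> Td hT; apply: ubs_eq (ubs_sub (forests_over_sub Td)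
  (ubsU ubs_nil (ubs_cat hT (ubs_all d)))) _ _; by field.
Qed.

Let ubsF d x : ubs (forests_over (usable d x)) 5 (4 * q).
Proof. by apply: (@ubs_forests_over d); [move=> t []|exact: ubs_usable]. Qed.

Let ubsFB d : ubs (forests_over (@inner n d)) 5 (4 * q).
Proof.
apply: (@ubs_forests_over d); first by move=> t [].
by apply: ubs_le (ubs_inner d) _ _ => //; have := q_gt0; lra.
Qed.

Lemma single_sub (T T' : set (tree n)) : T `<=` T' -> single T `<=` single T'.
Proof. by move=> TT ts [t /TT Tt ->]; exists t. Qed.

Lemma ubs_inner_computing d x :
  ubs (single (inner_computing d x)) (20 * q ^+ 4) (36 * q ^+ 5).
Proof.
set e := dual_connective d.
have h := ubs_node e (ubs_cat (ubs_usable e x) (ubs_cat (ubs_usable e x) (ubsF e x))).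
by apply: ubs_eq (ubs_sub (single_sub (@inner_computing_sub _ d x)) h) _ _; ring.
Qed.

Let ubs_repr_none d : ubs (single (@repr_none n d)) (2 * q ^+ 3) (5 * q ^+ 4).
Proof.
rewrite -[d]dual_connectiveK; set e := dual_connective d.
have h := ubs_node e (ubs_cat (ubs_inner e) (ubs_cat (ubs_inner e) (ubs_all e))).
by apply: ubs_eq (ubs_sub (single_sub (@repr_none_sub _ e)) h) _ _; field.
Qed.

Let ubs_inner_repr d y : ubs (single (inner_repr d y)) (10 * q ^+ 3) (13 * q ^+ 4).
Proof.
rewrite -[d]dual_connectiveK; set e := dual_connective d.
have h := ubs_node e (ubs_cat (ubsFB e) (ubs_cat (ubs_leaf y) (ubs_all e))).
by apply: ubs_eq (ubs_sub (single_sub (@inner_repr_sub _ e y)) h) _ _; field.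
Qed.

Let ubs_repr_some d y : ubs (single (repr_some d y)) (11 * q ^+ 2) (13 * q ^+ 4).
Proof.
apply: ubs_le (ubs_sub _ (ubsU (ubs_leaf y) (ubs_inner_repr d y))) _ _.
- by move=> ts [t /repr_some_sub[h|h] ->]; [left|right]; exists t.
- by have := qXS 2; lra.
- by rewrite add0r.
Qed.

Lemma ubs_partial d x : ubs (single (partial d x)) (1812 * q ^+ 2) (7132 * q ^+ 3).
Proof.
set e := dual_connective d; have A := ubs_all e.
pose F : set (seq (tree n)) := all_forests e.
pose D y : set (seq (tree n)) := single (inner_repr e y).
pose B y : set (seq (tree n)) := single (repr_some e y).
have h1 : ubs (F +++ single (repr_none e) +++ F) (8 * q) (28 * q ^+ 2).
  by apply: ubs_eq (ubs_cat A (ubs_cat (ubs_repr_none e) A)) _ _; field.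
have bA y : ubs (B y +++ F) (22 * q) (37 * q ^+ 2).
  apply: ubs_le (ubs_cat (ubs_repr_some e y) A) _ _.
    by rewrite le_eqVlt; apply/orP; left; apply/eqP; field.
  rewrite (_ : _ + _ = 11 * q ^+ 2 + 26 * q ^+ 3); last by field.
  by have := qXS 2; lra.
have AbA y : ubs (F +++ B y +++ F) 44 (96 * q).
  by apply: ubs_eq (ubs_cat A (bA y)) _ _; field.
have h2 := AbA x.
have h3a y : ubs (F +++ D y +++ F +++ B (neg_lit y) +++ F) (880 * q ^+ 2) (3504 * q ^+ 3).
  by apply: ubs_eq (ubs_cat A (ubs_cat (ubs_inner_repr e y) (AbA (neg_lit y)))) _ _; field.
have h3b y : ubs (F +++ B y +++ F +++ D (neg_lit y) +++ F) (880 * q ^+ 2) (3504 * q ^+ 3).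
  have DA : ubs (F +++ D (neg_lit y) +++ F) (40 * q) (92 * q ^+ 2).
    apply: ubs_eq (ubs_cat A (ubs_cat (ubs_inner_repr e (neg_lit y)) A)) _ _; by field.
  have bDA : ubs (B y +++ F +++ D (neg_lit y) +++ F) (440 * q ^+ 3) (1532 * q ^+ 4).
    apply: ubs_le (ubs_cat (ubs_repr_some e y) DA) _ _.
      by rewrite le_eqVlt; apply/orP; left; apply/eqP; field.
    rewrite (_ : _ + _ = 1012 * q ^+ 4 + 520 * q ^+ 5); last by field.
    by have := qXS 4; lra.
  by apply: ubs_eq (ubs_cat A bDA) _ _; field.
(* Choosing [y] costs the factor [N = q ^- 2]; since one of the two opposite representatives belongs
   to an inner child, of order [q ^+ 3] instead of [q ^+ 2], the sum stays bounded. *)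
have h3 := ubs_exists (fun y => ubsU (h3a y) (h3b y)).
have h := ubs_node e (ubsU (ubsU h1 h2) h3).
apply: ubs_le (ubs_sub (single_sub _) h) _ _.
- exact: partial_sub.
- have -> : #|{: literal n}|%:R = q ^- 2.
    by rewrite card_prod card_ord card_bool mulnC /q exprVn invrK s_sq.
  rewrite (_ : _ * _ = 1804 * q ^+ 2 + 8 * q ^+ 3); last by field.
  by have := qXS 2; lra.
- have -> : #|{: literal n}|%:R = q ^- 2.
    by rewrite card_prod card_ord card_bool mulnC /q exprVn invrK s_sq.
  rewrite (_ : _ * _ = 7104 * q ^+ 3 + 28 * q ^+ 4); last by field.
  by have := qXS 3; lra.
Qed.

(** Only the second component bounds a limiting ratio, so the first is left existential. *)
Lemma ubs_nonsimple d x : exists w,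
  ubs (nonsimple d x) w ((550 * 7132 ^+ 2 + 2 * 7132 + 8324) * q ^+ 5).
Proof.
have L := ubs_leaf x; have U := ubs_usable d x.
have F := ubsF d x; have X := ubs_inner_computing d x.
have P : ubs (single (partial d x)) (7132 * q ^+ 2) (7132 * q ^+ 3).
  by apply: ubs_le (ubs_partial d x) _ _ => //; rewrite ler_wpM2r// ler_nat.
(* Numerals are unary, so the constant is made abstract before computing. *)
move: (7132 : R) P => c P.
have LF : ubs (single (leaf_set x) +++ forests_over (usable d x)) (5 * q ^+ 2) (4 * q ^+ 3).
  by apply: ubs_eq (ubs_cat L F) _ _; ring.
have UF : ubs (single (usable d x) +++ forests_over (usable d x)) (10 * q) (13 * q ^+ 2).
  by apply: ubs_eq (ubs_cat U F) _ _; ring.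
have h := ubsU (ubsU (ubsU (ubsU (ubsU (ubsU (ubsU (ubsU (ubs_cat L P) (ubs_cat P L))
  (ubs_cat L L)) (ubs_cat U (ubs_cat U (ubs_cat F LF))))
  (ubs_cat F (ubs_cat L (ubs_cat U UF)))) (ubs_cat U (ubs_cat L U)))
  (ubs_cat F (ubs_cat P (ubs_cat F (ubs_cat P F))))) (ubs_cat U (ubs_cat F (ubs_cat X F))))
  (ubs_cat F (ubs_cat X UF)).
eexists; apply: ubs_le (ubs_sub (@nonsimple_sub _ d x) h) _ _; first exact: lexx.
rewrite [leLHS](_ : _ = (550 * c ^+ 2 + 2 * c + 524) * q ^+ 5 + 7800 * q ^+ 6); last first.
  by ring.
by have := qXS 5; lra.
Qed.

End Bounds.

(** * Contradictory leaves: a lower bound for the trees computing a constant *)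

Lemma bernoulli_sub (R : realDomainType) (x : R) k : 0 <= x <= 1 ->
  1 - k%:R * x <= (1 - x) ^+ k.
Proof.
move=> /andP[x0 x1]; elim: k => [|k IH]; first by rewrite mul0r subr0 expr0.
have x1' : 0 <= 1 - x by rewrite subr_ge0.
rewrite exprS; apply: le_trans (ler_wpM2l x1' IH).
have : 0 <= k%:R * x * x by rewrite !mulr_ge0.
by rewrite -natr1; lra.
Qed.

(** Bounds [(1 - x) ^+ k] away from 1 once [k x] is bounded below, whereas [bernoulli_sub] keeps it
    away from 0. *)
Lemma bernoulli_mul (R : realDomainType) (x : R) k : 0 <= x <= 1 ->
  (1 - x) ^+ k * (1 + k%:R * x) <= 1.
Proof.
move=> /andP[x0 x1]; elim: k => [|k IH]; first by rewrite mul0r addr0 expr0 mul1r.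
apply: le_trans IH; rewrite exprSr -mulrA ler_wpM2l ?exprn_ge0 ?subr_ge0//.
have : 0 <= k%:R * x * x by rewrite !mulr_ge0.
have : 0 <= x * x by rewrite mulr_ge0.
by rewrite -natr1; lra.
Qed.

Lemma expn_le_ffact a b k : (k <= b)%N -> ((a - b) ^ k <= a ^_ k)%N.
Proof.
elim: k => [//|k IH] kb; rewrite ffactnSr expnSr leq_mul ?IH ?leq_sub2l//; exact: ltnW.
Qed.

Section Contradictions.
Variables (R : realType) (n : nat).
Hypothesis n0 : (0 < n)%N.

Let N : R := (2 * n)%:R.
Let V := forest_count R n.
Let rho := radius N.
Let s := Num.sqrt N.
Let N2 : 2 <= N := literals_ge2 R n0.
Let V0 : V 0%N = 1 := forest_count0 R n.
Let Vrec : forall m, V m.+1 = cauchy_prod V V m + (N - 2) * V m + delta0 R m :=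
  forest_count_rec R n.
Let V_gt0 := growth_gt0 N2 V0 Vrec.
Let rho_gt0 : 0 < rho := radius_gt0 N2.
Let s_gt0 : 0 < s. Proof. by rewrite sqrtr_gt0 (lt_le_trans _ N2). Qed.
Let s_sq : s ^+ 2 = N. Proof. by rewrite sqr_sqrtr// (le_trans _ N2). Qed.

Let lits := literal n.

(** Both halves have the prescribed length [k], so that in a longer forest the cut after these
    leaves is unique. *)
Definition conflicting_leaves k : set (seq (tree n)) :=
  [set us | exists p r : seq lits, [/\ us = map (@Leaf n) (p ++ r), seq.size p = k,
    seq.size r = k & has (fun y => neg_lit y \in p) r]].

Lemma fsize_leaves (p : seq lits) : fsize (map (@Leaf n) p) = seq.size p.
Proof. by elim: p => //= l p; rewrite /fsize /= => ->. Qed.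

Lemma card_avoiding (p : seq lits) k : uniq p ->
  (#|[pred r : {ffun 'I_k -> lits} | has (fun y => neg_lit y \in p) (codom r)]|
   + (2 * n - seq.size p) ^ k)%N = ((2 * n) ^ k)%N.
Proof.
move=> up; pose A : pred lits := [pred y | neg_lit y \notin p].
have cA : #|A| = (2 * n - seq.size p)%N.
  have := cardC A; rewrite card_prod card_ord card_bool mulnC => <-.
  rewrite (@eq_card _ (predC A) (mem (map (@neg_lit n) p))) => [|y].
    have /card_uniqP -> : uniq (map (@neg_lit n) p).
      by rewrite map_inj_uniq//; exact: can_inj (@neg_litK n).
    by rewrite size_map addnK.
  rewrite !inE negbK; apply/idP/mapP => [yp|[z zp ->]]; last by rewrite neg_litK.
  by exists (neg_lit y) => //; rewrite neg_litK.
rewrite -cA -(card_ord k) -(card_ffun_on _ A) card_ord.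
rewrite (_ : ((2 * n) ^ k)%N = #|{: {ffun 'I_k -> lits}}|); last first.
  by rewrite card_ffun card_prod card_ord card_bool card_ord mulnC.
rewrite -(cardC [pred r : {ffun 'I_k -> lits} | has (fun y => neg_lit y \in p) (codom r)]).
congr (_ + _)%N; apply: eq_card => r; rewrite !inE -all_predC.
apply/ffun_onP/allP => [h y /codomP[i ->]|h i]; first exact: h.
by apply: h; exact: codom_f.
Qed.

(** Only the [p] without repetition are counted: then exactly [2 * n - k] literals avoid the
    negations of [p], so the number of suitable [r] is the same for all of them. *)
Lemma cnt_conflicting_leaves k :
  ((2 * n) ^_ k * ((2 * n) ^ k - (2 * n - k) ^ k))%:R <=
  cnt R (conflicting_leaves k) (k + k).
Proof.
pose P := [seq val p | p <- enum [pred p : k.-tuple lits | uniq p]].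
pose Rs (p : seq lits) := map (fun r : {ffun 'I_k -> lits} => codom r)
  (enum [pred r : {ffun 'I_k -> lits} | has (fun y => neg_lit y \in p) (codom r)]).
pose S := [seq map (@Leaf n) (p ++ r) | p <- P, r <- Rs p].
have PP p : p \in P -> uniq p /\ seq.size p = k.
  by move=> /mapP[t]; rewrite mem_enum inE => ut ->; rewrite ut size_tuple.
have sP : seq.size P = ((2 * n) ^_ k)%N.
  rewrite size_map -cardE -[RHS](congr1 (fun z => z ^_ k)%N (_ : #|{: lits}| = _)); last first.
    by rewrite card_prod card_ord card_bool mulnC.
  rewrite -(@card_uniq_tuples _ k predT); apply: eq_card => t; rewrite !inE.
  by rewrite all_predT.
have sS : seq.size S = ((2 * n) ^_ k * ((2 * n) ^ k - (2 * n - k) ^ k))%N.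
  rewrite size_allpairs_dep -sP sumnE big_map big_seq.
  rewrite (eq_bigr (fun=> (2 * n) ^ k - (2 * n - k) ^ k)%N) => [|p /PP[up kp]].
    by rewrite -big_seq big_const_seq count_predT iter_addn_0 mulnC.
  by rewrite size_map -cardE -(card_avoiding k up) kp addnK.
rewrite -sS ler_nat; apply: uniq_leq_size => [|us /allpairsPdep[p [r [pP rR ->]]]].
  apply: allpairs_uniq_dep.
  - by rewrite map_inj_uniq ?enum_uniq//; exact: val_inj.
  - move=> p _; rewrite map_inj_uniq ?enum_uniq// => r r'.
    by rewrite !codom_ffun => /val_inj/(can_inj fgraphK).
  move=> _ _ /allpairsPdep[p [r [+ _ ->]]] /allpairsPdep[p' [r' [+ _ ->]]] /=.
  have Linj : injective (@Leaf n) by move=> a b [].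
  move=> /PP[_ pk] /PP[_ p'k] /(inj_map Linj)/eqP.
  by rewrite eqseq_cat ?pk ?p'k// => /andP[/eqP -> /eqP ->].
have [_ pk] := PP p pP; move: rR => /mapP[f]; rewrite mem_enum inE => fp rE.
have rk : seq.size r = k by rewrite rE size_codom card_ord.
rewrite mem_level fsize_leaves size_cat pk rk eqxx andbT.
by apply/asboolP; exists p, r; rewrite rE; split=> //; rewrite -rE.
Qed.

Lemma conflicting_leaves_const d k (e := dual_connective d) : (0 < k)%N ->
  single (nodeset e (catset (conflicting_leaves k) (all_forests e))) `<=`
  children_with (@fun_of_tree n) d (const_fun n (neutral d)).
Proof.
move=> k0 ts [t [us [_ [l [[p [r [-> pk rk /hasP[y yr yp]]]] fl ->]]] ->] ->].
exists (Node e (map (@Leaf n) (p ++ r) ++ l)) => //; split.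
  apply/childP; right; exists (map (@Leaf n) (p ++ r) ++ l); split=> //.
    by rewrite size_cat size_map size_cat pk rk; lia.
  rewrite forest_cat [forest _ l]fl andbT; apply/allP => u /mapP[z _ ->].
  by [].
apply: inactive_const => v; rewrite active_dual all_cat negb_and; apply/orP; left.
apply/allPn; have [vy|vy] := boolP (active d v (Leaf y)).
  exists (Leaf (neg_lit y)); last by rewrite active_neg_lit vy.
  by apply: map_f; rewrite mem_cat yp.
exists (Leaf y) => //; by apply: map_f; rewrite mem_cat yr orbT.
Qed.

Lemma cnt_children_const_ge d k m : (0 < k)%N ->
  ((2 * n) ^_ k * ((2 * n) ^ k - (2 * n - k) ^ k))%:R * V m <=
  cnt R (children_with (@fun_of_tree n) d (const_fun n (neutral d))) (m + (k + k)).+1.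
Proof.
move=> k0; set e := dual_connective d.
have sub := @conflicting_leaves_const d k k0.
apply: le_trans (cnt_sub R _ sub).
rewrite cnt_nodeset /=; apply: le_trans (cnt_cat_ge R _ (fun _ h => h) _); last first.
  move=> a a' b b' [p [r [-> pk rk _]]] [p' [r' [-> pk' rk' _]]] _ _ /eqP.
  by rewrite eqseq_cat ?size_map ?size_cat ?pk ?rk ?pk' ?rk'// => /andP[/eqP].
have kk : (k + k < (m + (k + k)).+1)%N by lia.
rewrite /cauchy_prod (bigD1 (Ordinal kk))//= addnK cnt_all_forests.
apply: (@le_trans _ _ (cnt R (conflicting_leaves k) (k + k) * forest_count R n m)).
  by rewrite ler_wpM2r ?cnt_conflicting_leaves// ltW.
by rewrite lerDl; apply: sumr_ge0 => i _; rewrite mulr_ge0 ?cnt_ge0.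
Qed.

Lemma children_const_lim_ge d l : 16 <= s ->
  ratio V (cnt R (children_with (@fun_of_tree n) d (const_fun n (neutral d)))) @ \oo --> l ->
  rho / 1028 <= l.
Proof.
move=> s16 fl; set f := cnt R _ in fl.
(* For [k] of order [sqrt N], the [k] leaves of the second half avoid the
   negations of the [k] distinct literals of the first half with probability
   [(1 - k / N) ^+ k], which stays away from [0] and [1]. *)
pose k := Num.truncn (s / 8).
have /truncn_itv/andP[k_le k_ge] : 0 <= s / 8 by rewrite divr_ge0// ltW.
rewrite -/k in k_le k_ge.
have k16 : s / 16 <= k%:R by move: k_ge; rewrite -[k.+1%:R]natr1; lra.
have k0 : (0 < k)%N by rewrite -(ltr0n R) (lt_le_trans _ k16)// divr_gt0.
have kN : (k <= 2 * n)%N.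
  rewrite -(ler_nat R) -/N -s_sq expr2 (le_trans k_le)//.
  by have := ler_wpM2l (ltW s_gt0) s16; lra.
pose W := ((2 * n) ^_ k * ((2 * n) ^ k - (2 * n - k) ^ k))%N.
have Wl : W%:R * rho ^+ (k + k).+1 <= l.
  have c : (fun m => W%:R * (V (m - (k + k).+1)%N / V m)) @ \oo -->
      W%:R * rho ^+ (k + k).+1.
    by apply: cvgMr; exact: growth_shift_cvg.
  rewrite -(cvg_lim (@Rhausdorff R) fl) -(cvg_lim (@Rhausdorff R) c).
  apply: ler_lim; [by apply: cvgP c|by apply: cvgP fl|].
  near=> m; have mk : ((k + k).+1 <= m)%N by near: m; exact: nbhs_infty_ge.
  rewrite /ratio mulrA ler_pM2r ?invr_gt0//.
  have := cnt_children_const_ge d (m - (k + k).+1) k0.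
  by rewrite (_ : (_ + (k + k)).+1 = m)//; clear -mk; lia.
apply: le_trans Wl.
(* [b] is the probability that the second half avoids the negations of the first, and [A ^+ 2]
   compares the weight [rho ^+ (k + k)] with the number of pairs of halves. As [k / s] lies between
   [1 / 16] and [1 / 8], [k * x = (k / s) ^+ 2] lies between [1 / 256] and [1 / 64]; the final
   constant is [1028 = 2 * 2 * 257]. *)
pose x : R := k%:R / N; pose b := (1 - x) ^+ k; pose A := (rho * N) ^+ k.
have N_gt0 : 0 < N := lt_le_trans (ltr0n R 2) N2.
have x01 : 0 <= x <= 1.
  by rewrite /x divr_ge0 ?(ltW N_gt0)//= ler_pdivrMr// mul1r ler_nat.
have kxE : k%:R * x = (k%:R / s) ^+ 2 by rewrite /x -s_sq; field; rewrite gt_eqF.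
have ks0 : 0 <= k%:R / s by rewrite divr_ge0// ltW.
have ks1 : 1 / 16 <= k%:R / s by rewrite ler_pdivlMr//; lra.
have ks2 : k%:R / s <= 1 / 8 by rewrite ler_pdivrMr//; lra.
have kx1 : 1 / 256 <= k%:R * x.
  rewrite kxE (_ : 1 / 256 = (1 / 16) ^+ 2); last by field.
  by rewrite lerXn2r// nnegrE// divr_ge0.
have kx2 : k%:R * x <= 1 / 64.
  rewrite kxE (_ : 1 / 64 = (1 / 8) ^+ 2); last by field.
  by rewrite lerXn2r// nnegrE// divr_ge0.
have b_ge : 1 / 2 <= b by have := bernoulli_sub k x01; rewrite -/b; lra.
have b_le : 1 / 257 <= 1 - b.
  have := bernoulli_mul k x01; rewrite -/b => h.
  have b0 : 0 <= b by lra.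
  have := ler_wpM2l b0 kx1; lra.
have A_ge : 3 / 4 <= A.
  have s2 : 0 < s + 2 by rewrite addr_gt0.
  have -> : A = (1 - 2 / (s + 2)) ^+ k.
    rewrite /A /rho radiusE// -/s -s_sq; congr (_ ^+ _); field.
    by rewrite !gt_eqF.
  apply: le_trans (bernoulli_sub k _); last first.
    by rewrite divr_ge0 ?(ltW s2)//= ler_pdivrMr// mul1r; lra.
  have : k%:R * (2 / (s + 2)) <= 1 / 4.
    by rewrite mulrA ler_pdivrMr//; lra.
  lra.
have A2 : 1 / 2 <= A ^+ 2.
  have t0 : 0 <= 3 / 4 :> R by rewrite divr_ge0.
  have : (3 / 4) ^+ 2 <= A ^+ 2 by rewrite lerXn2r// nnegrE (le_trans t0 A_ge).
  by lra.
have main : 1 / 2 * (1 / 2 * (1 / 257)) <= A ^+ 2 * (b * (1 - b)).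
  have h2 : 0 <= 1 / 2 :> R by rewrite divr_ge0.
  have h257 : 0 <= 1 / 257 :> R by rewrite divr_ge0 ?ler01 ?ler0n.
  exact: ler_pM h2 (mulr_ge0 h2 h257) A2 (ler_pM h2 h257 b_ge b_le).
have Nk : (2 * n - k)%:R = N * (1 - x).
  by rewrite natrB// mulrBr mulr1 /x mulrC divfK// gt_eqF.
have W_ge : (N * (1 - x)) ^+ k * (N ^+ k - (N * (1 - x)) ^+ k) <= W%:R.
  rewrite -Nk /N -!natrX -natrB ?leq_exp2r ?leq_subr// -natrM ler_nat.
  by rewrite leq_mul2r expn_le_ffact ?orbT.
apply: le_trans (ler_wpM2r _ W_ge); last by rewrite exprn_ge0// ltW.
rewrite [leRHS](_ : _ = rho * (A ^+ 2 * (b * (1 - b)))).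
  have -> : rho / 1028 = rho * (1 / 2 * (1 / 2 * (1 / 257))) by field.
  by rewrite ler_pM2l.
rewrite /A /b exprS exprD !exprMn; ring.
Unshelve. all: by end_near.
Qed.

End Contradictions.

(** * Limiting ratios and their comparison *)

Section Limits.
Variables (R : realType) (n : nat).
Hypothesis n0 : (0 < n)%N.

Let N : R := (2 * n)%:R.
Let V := forest_count R n.
Let rho := radius N.
Let s := Num.sqrt N.
Let v := 1 + s.
Let q := s^-1.
Let N2 : 2 <= N := literals_ge2 R n0.
Let V0 : V 0%N = 1 := forest_count0 R n.
Let Vrec : forall m, V m.+1 = cauchy_prod V V m + (N - 2) * V m + delta0 R m :=
  forest_count_rec R n.
Let V_gt0 := growth_gt0 N2 V0 Vrec.
Let V_neq0 m : V m != 0. Proof. by rewrite gt_eqF. Qed.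
Let rho_gt0 : 0 < rho := radius_gt0 N2.
Let s_gt0 : 0 < s. Proof. by rewrite sqrtr_gt0 (lt_le_trans _ N2). Qed.
Let v_gt0 : 0 < v. Proof. by rewrite addr_gt0. Qed.

Definition assoc_with (F : set (tree n)) : set (seq (tree n)) :=
  single [set t | Defs.associative t /\ F t].

(** A leaf may hang below both labels and would be counted twice; a larger tree may hang only below
    the label dual to that of its root. *)
Lemma cnt_assoc_with F m : (1 < m)%N -> cnt R (assoc_with F) m =
  cnt R (single [set t | child Conj t /\ F t]) m +
  cnt R (single [set t | child Disj t /\ F t]) m.
Proof.
move=> m1; rewrite (cnt_split R (fun ts => if ts is [:: Node Disj _] then true else false)).
congr (_ + _); apply: eq_cnt_at => ts tm; split.
- by move=> [[[l|[] us] [at_ Ft] ->]] //= _; exists (Node Disj us) => //; split=> //; apply/andP.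
- move=> [[l|c us] [ct Ft] tsE]; first by move: m1; rewrite -tm tsE.
  case/andP: ct => at_; case: c tsE at_ Ft => // -> at_ Ft _; split=> //.
  by exists (Node Disj us).
- move=> [[[l|[] us] [at_ Ft] ->]] //= _; first by exists (Leaf l).
  by exists (Node Conj us) => //; split=> //; apply/andP.
move=> [[l|c us] [ct Ft] tsE]; first by move: m1; rewrite -tm tsE.
case/andP: ct => at_; case: c tsE at_ Ft => // -> at_ Ft _; split=> //.
by exists (Node Conj us).
Qed.

Lemma cnt_associative m : (1 < m)%N ->
  cnt R (assoc_with [set: tree n]) m = 2 * child_count R n m.
Proof.
move=> m1; rewrite cnt_assoc_with// mulr_natl mulr2n.
by congr (_ + _); [rewrite -(@cnt_all_children R n Conj)|
  rewrite -(@cnt_all_children R n Disj)]; apply: eq_cnt => ts;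
  split=> [[t [ct _] ->]|[t ct ->]]; exists t.
Qed.

(** The trees are counted by [2 * child_count], whose ratio to [V] tends to [2 * v ^- 2]; the
    resulting factor [v ^+ 2 / 2] is the same for every family. *)
Lemma tree_ratio_cvg (F : set (tree n)) (l : R) : ratio V (cnt R (assoc_with F)) @ \oo --> l ->
  tree_ratio R F @ \oo --> l * v ^+ 2 / 2.
Proof.
move=> Fl.
have [_ _ cl] := good_children N2 V0 Vrec (@child_count_ge0 R n) (child_countE R n).
have vn0 : v ^- 2 != 0 by rewrite invr_neq0// expf_neq0// gt_eqF.
have : (fun m => ratio V (cnt R (assoc_with F)) m / (2 * ratio V (child_count R n) m)) @ \oo
    --> l / (2 * v ^- 2).
  apply: cvgM => //; apply: cvgV; first by rewrite mulf_neq0.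
  exact: cvgMr.
rewrite (_ : l / _ = l * v ^+ 2 / 2); last by field; rewrite gt_eqF.
apply: cvg_trans; apply: near_eq_cvg; near=> m.
have m1 : (1 < m)%N by near: m; exact: nbhs_infty_gt.
rewrite /tree_ratio !count_sizedE -/(assoc_with F) -/(assoc_with setT) cnt_associative//.
by rewrite /ratio mulrA invf_div mulrA divfK.
Unshelve. all: by end_near.
Qed.

Lemma computing_children_cvg d (f : boolfun n) :
  cvgn (ratio V (cnt R (children_with (@fun_of_tree n) d f))).
Proof.
apply: (children_with_cvg n0 (@node_fun_cons n) (@node_fun1 n) (fun _ _ => erefl)
  (@op_fun_absorbing n)) => e; pose i : 'I_n := Ordinal n0.
(* [T] computes the absorbing constant for [e] but is itself labelled [e]; two copies of it under
   the dual label make an admissible child with the same value. *)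
pose T := Node e [:: Leaf (i, true); Leaf (i, false)].
exists (Node (dual_connective e) [:: T; T]); first by rewrite /T; case: (e).
by apply/ffunP => w; rewrite !ffunE /T; case: (e) => /=; rewrite /eval_literal /=;
  case: (w i).
Qed.

Let lim_const d := limn (ratio V (cnt R (children_with (@fun_of_tree n) d
  (const_fun n (neutral d))))).

Definition simple_forests d x : set (seq (tree n)) :=
  [set ts | forest d ts /\ simple_pair d x ts].

(** The factor 2 is for the two positions of [Leaf x], which differ because the other child is not a
    leaf; the shift accounts for the size of [Leaf x]. The size bound prevents a child counted on
    the right from being a leaf. *)
Lemma cnt_simple_forests d x m : (3 < m)%N -> cnt R (simple_forests d x) m =
  2 * sh (cnt R (children_with (@fun_of_tree n) d (const_fun n (neutral d)))) m.
Proof.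
move=> m3.
pose S : set (tree n) := [set t | [/\ child d t, ~~ is_leaf t &
  fun_of_tree t = const_fun n (neutral d)]].
have leafE : cnt R (single (leaf_set x)) =1 sh (delta0 R).
  move=> k; rewrite (@eq_cnt _ R _ (single [set t | exists2 l, pred1 x l & t = Leaf l])).
    by rewrite cnt_leaf card1 mul1r.
  move=> ts; split=> [[t -> ->]|[t [l /= /eqP -> ->] ->]]; last by exists (Leaf x).
  by exists (Leaf x) => //; exists x => //=; rewrite eqxx.
have SE : sh (cnt R (single S)) m =
    sh (cnt R (children_with (@fun_of_tree n) d (const_fun n (neutral d)))) m.
  case: m m3 => //= m m3; apply: eq_cnt_at => ts tm; split=> [[t [? ? ?] ->]|]; first by exists t.
  move=> [[l|c us] [ct tf] tsE]; first by move: m3; rewrite -tm tsE.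
  by exists (Node c us).
rewrite -SE mulr_natl mulr2n.
rewrite (cnt_split R (fun ts => if ts is t :: _ then is_leaf t else false)); congr (_ + _).
  rewrite (cnt_single_cat R (T := leaf_set x) (B := single S)) => [|ts].
    rewrite cauchyC (eq_cauchy (f' := cnt R (single S)) (g' := sh (delta0 R))) => //.
    by rewrite cauchy_shr; case: (m) => //= k; rewrite cauchy1r.
  split=> [[[fts [t [nl tf [tsE|tsE]]]] hl]|[_ [_ [[_ -> ->] [t [ct nl tf] ->] ->]]]].
  - rewrite tsE in fts *; apply: single_cons => //; apply: single_one; split=> //.
    by move: fts; rewrite /forest /= andbT.
  - by move: hl nl; rewrite tsE /= => ->.
  split=> //; split; first by rewrite /forest /= ct.
  by exists t; split=> //; left.
rewrite (cnt_single_cat R (T := S) (B := single (leaf_set x))) => [|ts].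
  rewrite (eq_cauchy (f' := cnt R (single S)) (g' := sh (delta0 R))) => //.
  by rewrite cauchy_shr; case: (m) => //= k; rewrite cauchy1r.
split=> [[[fts [t [nl tf [tsE|tsE]]]] hl]|[_ [_ [[t [ct nl tf] ->] [_ -> ->] ->]]]].
- by move: hl; rewrite tsE.
- rewrite tsE in fts *; apply: single_cons; last exact: single_one.
  by split=> //; move: fts; rewrite /forest /= andbT.
split=> //; split; first by rewrite /forest /= ct.
by exists t; split=> //; right.
Qed.

Lemma assoc_simpleP x t : Defs.associative t /\ simple_tree x t <->
  nodeset Conj (simple_forests Conj x) t \/ nodeset Disj (simple_forests Disj x) t.
Proof.
split=> [[at_ [_ [c [u [nu uf tE]]]]]|].
  have [ts [tE' sp]] : exists ts, t = Node c ts /\ simple_pair c x ts.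
    by case: tE => tE; rewrite tE; eexists; (split; first by []);
      exists u; split=> //; [left|right].
  move: at_; rewrite tE' associative_node => /andP[_ fts].
  by case: c {uf tE tE'} sp fts => sp fts; [left|right]; exists ts.
have core c : nodeset c (simple_forests c x) t -> Defs.associative t /\ simple_tree x t.
  move=> [ts [fts [u [nu uf tsE]]] ->].
  have at_ : Defs.associative (Node c ts).
    by rewrite associative_node fts andbT; case: tsE => ->.
  split=> //; split=> //; exists c, u; split=> //.
  by case: tsE => ->; [left|right].
by case=> /core.
Qed.

Lemma cnt_simple x m : (4 < m)%N -> cnt R (assoc_with (simple_tree x)) m =
  2 * sh (sh (cnt R (children_with (@fun_of_tree n) Conj (const_fun n true)))) m +
  2 * sh (sh (cnt R (children_with (@fun_of_tree n) Disj (const_fun n false)))) m.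
Proof.
move=> m4.
have h d : sh (cnt R (simple_forests d x)) m =
    2 * sh (sh (cnt R (children_with (@fun_of_tree n) d (const_fun n (neutral d))))) m.
  by case: m m4 => // m m4 /=; rewrite cnt_simple_forests.
rewrite -(h Conj) -(h Disj) -(@cnt_nodeset n R Conj (simple_forests Conj x))
  -(@cnt_nodeset n R Disj (simple_forests Disj x)).
rewrite (cnt_split R (fun ts => if ts is [:: Node Conj _] then true else false)).
congr (_ + _); apply: eq_cnt => ts; split.
- by move=> [[t /assoc_simpleP[h1|[us _ ->]] ->]] //= _; exists t.
- move=> [t h1 ->]; split; last by case: h1 => us _ ->.
  by exists t => //; apply/assoc_simpleP; left.
- by move=> [[t /assoc_simpleP[[us _ ->]|h1] ->]] //= _; exists t.
move=> [t h1 ->]; split; last by case: h1 => us _ ->.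
by exists t => //; apply/assoc_simpleP; right.
Qed.

Let const_cvg d : ratio V (cnt R (children_with (@fun_of_tree n) d
  (const_fun n (neutral d)))) @ \oo --> lim_const d.
Proof. exact: computing_children_cvg. Qed.

Let ratio_sh_cvg f (l : R) : ratio V f @ \oo --> l -> ratio V (sh f) @ \oo --> rho * l.
Proof.
move=> fl; rewrite -(cvg_shiftS (ratio V (sh f))).
rewrite (_ : (fun _ => _) = fun m => ratio V f m * (V m / V m.+1)).
  by rewrite mulrC; apply: cvgM => //; exact: growth_inv_ratio_cvg.
by apply/funext => m; rewrite (ratio_sh N2 V0 Vrec).
Qed.

Lemma simple_cvg x : ratio V (cnt R (assoc_with (simple_tree x))) @ \oo -->
  2 * rho ^+ 2 * (lim_const Conj + lim_const Disj).
Proof.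
pose f d := cnt R (children_with (@fun_of_tree n) d (const_fun n (neutral d))).
have : (fun m => 2 * ratio V (sh (sh (f Conj))) m + 2 * ratio V (sh (sh (f Disj))) m)
    @ \oo --> 2 * (rho * (rho * lim_const Conj)) + 2 * (rho * (rho * lim_const Disj)).
  by apply: cvgD; apply: cvgMr; do 2!apply: ratio_sh_cvg; exact: const_cvg.
rewrite (_ : _ + _ = 2 * rho ^+ 2 * (lim_const Conj + lim_const Disj)); last by ring.
apply: cvg_trans; apply: near_eq_cvg; near=> m.
have m4 : (4 < m)%N by near: m; exact: nbhs_infty_gt.
have -> : ratio V (cnt R (assoc_with (simple_tree x))) m =
    2 * ratio V (sh (sh (f Conj))) m + 2 * ratio V (sh (sh (f Disj))) m.
  by rewrite {1}/ratio cnt_simple// mulrDl /ratio !mulrA.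
by [].
Unshelve. all: by end_near.
Qed.

Lemma computing_cvg f : cvgn (ratio V (cnt R (assoc_with (computing f)))).
Proof.
pose g d := ratio V (cnt R (children_with (@fun_of_tree n) d f)).
apply/cvg_ex; exists (limn (g Conj) + limn (g Disj)).
have : (fun m => g Conj m + g Disj m) @ \oo --> limn (g Conj) + limn (g Disj).
  by apply: cvgD; exact: computing_children_cvg.
apply: cvg_trans; apply: near_eq_cvg; near=> m.
rewrite /ratio cnt_assoc_with; last by near: m; exact: nbhs_infty_gt.
by rewrite mulrDl.
Unshelve. all: by end_near.
Qed.

Lemma cnt_computing x m : (1 < m)%N ->
  cnt R (assoc_with (simple_tree x)) m <= cnt R (assoc_with (computing (literal_fun x))) m
  <= cnt R (assoc_with (simple_tree x)) m +
     (sh (cnt R (nonsimple Conj x)) m + sh (cnt R (nonsimple Disj x)) m).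
Proof.
move=> m1; apply/andP; split.
  by apply: cnt_sub => ts [t [at_ /simple_tree_computes st] ->]; exists t.
rewrite -(@cnt_nodeset n R Conj (nonsimple Conj x))
  -(@cnt_nodeset n R Disj (nonsimple Disj x)).
rewrite (cnt_split R (fun ts => `[< assoc_with (simple_tree x) ts >])).
apply: lerD; first by apply: cnt_sub => ts [_ /asboolP].
set A := single (nodeset Conj _); set B := single (nodeset Disj _).
apply: (@le_trans _ _ (cnt R (A `|` B) m)); last exact: cnt_subU.
apply: cnt_sub_at => ts tm [[t [at_ tx] tsE] /asboolPn ns].
case: t at_ tx tsE => [l|c us] at_ tx tsE; first by move: m1; rewrite -tm tsE.
have := at_; rewrite associative_node => /andP[s2 fus].
have us_ns : nonsimple c x us.
  split=> // -[u [nu uf usE]]; apply: ns; exists (Node c us) => //; split=> //.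
  by split=> //; exists c, u; split=> //; case: usE => ->; [left|right].
have cover : single (nodeset c (nonsimple c x)) ts.
  by exists (Node c us) => //; exists us.
by case: c cover {us_ns fus at_ tx ns tsE} => cover; [left|right].
Qed.

Lemma computing_simple_lim x lx ls :
  ratio V (cnt R (assoc_with (computing (literal_fun x)))) @ \oo --> lx ->
  ratio V (cnt R (assoc_with (simple_tree x))) @ \oo --> ls ->
  0 <= lx - ls <= 2 * rho * ((550 * 7132 ^+ 2 + 2 * 7132 + 8324) * q ^+ 5).
Proof.
move=> hx hs; set K : R := 550 * _ + _ + _.
have hd := cvgB hx hs.
(* The comparison is made for sizes above 1, while a majorant is needed at every size; the value 0
   below leaves the limit unchanged. *)
pose h m : R := if (1 < m)%N then cnt R (assoc_with (computing (literal_fun x))) m -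
  cnt R (assoc_with (simple_tree x)) m else 0.
have {}hd : ratio V h @ \oo --> lx - ls.
  move: hd => /(_ eventually_filter); apply: cvg_trans; apply: near_eq_cvg; near=> m.
  have m1 : (1 < m)%N by near: m; exact: nbhs_infty_gt.
  by rewrite /ratio /h m1 /= mulrBl.
have h0 m : 0 <= h m.
  rewrite /h; case: ifP => // m1; rewrite subr_ge0.
  by have /andP[] := cnt_computing x m1.
apply/andP; split.
  rewrite -(cvg_lim (@Rhausdorff R) hd); apply: limr_ge; first by apply: cvgP hd.
  by near=> m; rewrite /ratio divr_ge0// ltW.
have [w1 u1] := ubs_nonsimple R n0 Conj x; have [w2 u2] := ubs_nonsimple R n0 Disj x.
have u := ubD (ub_sh N2 V0 Vrec u1) (ub_sh N2 V0 Vrec u2).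
have {}u : ub N V h (radius N * w1 + radius N * w2)
    (radius N * (K * q ^+ 5) + radius N * (K * q ^+ 5)).
  apply: ub_le u _ _ _ => // m; rewrite h0 /= /h; case: ifP => [m1|_].
    by rewrite lerBlDl; have /andP[] := cnt_computing x m1.
  by case: m => [|m] /=; rewrite addr_ge0 ?cnt_ge0.
apply: le_trans (ub_lim N2 V0 Vrec u hd) _.
by rewrite -mulrA mulr_natl mulr2n.
Unshelve. all: by end_near.
Qed.

Lemma simple_lim_ge : 16 <= s ->
  rho ^+ 3 / 257 <= 2 * rho ^+ 2 * (lim_const Conj + lim_const Disj).
Proof.
move=> s16.
have hC := children_const_lim_ge n0 s16 (@const_cvg Conj).
have hD := children_const_lim_ge n0 s16 (@const_cvg Disj).
have -> : rho ^+ 3 / 257 = 2 * rho ^+ 2 * (rho / 1028 + rho / 1028) by field.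
by rewrite ler_wpM2l ?lerD// mulr_ge0// exprn_ge0// ltW.
Qed.

Lemma proportion_cvg (f : boolfun n) : cvgn (proportion R f).
Proof.
by apply: cvgP; apply: tree_ratio_cvg; exact: computing_cvg.
Qed.

Lemma simple_ratio_cvg (x : literal n) : cvgn (tree_ratio R (simple_tree x)).
Proof. by apply: cvgP; apply: tree_ratio_cvg; exact: simple_cvg. Qed.

(** [4626 = 2 * 9 * 257]: the two root labels, the bound [((s + 2) / s) ^+ 2 <= 9] in replacing
    [q ^+ 4] by [rho ^+ 2], and the constant of [simple_lim_ge]. *)
Lemma probability_sub_simple (x : literal n) : 16 <= s ->
  `|limiting_probability R (literal_fun x) - limiting_ratio R (simple_tree x)| <=
  4626 * (550 * 7132 ^+ 2 + 2 * 7132 + 8324) / s * `|limiting_ratio R (simple_tree x)|.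
Proof.
move=> s16.
have : 0 <= 550 * 7132 ^+ 2 + 2 * 7132 + 8324 :> R.
  apply: addr_ge0; last exact: ler0n.
  apply: addr_ge0; apply: mulr_ge0; try exact: ler0n.
  by apply: exprn_ge0; exact: ler0n.
have := @computing_simple_lim x; move: (550 * 7132 ^+ 2 + 2 * 7132 + 8324) => K csl K0.
have hx := @computing_cvg (literal_fun x).
have /andP[d0 dle] := csl _ _ hx (@simple_cvg x).
have ls_ge := simple_lim_ge s16.
rewrite /limiting_probability /limiting_ratio.
rewrite (cvg_lim (@Rhausdorff R) (tree_ratio_cvg hx)).
rewrite (cvg_lim (@Rhausdorff R) (tree_ratio_cvg (@simple_cvg x))).
move: d0 dle ls_ge; set lx := limn _; set ls := 2 * rho ^+ 2 * _ => d0 dle ls_ge.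
clearbody lx ls.
have ls0 : 0 <= ls.
  apply: le_trans ls_ge; apply: divr_ge0; last exact: ler0n.
  by apply: exprn_ge0; exact: ltW.
have vv : 0 < v ^+ 2 / 2 by rewrite divr_gt0// exprn_gt0.
have -> : lx * v ^+ 2 / 2 - ls * v ^+ 2 / 2 = (lx - ls) * (v ^+ 2 / 2) by ring.
have -> : ls * v ^+ 2 / 2 = ls * (v ^+ 2 / 2) by ring.
rewrite !normrM (ger0_norm d0) (ger0_norm ls0) [leRHS]mulrA; apply: ler_wpM2r; first exact: mulr_ge0.
apply: le_trans dle _.
have rE : rho = (s * (s + 2))^-1 := radiusE N2.
have h1 : q ^+ 5 * rho <= 9 * q * rho ^+ 3.
  have -> : q ^+ 5 * rho = q * rho ^+ 3 * ((s + 2) / s) ^+ 2.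
    by rewrite /q rE; field; rewrite !gt_eqF// ?addr_gt0.
  rewrite [leRHS](_ : _ = q * rho ^+ 3 * 3 ^+ 2); last by ring.
  apply: ler_wpM2l.
    by apply: mulr_ge0; [rewrite invr_ge0 ltW|apply: exprn_ge0; exact: ltW].
  rewrite lerXn2r ?nnegrE ?divr_ge0 ?addr_ge0 ?(ltW s_gt0)//.
  by rewrite ler_pdivrMr//; lra.
have h2 : q * rho ^+ 3 <= 257 * (q * ls).
  rewrite [leRHS]mulrCA; apply: ler_wpM2l; first by rewrite invr_ge0 ltW.
  by rewrite -ler_pdivrMl ?ltr0n// mulrC.
have h3 := ler_wpM2l K0 (le_trans h1 (_ : _ <= 9 * (257 * (q * ls)))).
rewrite [leLHS](_ : _ = 2 * (K * (q ^+ 5 * rho))); last by ring.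
rewrite [leRHS](_ : _ = 2 * (K * (9 * (257 * (q * ls))))); last by rewrite /q; ring.
by rewrite ler_pM2l// h3// -mulrA ler_pM2l.
Qed.

End Limits.

Theorem mainTheorem13 (R : realType) (x : forall n : nat, literal n.+1) :
  [/\ forall n : nat, cvgn (proportion R (literal_fun (x n))),
      forall n : nat, cvgn (tree_ratio R (simple_tree (x n)))
    & (fun n : nat => limiting_probability R (literal_fun (x n)))
        ~_\oo (fun n : nat => limiting_ratio R (simple_tree (x n)))].
Proof.
split=> [n|n|]; [exact: proportion_cvg|exact: simple_ratio_cvg|].
apply/eqaddoP => eps eps0.
have K0 : 0 <= 550 * 7132 ^+ 2 + 2 * 7132 + 8324 :> R.
  apply: addr_ge0; last exact: ler0n.
  apply: addr_ge0; apply: mulr_ge0; try exact: ler0n.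
  by apply: exprn_ge0; exact: ler0n.
have bound n := @probability_sub_simple R n.+1 (ltn0Sn n) (x n).
move: (550 * 7132 ^+ 2 + 2 * 7132 + 8324) K0 bound => K' K'0 bound.
have K0 : 0 <= 4626 * K' by rewrite mulr_ge0 ?ler0n.
move: (4626 * K') K0 bound => K K0 bound.
(* The summand 16 meets the hypothesis of [probability_sub_simple], and [K / eps] makes the relative
   error at most [eps]. *)
have [M _ HM] : \forall n \near \oo, (16 + K / eps) ^+ 2 <= (2 * n.+1)%:R.
  near=> n; apply: (@le_trans _ _ n%:R); last by rewrite ler_nat; lia.
  by near: n; exact: nbhs_infty_ger.
exists M => // n /= /HM /= sn.
have Ke0 : 0 <= K / eps by rewrite divr_ge0// ltW.
have s_ge : 16 + K / eps <= Num.sqrt (2 * n.+1)%:R :> R.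
  rewrite -[leLHS]ger0_norm ?addr_ge0// -sqrtr_sqr; exact: ler_wsqrtr.
have s16 : 16 <= Num.sqrt (2 * n.+1)%:R :> R.
  by apply: le_trans s_ge; rewrite lerDl.
have s0 : 0 < Num.sqrt (2 * n.+1)%:R :> R := lt_le_trans (ltr0n R 16) s16.
apply: le_trans (bound n s16) _.
apply: ler_wpM2r; first exact: normr_ge0.
rewrite ler_pdivrMr// mulrC -ler_pdivrMr//.
by apply: le_trans s_ge; rewrite lerDr.
Unshelve. all: by end_near.
Qed.
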